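(* Let $G$ be an $m$-dimensional complex Lie group with identity element $e$ and holomorphic Lie algebra $\mathfrak g=T^{1,0}_eG$, and let $\Omega$ be a domain in $G$. Fix a basis $\varepsilon=(\varepsilon_1,\dots,\varepsilon_m)$ of $\mathfrak g$. Let $N$ be a compact Hermitian manifold and let $\mathscr F$ be a family of holomorphic mappings from $\Omega$ to $N$. Let $p_0\in\Omega$. Then $\mathscr F$ is not normal at $p_0$ if and only if there exist (a) a sequence $\{f_j\}_{j=1}^{+\infty}\subset\mathscr F$; (b) a sequence $\{p_j\}_{j=1}^{+\infty}\subset\Omega$ with $p_j\to p_0$ as $j\to+\infty$; (c) a sequence $\{\rho_j\}_{j=1}^{+\infty}\subset\mathbb R$ with $0<\rho_j\to 0$ as $j\to+\infty$ such that the sequence $$\phi_j(z):=f_j\circ\exp_{p_j}\big(\rho_j\,(dL_{p_j})_e(\varepsilon z^T)\big),\qquad j=1,2,\dots$$ converges uniformly on compact subsets of $\mathbb C^m$ to a nonconstant holomorphic mapping $\phi:\mathbb C^m\to N$. Here $z^T$ is the transpose of $z=(z_1,\dots,z_m)$, so that $\varepsilon z^T=\sum_{k=1}^m z_k\varepsilon_k\in\mathfrak g$.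
   Context: A complex Lie group $G$ is a complex manifold with a group structure whose multiplication and inversion are holomorphic. $T^{1,0}_gG$ denotes the holomorphic tangent space of $G$ at $g$. For $g\in G$, $L_g:G\to G$, $L_g(h)=gh$, is the left translation, and $(dL_g)_h:T^{1,0}_hG\to T^{1,0}_{gh}G$ is its differential at $h$. Exponential mapping at $g$: each $\xi\in T^{1,0}_gG$ generates a unique left-invariant holomorphic vector field $\tilde\xi$ on $G$, $\tilde\xi_h=(dL_{hg^{-1}})_g(\xi)$, with $\tilde\xi_g=\xi$. Let $\gamma_\xi:\mathbb C\to G$ be the unique holomorphic curve with $\gamma_\xi'=\tilde\xi_{\gamma_\xi}$ and $\gamma_\xi(0)=g$. Then $\exp_g:T^{1,0}_gG\to G$ is defined by $\exp_g(\xi)=\gamma_\xi(1)$; it is holomorphic. Normality: for complex manifolds $M,N$, let $\mathscr C(M,N)$ be the set of continuous mappings $M\to N$ with the compact-open topology. A family $\mathscr F\subset\mathscr C(M,N)$ is normal (on $M$) if each sequence in $\mathscr F$ contains a subsequence which is either relatively compact in $\mathscr C(M,N)$ or compactly divergent. The family is normal at a point $p_0$ if its restriction to some open neighborhood of $p_0$ is normal on that neighborhood. Convergence: $\phi_j$ is defined at those $z\in\mathbb C^m$ for which $\exp_{p_j}(\rho_j(dL_{p_j})_e(\varepsilon z^T))\in\Omega$; uniform convergence on compact subsets of $\mathbb C^m$ means that for every compact $K\subset\mathbb C^m$, $\phi_j$ is defined on $K$ for all sufficiently large $j$ and $\phi_j\to\phi$ uniformly on $K$ (with respect to a distance function on $N$).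 *)

(* Defs.v *)
From HB Require Import structures.
From mathcomp Require Export all_boot all_order all_algebra.
From mathcomp Require Export all_classical all_reals all_analysis.
From mathcomp Require Export complex.

Set Implicit Arguments.
Unset Strict Implicit.
Unset Printing Implicit Defensive.

Import Order.TTheory GRing.Theory Num.Theory.
Export numFieldNormedType.Exports.

Local Open Scope ring_scope.
Local Open Scope complex_scope.
Local Open Scope classical_set_scope.

(* The complex plane gets its norm topology through the regular module R[i]^o
   of the field R[i]; R[i] itself is a module over R in the complex library. *)
HB.instance Definition _ (R : realType) :=
  PseudoPointedMetric.copy R[i] R[i]^o.

(** * Complex manifolds *)

(* [chart_fun] and [chart_inv] are total functions; only their restrictions to
   [chart_dom] and to its image are meaningful.  *)
Record chart (R : realType) (n : nat) (M : topologicalType) := Chart {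
  chart_dom : set M ;
  chart_fun :> M -> 'rV[R[i]]_n ;
  chart_inv : 'rV[R[i]]_n -> M ;
  chart_dom_open : open chart_dom ;
  chart_cod_open : open (chart_fun @` chart_dom) ;
  chart_funK : {in chart_dom, cancel chart_fun chart_inv} ;
  chart_fun_cont : {in chart_dom, continuous chart_fun} ;
  chart_inv_cont : {in chart_fun @` chart_dom, continuous chart_inv}
}.

(* [differentiable] between normed modules over R[i] is Fréchet
   differentiability with an R[i]-linear differential; required at every point
   of an open set, it is holomorphy.
   [chart_at p] is a preferred chart around p: it is used to give coordinates
   to tangent vectors at p. *)
HB.mixin Record isComplexManifold (R : realType) (n : nat) M
    of Topological M := {
  atlas : set (chart R n M) ;
  chart_at : M -> chart R n M ;
  atlas_chart_at : forall p : M, atlas (chart_at p) ;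
  mem_chart_at : forall p : M, chart_dom (chart_at p) p ;
  atlas_compatible : forall (a b : chart R n M) (p : M), atlas a -> atlas b ->
    chart_dom a p -> chart_dom b p -> differentiable (b \o chart_inv a) (a p) ;
  manifold_hausdorff : hausdorff_space M ;
  manifold_second_countable : @second_countable M
}.

#[short(type="complexManifold")]
HB.structure Definition ComplexManifold (R : realType) (n : nat) :=
  {M of isComplexManifold R n M & Topological M}.

(* The holomorphic tangent space at p, a tangent vector being given by its
   complex coordinates in the chart [chart_at p]. *)
Definition tangent (R : realType) (n : nat) (M : complexManifold R n) (p : M) :
  Type := 'rV[R[i]]_n.

Section holomorphic.
Context (R : realType) (n k : nat).
Context (M : complexManifold R n) (N : complexManifold R k).

Definition in_charts (f : M -> N) (p : M) : 'rV[R[i]]_n -> 'rV[R[i]]_k :=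
  chart_at (f p) \o f \o chart_inv (chart_at p).

(* To be used for U open. *)
Definition holomorphic_on (U : set M) (f : M -> N) : Prop :=
  forall p, U p -> {for p, continuous f} /\
    differentiable (in_charts f p) (chart_at p p).

Definition mdiff (f : M -> N) (p : M) (v : tangent p) : tangent (f p) :=
  'd (in_charts f p) (chart_at p p) v.

End holomorphic.

(* Maps into M from a complex normed space, such as C or C^m. *)
Definition holomorphic_from (R : realType) (V : normedModType R[i]) (n : nat)
    (M : complexManifold R n) (f : V -> M) : Prop :=
  forall z, {for z, continuous f} /\ differentiable (chart_at (f z) \o f) z.

Definition velocity (R : realType) (n : nat) (M : complexManifold R n)
    (c : R[i]^o -> M) (t : R[i]^o) : tangent (c t) :=
  'D_1 (chart_at (c t) \o c : R[i]^o -> 'rV[R[i]]_n) t.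

(** * Complex Lie groups *)

HB.mixin Record isComplexLieGroup (R : realType) (n : nat) G
    of Group G & ComplexManifold R n G := {
  mulg_continuous : continuous (fun x : G * G => (x.1 * x.2)%g) ;
  (* holomorphy of G * G -> G in the product charts of G * G *)
  mulg_differentiable : forall p q : G,
    differentiable
      (fun w : 'rV[R[i]]_n * 'rV[R[i]]_n =>
         chart_at (p * q)%g
           (chart_inv (chart_at p) w.1 * chart_inv (chart_at q) w.2)%g)
      (chart_at p p, chart_at q q) ;
  invg_holomorphic : holomorphic_on [set: G] (fun x : G => x^-1%g)
}.

#[short(type="complexLieGroup")]
HB.structure Definition ComplexLieGroup (R : realType) (n : nat) :=
  {G of Group G & ComplexManifold R n G & isComplexLieGroup R n G}.

Section exponential.
Context (R : realType) (n : nat) (G : complexLieGroup R n).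

Definition Ltrans (g : G) : G -> G := fun h => (g * h)%g.

Definition dL (g h : G) : tangent h -> tangent (Ltrans g h) :=
  @mdiff R n n G G (Ltrans g) h.
Arguments dL : clear implicits.

(* The type of the right-hand side is [tangent (h * g^-1 * g)], where
   h * g^-1 * g = h. *)
Definition left_invariant_field (g : G) (xi : tangent g) (h : G) : tangent h :=
  dL (h * g^-1)%g g xi.

Definition integral_curve (g : G) (xi : tangent g) (c : R[i]^o -> G) : Prop :=
  [/\ holomorphic_from c, c 0 = g &
      forall t, velocity c t = left_invariant_field xi (c t)].

(* [xget] selects the (unique) integral curve; the default value is
   irrelevant. *)
Definition exp_at (g : G) (xi : tangent g) : G :=
  xget (fun=> g) [set c | integral_curve xi c] 1.

End exponential.

Arguments dL {R n G} g h _.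
Arguments exp_at {R n G} g _.

(** * Hermitian manifolds *)

(* C^r functions of the underlying real variables, on an open set U: all
   iterated real directional derivatives of order <= r exist on U and are
   continuous there. *)
Fixpoint real_Cr (R : realType) (n : nat) (r : nat) (U : set 'rV[R[i]]_n)
    (f : 'rV[R[i]]_n -> R[i]^o) : Prop :=
  (forall x, U x -> {for x, continuous f}) /\
  if r is r'.+1 then
    forall v, exists2 g : 'rV[R[i]]_n -> R[i]^o,
      (forall x, U x ->
         (t^-1)%:C *: (f (x + t%:C *: v) - f x) @[t --> (0 : R)^'] --> g x) &
      real_Cr r' U g
  else True.

Definition smooth_on (R : realType) (n : nat) (U : set 'rV[R[i]]_n)
    (f : 'rV[R[i]]_n -> R[i]^o) : Prop :=
  forall r, real_Cr r U f.

(* The coordinate vector field of the chart a with constant components v, at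
   the point of coordinates x in a. *)
Definition coord_field (R : realType) (n : nat) (M : complexManifold R n)
    (a : chart R n M) (v x : 'rV[R[i]]_n) : tangent (chart_inv a x) :=
  'd (chart_at (chart_inv a x) \o chart_inv a) x v.

HB.mixin Record isHermitian (R : realType) (n : nat) M
    of ComplexManifold R n M := {
  hmetric : forall p : M, tangent p -> tangent p -> R[i] ;
  hmetric_linear : forall (p : M) (c : R[i]) (u v w : tangent p),
    hmetric p (c *: u + v) w = c * hmetric p u w + hmetric p v w ;
  hmetric_conj : forall (p : M) (u v : tangent p),
    hmetric p v u = (hmetric p u v)^* ;
  hmetric_pos : forall (p : M) (u : tangent p), u != 0 -> 0 < hmetric p u u ;
  hmetric_smooth : forall (a : chart R n M) (u v : 'rV[R[i]]_n),
    atlas a ->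
    smooth_on (a @` chart_dom a)
      (fun x => hmetric (chart_inv a x) (coord_field a u x) (coord_field a v x))
}.

#[short(type="hermitianManifold")]
HB.structure Definition HermitianManifold (R : realType) (n : nat) :=
  {M of ComplexManifold R n M & isHermitian R n M}.

(** * Normal families *)

Section normal.
Context (M N : topologicalType).

(* C(M, N) with the compact-open topology *)
Definition cont_compact_open : topologicalType :=
  initial_topology (id : continuousType M N -> {compact-open, M -> N}).

Definition compactly_divergent (f : nat -> continuousType M N) : Prop :=
  forall (K : set M) (L : set N), compact K -> compact L ->
    \forall j \near \oo, (f j @` K) `&` L = set0.

Definition normal (F : set (continuousType M N)) : Prop :=
  forall f : nat -> continuousType M N, (forall j, F (f j)) ->
  exists2 s : nat -> nat, {homo s : i j / (i < j)%N} &
    precompact (range (f \o s) : set cont_compact_open) \/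
    compactly_divergent (f \o s).

End normal.

(* The values of the members of F outside Omega play no role. *)
Definition normal_at (M N : topologicalType) (Omega : set M) (F : set (M -> N))
    (p : M) : Prop :=
  exists U : set M, [/\ open U, U p, U `<=` Omega &
    normal [set g : continuousType (set_type U) N |
      exists2 f, F f & forall x : set_type U, g x = f (set_val x)]].

(** * Uniform convergence on compact sets *)

(* d is a metric on N that induces the topology of N. *)
Definition distance_on (R : realType) (N : topologicalType) (d : N -> N -> R) :
    Prop :=
  [/\ forall x y, (d x y = 0) <-> (x = y),
      forall x y, d x y = d y x,
      forall x y z, d x z <= d x y + d y z &
      forall x (A : set N), nbhs x A <->
        exists2 r : R, 0 < r & [set y | d x y < r] `<=` A].

(* Convergence, uniform on compact sets, of maps phi_ j that are defined only
   on D j. *)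
Definition cvg_on_compacts (R : realType) (T N : topologicalType)
    (d : N -> N -> R) (D : nat -> set T) (phi_ : nat -> T -> N) (phi : T -> N) :
    Prop :=
  forall K : set T, compact K ->
    (\forall j \near \oo, K `<=` D j) /\
    (forall e : R, 0 < e ->
       \forall j \near \oo, forall z, K z -> d (phi_ j z) (phi z) < e).

(* Main.v *)
From HB Require Import structures.
Require Import Defs.
From mathcomp Require Import ring lra zify.

Set Implicit Arguments.
Unset Strict Implicit.
Unset Printing Implicit Defensive.

Import Order.TTheory GRing.Theory Num.Theory.
Local Open Scope ring_scope.
Local Open Scope complex_scope.
Local Open Scope classical_set_scope.

(** Zalcman's rescaling, in the exponential coordinates of the group.

    If F is not normal at p0, then near p0 the members of F move points that are
    very close to each other by a fixed amount. Suitable centres and scales being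
    chosen, the members of F, seen through a microscope that makes this fixed
    amount visible at distance 1, do not move points of bounded distance more
    wildly than near the centre, on balls that exhaust the space. The rescaled
    maps are then equicontinuous, a subsequence converges to a holomorphic map on
    C^m ([ultra_equicontinuous], [ultra_holomorphic]), and the limit is not
    constant because the fixed amount is still there at distance 1 ([zalcman]).
    Conversely, if the rescaled maps converge to a map with different values at z
    and at 0, the points that they come from both tend to p0, while their images
    stay apart: a normal family, which is equicontinuous as N is compact, does
    not allow this ([normal_not_separating]).

    The expansion of a map f at a point is not measured by a derivative but by
    the radius r of a ball of the translated frame on which f moves by at most
    delta ([tame]). Here delta is a Lebesgue number for the covering of N by
    bounded charts ([chart_scale]): a holomorphic map that moves points by at
    most delta is read in one chart as a bounded holomorphic map, and the Cauchy
    estimates make it Lipschitz at the scale r. The centres are found by Hofer's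
    doubling argument ([rescaling_point]).

    Two bodies of theory support this. The Cauchy estimates of order 1 and 2
    ([cauchy_estimates]) come from dyadic sums along the sides of squares in
    place of contour integrals: Goursat's bisection gives a maximum principle up
    to the factor 5, applying it to powers removes the factor, and the maximum
    principle for difference quotients gives the estimates. They yield
    Weierstrass' theorem for limits along an ultrafilter ([weierstrass]) and the
    bound on mixed differences that makes the group law additive up to a
    bilinear error ([mixed_difference]).

    The exponential of x is then the limit of (x / N)^N, the factors being taken
    in a chart at the identity; the limit is holomorphic by Weierstrass' theorem
    and has the derivative of a one-parameter subgroup ([generates_Exp]). Two
    curves with the same left-invariant velocity have a constant quotient
    ([quot_constant]), so that the integral curves in the definition of the
    exponential are the ones constructed ([exp_at_GExp]). The group enters the
    rescaling only through [exp_frame]. *)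

(** * Real-valued norms *)

Section RealNorm.
Context {R : realType}.
Local Notation C := R[i].

Definition nrm (V : normedZmodType C) (x : V) : R := complex.Re `|x|.

Lemma nrmE (V : normedZmodType C) (x : V) : `|x| = (nrm x)%:C.
Proof.
have := normr_ge0 x; rewrite lecE /= => /andP[/eqP h _].
by rewrite /nrm; case: `|x| h => a b /= ->.
Qed.

Lemma nrm_ge0 (V : normedZmodType C) (x : V) : 0 <= nrm x.
Proof. by rewrite -ler0c -nrmE. Qed.

Lemma nrm0 (V : normedZmodType C) : nrm (0 : V) = 0.
Proof. by rewrite /nrm normr0. Qed.

Lemma nrm0_eq0 (V : normedZmodType C) (x : V) : nrm x = 0 -> x = 0.
Proof. by move=> h; apply/normr0_eq0; rewrite nrmE h. Qed.

Lemma nrmN (V : normedZmodType C) (x : V) : nrm (- x) = nrm x.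
Proof. by rewrite /nrm normrN. Qed.

Lemma nrmBC (V : normedZmodType C) (x y : V) : nrm (x - y) = nrm (y - x).
Proof. by rewrite /nrm distrC. Qed.

Lemma nrmD (V : normedZmodType C) (x y : V) : nrm (x + y) <= nrm x + nrm y.
Proof. by rewrite -lecR rmorphD /= -!nrmE ler_normD. Qed.

Lemma nrmB (V : normedZmodType C) (x y : V) : nrm (x - y) <= nrm x + nrm y.
Proof. by rewrite -(nrmN y) nrmD. Qed.

Lemma nrmB_le (V : normedZmodType C) (x y : V) : nrm x - nrm y <= nrm (x - y).
Proof. by have := nrmD (x - y) y; rewrite subrK; lra. Qed.

Lemma nrm_tri (V : normedZmodType C) (y x z : V) :
  nrm (x - z) <= nrm (x - y) + nrm (y - z).
Proof. by rewrite -[x - z](subrKA y) nrmD. Qed.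

Lemma nrmM (x y : C) : nrm (x * y) = nrm x * nrm y.
Proof. by apply: (@complexI R); rewrite -nrmE normrM !nrmE -rmorphM. Qed.

Lemma nrm1 : nrm (1 : C) = 1.
Proof. by rewrite /nrm normr1. Qed.

Lemma nrmX (x : C) n : nrm (x ^+ n) = nrm x ^+ n.
Proof. by elim: n => [|n ih]; rewrite ?nrm1 // !exprS nrmM ih. Qed.

Lemma nrmV (x : C) : nrm x^-1 = (nrm x)^-1.
Proof. by apply: (@complexI R); rewrite -nrmE normfV !nrmE fmorphV. Qed.

Lemma nrmZ (V : normedModType C) (a : C) (x : V) : nrm (a *: x) = nrm a * nrm x.
Proof. by apply: (@complexI R); rewrite -nrmE normrZ !nrmE -rmorphM. Qed.

Lemma nrmR (a : R) : nrm (a%:C) = `|a|.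
Proof. by rewrite /nrm normc_def /= expr0n addr0 sqrtr_sqr. Qed.

Lemma nrm_Re (z : C) : `|complex.Re z| <= nrm z.
Proof. by rewrite -lecR -nrmE normc_ge_Re. Qed.

Lemma nrm_i : nrm ('i%C : C) = 1.
Proof. by rewrite /nrm normc_def /= expr0n add0r expr1n sqrtr1. Qed.

Lemma nrm_Im (z : C) : `|complex.Im z| <= nrm z.
Proof.
have := nrm_Re (z * 'i%C); by rewrite nrmM nrm_i mulr1 ReiNIm normrN.
Qed.

Lemma nrm_ReIm (z : C) : nrm z <= `|complex.Re z| + `|complex.Im z|.
Proof.
rewrite {1}[z]complexE (le_trans (nrmD _ _))// nrmM nrm_i mul1r.
by rewrite !nrmR.
Qed.

Lemma nrm_gt0 (V : normedZmodType C) (x : V) : (0 < nrm x) = (x != 0).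
Proof.
rewrite lt0r nrm_ge0 andbT; congr (~~ _); apply/eqP/eqP => [/nrm0_eq0//|->].
exact: nrm0.
Qed.

(** The filter [nbhs x] of a normed space over [R[i]] has as a base the balls of
    real radius, since a positive complex number is real. *)
Lemma nbhs_nrmP (V : normedModType C) (x : V) (A : set V) :
  nbhs x A <-> exists2 e : R, 0 < e & forall y, nrm (y - x) < e -> A y.
Proof.
split.
- move=> /nbhs_normP [e /= e0 h].
  have [e0' er] : 0 < complex.Re e /\ (complex.Re e)%:C = e.
    by move: e0; rewrite ltcE /= => /andP[/eqP]; case: e {h} => a b /= -> ->.
  exists (complex.Re e) => // y hy; apply: h => /=.
  by rewrite distrC nrmE -er ltcR.
- case=> e e0 h; apply/nbhs_normP; exists e%:C => /=; first by rewrite ltcR.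
  by move=> y /=; rewrite distrC nrmE ltcR; exact: h.
Qed.

Lemma cvg_nrmP (T : Type) (F : set_system T) {FF : Filter F} (V : normedModType C)
  (f : T -> V) (l : V) :
  f @ F --> l <-> forall e : R, 0 < e -> \forall t \near F, nrm (f t - l) < e.
Proof.
split=> [h e e0|h A /nbhs_nrmP [e e0 hA]].
  have /h : nbhs l [set y | nrm (y - l) < e] by apply/nbhs_nrmP; exists e.
  by [].
by apply: filterS (h e e0) => t /hA.
Qed.

Lemma continuous_nrmP (V W : normedModType C) (f : V -> W) (x : V) :
  {for x, continuous f} <-> forall e : R, 0 < e -> exists2 del, 0 < del &
    forall h, nrm h < del -> nrm (f (x + h) - f x) < e.
Proof.
split.
- move=> /cvg_nrmP h e /h /nbhs_nrmP [del d0 hd]; exists del => // k kd.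
  by apply: hd; rewrite addrAC subrr add0r.
- move=> h; apply/cvg_nrmP => e /h [del d0 hd]; apply/nbhs_nrmP.
  exists del => // y hy; have := hd _ hy; by rewrite [x + _]addrC subrK.
Qed.

(** * Differentiability by estimates *)

Lemma differentiable_nrm (V W : normedModType C) (f : V -> W) (x : V) :
  differentiable f x -> forall e : R, 0 < e -> exists2 del, 0 < del &
    forall h, nrm h < del -> nrm (f (x + h) - f x - 'd f x h) <= e * nrm h.
Proof.
move=> /diff_locallyP [_ /eqaddoP h] e e0.
have /h /nbhs_nrmP [del d0 hd] : 0 < e%:C by rewrite ltcR.
exists del => // k kd.
have := hd k; rewrite subr0 => /(_ kd).
rewrite !fctE /= !nrmE -rmorphM lecR (addrC k x).
by rewrite opprD addrA.
Qed.

Lemma linear_bounded_continuous0 (V W : normedModType C) (L : {linear V -> W})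
    (B : R) : (forall h, nrm (L h) <= B * nrm h) -> continuous L.
Proof.
move=> hB x; apply/continuous_nrmP => e e0.
have B1 : 0 < `|B| + 1 by rewrite ltr_wpDl.
exists (e / (`|B| + 1)); first by rewrite divr_gt0.
move=> h hd; rewrite raddfD /= addrAC subrr add0r.
rewrite ltr_pdivlMr // in hd; apply: le_lt_trans hd.
apply: le_trans (hB h) _; rewrite mulrC ler_wpM2l ?nrm_ge0//.
have := ler_norm B; lra.
Qed.

Lemma is_diff_estimate (V W : normedModType C) (f : V -> W) (x : V)
    (L : {linear V -> W}) : continuous L ->
  (forall e : R, 0 < e -> exists2 del, 0 < del &
    forall h, nrm h < del -> nrm (f (x + h) - f x - L h) <= e * nrm h) ->
  is_diff x f L.
Proof.
move=> Lc hL.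
have dfE : f \o shift x = cst (f x) + L +o_ 0 id.
  apply/eqaddoP => e e0.
  have er : (complex.Re e)%:C = e.
    by move: e0; rewrite ltcE /= => /andP[/eqP]; case: e => a b /= ->.
  have /hL [del d0 hd] : 0 < complex.Re e by move: e0; rewrite ltcE => /andP[].
  apply/nbhs_nrmP; exists del => // y; rewrite subr0 => /hd.
  rewrite !fctE /= -er !nrmE -rmorphM lecR (addrC y x).
  by rewrite opprD addrA.
have dE := diff_unique Lc dfE; split; last exact: dE.
by apply/diff_locallyP; rewrite dE; exact: (conj Lc dfE).
Qed.

Lemma nrm_differentiable (V W : normedModType C) (f : V -> W) (x : V)
    (L : {linear V -> W}) (B : R) :
  (forall h, nrm (L h) <= B * nrm h) ->
  (forall e : R, 0 < e -> exists2 del, 0 < del &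
    forall h, nrm h < del -> nrm (f (x + h) - f x - L h) <= e * nrm h) ->
  is_diff x f L.
Proof. by move=> hB; apply: is_diff_estimate; exact: linear_bounded_continuous0 hB. Qed.

Lemma near_eq_differentiable (V W : normedModType C) (f g : V -> W) (x : V) :
  (\forall y \near x, f y = g y) -> differentiable f x -> is_diff x g ('d f x).
Proof.
move=> fg df; have fx := nbhs_singleton fg; move/nbhs_nrmP: fg => [r r0 fg].
apply: is_diff_estimate; first exact: ((diff_locallyP _ _).1 df).1.
move=> e /(differentiable_nrm df) [del d0 hd].
exists (Num.min r del); first by rewrite lt_min r0.
move=> h; rewrite lt_min => /andP[hr /hd].
by rewrite -fx -fg // addrAC subrr add0r.
Qed.

End RealNorm.

(** * Goursat's lemma with dyadic sums *)

Section Goursat.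
Context {R : realType}.
Local Notation C := R[i].
Implicit Types (g : C -> C) (a b c l z : C).

(** Trapezoidal sums over the 2^n equal pieces of the segment from a to b: a
    discrete contour integral of g. *)
Fixpoint edge_sum g n a b : C :=
  if n is n'.+1 then edge_sum g n' a ((a + b) / 2) + edge_sum g n' ((a + b) / 2) b
  else (g a + g b) / 2 * (b - a).

Definition loop_sum g n c l : C :=
  edge_sum g n c (c + l) + edge_sum g n (c + l) (c + l + l * 'i%C) +
  edge_sum g n (c + l + l * 'i%C) (c + l * 'i%C) + edge_sum g n (c + l * 'i%C) c.

Lemma edge_sumS g n a b : edge_sum g n.+1 a b =
  edge_sum g n a ((a + b) / 2) + edge_sum g n ((a + b) / 2) b.
Proof. by []. Qed.

Lemma edge_sum_lin g1 g2 k1 k2 n a b :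
  edge_sum (fun z => k1 * g1 z + k2 * g2 z) n a b =
  k1 * edge_sum g1 n a b + k2 * edge_sum g2 n a b.
Proof.
elim: n a b => [|n ih] a b /=; first by ring.
by rewrite !ih; ring.
Qed.

Lemma loop_sum_lin g1 g2 k1 k2 n c l :
  loop_sum (fun z => k1 * g1 z + k2 * g2 z) n c l =
  k1 * loop_sum g1 n c l + k2 * loop_sum g2 n c l.
Proof. by rewrite /loop_sum !edge_sum_lin; ring. Qed.

Lemma edge_sum_sym g n a b : edge_sum g n b a = - edge_sum g n a b.
Proof.
elim: n a b => [|n ih] a b /=; first by ring.
by rewrite (addrC b a) [LHS]addrC (ih a) (ih _ b) opprD.
Qed.

Lemma edge_sum_affine (k1 k2 : C) n a b :
  edge_sum (fun z => k1 + k2 * z) n a b =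
  k1 * (b - a) + k2 * ((b ^+ 2 - a ^+ 2) / 2).
Proof.
elim: n a b => [|n ih] a b /=; first by field.
by rewrite !ih; field.
Qed.

Lemma loop_sum_affine (k1 k2 : C) n c l :
  loop_sum (fun z => k1 + k2 * z) n c l = 0.
Proof. by rewrite /loop_sum !edge_sum_affine; field. Qed.

Lemma loop_sum_split g n c l :
  loop_sum g n.+1 c l = loop_sum g n c (l / 2) + loop_sum g n (c + l / 2) (l / 2) +
    loop_sum g n (c + l / 2 * 'i%C) (l / 2) +
    loop_sum g n (c + l / 2 + l / 2 * 'i%C) (l / 2).
Proof.
set h := l / 2; have -> : l = h + h by rewrite /h; field.
rewrite /loop_sum !edge_sumS.
have -> : (c + (c + (h + h))) / 2 = c + h by field.
have -> : (c + (h + h) + (c + (h + h) + (h + h) * 'i%C)) / 2 = c + h + h + h * 'i%C by field.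
have -> : (c + (h + h) + (h + h) * 'i%C + (c + (h + h) * 'i%C)) / 2 =
  c + h + h * 'i%C + h * 'i%C by field.
have -> : (c + (h + h) * 'i%C + c) / 2 = c + h * 'i%C by field.
have -> : c + (h + h) = c + h + h by ring.
have -> : c + h * 'i%C + h = c + h + h * 'i%C by ring.
have -> : c + h * 'i%C + h * 'i%C = c + (h + h) * 'i%C by ring.
have -> : c + h + h * 'i%C + h = c + h + h + h * 'i%C by ring.
have -> : c + h + h + h * 'i%C + h * 'i%C = c + h + h + (h + h) * 'i%C by ring.
rewrite (edge_sum_sym g n (c + h) (c + h + h * 'i%C)).
rewrite (edge_sum_sym g n (c + h * 'i%C) (c + h + h * 'i%C)).
rewrite (edge_sum_sym g n (c + h + h * 'i%C) (c + h + h + h * 'i%C)).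
rewrite (edge_sum_sym g n (c + h + h * 'i%C) (c + h + h * 'i%C + h * 'i%C)).
by ring.
Qed.

Lemma edge_sum_bound g (D : set C) (M : R) n a b :
  (forall x y, D x -> D y -> D ((x + y) / 2)) -> D a -> D b ->
  (forall z, D z -> nrm (g z) <= M) ->
  nrm (edge_sum g n a b) <= M * nrm (b - a).
Proof.
move=> Dm + + hM.
have n2 : nrm (2^-1 : C) = 2^-1 :> R.
  have -> : (2^-1 : C) = (2^-1)%:C by rewrite fmorphV /= rmorphD /= rmorph1.
  by rewrite nrmR ger0_norm // invr_ge0.
elim: n a b => [|n ih] a b Da Db /=.
  rewrite nrmM ler_wpM2r ?nrm_ge0 // nrmM n2.
  have := nrmD (g a) (g b); have := hM _ Da; have := hM _ Db; lra.
apply: le_trans (nrmD _ _) _.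
have h1 := ih _ _ Da (Dm _ _ Da Db); have h2 := ih _ _ (Dm _ _ Da Db) Db.
have e1 : (a + b) / 2 - a = (b - a) / 2 by field.
have e2 : b - (a + b) / 2 = (b - a) / 2 by field.
rewrite e1 nrmM n2 in h1; rewrite e2 nrmM n2 in h2; lra.
Qed.

Definition square c (L : R) : set C := [set z |
  [/\ complex.Re c <= complex.Re z <= complex.Re c + L &
      complex.Im c <= complex.Im z <= complex.Im c + L]].

Lemma ReD a b : complex.Re (a + b) = complex.Re a + complex.Re b.
Proof. by case: a b => [? ?] [? ?]. Qed.
Lemma ImD a b : complex.Im (a + b) = complex.Im a + complex.Im b.
Proof. by case: a b => [? ?] [? ?]. Qed.
Lemma ReN a : complex.Re (- a) = - complex.Re a. Proof. by case: a. Qed.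
Lemma ImN a : complex.Im (- a) = - complex.Im a. Proof. by case: a. Qed.
Lemma Re_half a : complex.Re (a / 2) = complex.Re a / 2.
Proof.
suff : a = a / 2 + a / 2 by move/(congr1 (@complex.Re R)); rewrite ReD; lra.
by field.
Qed.
Lemma Im_half a : complex.Im (a / 2) = complex.Im a / 2.
Proof.
suff : a = a / 2 + a / 2 by move/(congr1 (@complex.Im R)); rewrite ImD; lra.
by field.
Qed.
Lemma ReRi (x : R) : complex.Re (x%:C * 'i%C) = 0.
Proof. by rewrite ReiNIm /= oppr0. Qed.
Lemma ImRi (x : R) : complex.Im (x%:C * 'i%C) = x.
Proof. by rewrite ImiRe. Qed.

Definition ReImE := (ReD, ImD, ReN, ImN, Re_half, Im_half, ReRi, ImRi).

Lemma square_mid c L x y : square c L x -> square c L y -> square c L ((x + y) / 2).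
Proof. by rewrite /square /= !ReImE => -[? ?] [? ?]; split; lra. Qed.

Lemma square_diam c L x y : square c L x -> square c L y -> nrm (x - y) <= 2 * L.
Proof.
rewrite /square /= => -[? ?] [? ?].
apply: le_trans (nrm_ReIm _) _; rewrite !ReImE.
have : `|complex.Re x - complex.Re y| <= L by rewrite ler_norml; lra.
have : `|complex.Im x - complex.Im y| <= L by rewrite ler_norml; lra.
lra.
Qed.

Lemma loop_sum_bound g c (L M : R) n : 0 <= L ->
  (forall z, square c L z -> nrm (g z) <= M) ->
  nrm (loop_sum g n c L%:C) <= 4 * M * L.
Proof.
move=> L0 hM.
have hD := @square_mid c L.
have [D1 D2 D3 D4] : [/\ square c L c, square c L (c + L%:C),
   square c L (c + L%:C + L%:C * 'i%C) & square c L (c + L%:C * 'i%C)].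
  by rewrite /square /= !ReImE /=; split; lra.
have B := edge_sum_bound n hD _ _ hM.
have := B _ _ D1 D2; have := B _ _ D2 D3; have := B _ _ D3 D4; have := B _ _ D4 D1.
rewrite /loop_sum.
have -> : c - (c + L%:C * 'i%C) = - (L%:C * 'i%C) by ring.
have -> : (c + L%:C * 'i%C) - (c + L%:C + L%:C * 'i%C) = - L%:C by ring.
have -> : (c + L%:C + L%:C * 'i%C) - (c + L%:C) = L%:C * 'i%C by ring.
have -> : (c + L%:C) - c = L%:C by ring.
rewrite !nrmN !nrmM nrm_i !nrmR (ger0_norm L0).
move=> h1 h2 h3 h4.
do 3 (apply: le_trans (nrmD _ _) _; rewrite -lerBrDr).
lra.
Qed.

(** Bisection. If P failed on a square, it would fail on one of the quarters, and
    so on; the nested squares so obtained shrink to a point, around which P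
    holds on all small squares. *)
Lemma square_ind (P : C -> R -> Prop) c0 (L0 : R) : 0 < L0 ->
  (forall c L, 0 < L -> P c (L / 2) -> P (c + (L / 2)%:C) (L / 2) ->
     P (c + (L / 2)%:C * 'i%C) (L / 2) ->
     P (c + (L / 2)%:C + (L / 2)%:C * 'i%C) (L / 2) -> P c L) ->
  (forall z, square c0 L0 z -> exists2 del, 0 < del & forall c L,
     0 < L < del -> square c L z -> P c L) ->
  P c0 L0.
Proof.
move=> L00 Psplit Ploc; apply: contrapT => nP.
pose nxt c L : C := if `[< ~ P c (L / 2) >] then c else
   if `[< ~ P (c + (L / 2)%:C) (L / 2) >] then c + (L / 2)%:C else
   if `[< ~ P (c + (L / 2)%:C * 'i%C) (L / 2) >] then c + (L / 2)%:C * 'i%C else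
   c + (L / 2)%:C + (L / 2)%:C * 'i%C.
have nxtP c L : 0 < L -> ~ P c L -> ~ P (nxt c L) (L / 2).
  move=> Lp nPc; rewrite /nxt; case: asboolP => // /contrapT h1.
  case: asboolP => // /contrapT h2; case: asboolP => // /contrapT h3.
  by move=> h4; apply: nPc; apply: Psplit.
have nxt_loc c L : 0 < L ->
   complex.Re c <= complex.Re (nxt c L) <= complex.Re c + L / 2 /\
   complex.Im c <= complex.Im (nxt c L) <= complex.Im c + L / 2.
  by move=> Lp; rewrite /nxt; repeat case: ifP => _; rewrite ?ReImE /=; lra.
pose Ln n := L0 / 2 ^+ n.
have Ln0 n : 0 < Ln n by rewrite divr_gt0 // exprn_gt0.
have LnS n : Ln n.+1 = Ln n / 2 by rewrite /Ln exprS invfM mulrCA mulrC.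
pose cn := fix cn n := if n is n'.+1 then nxt (cn n') (Ln n') else c0.
have nPn n : ~ P (cn n) (Ln n).
  elim: n => [|n ih]; first by rewrite /Ln expr0 divr1.
  by rewrite LnS; exact: nxtP.
have mono n k : complex.Re (cn n) <= complex.Re (cn (n + k)%N) /\
   complex.Re (cn (n + k)%N) + Ln (n + k)%N <= complex.Re (cn n) + Ln n /\
   complex.Im (cn n) <= complex.Im (cn (n + k)%N) /\
   complex.Im (cn (n + k)%N) + Ln (n + k)%N <= complex.Im (cn n) + Ln n.
  elim: k => [|k ih]; first by rewrite addn0; lra.
  have := nxt_loc (cn (n + k)%N) (Ln (n + k)%N) (Ln0 _).
  by rewrite addnS /= LnS; have := Ln0 (n + k)%N; lra.
have cross n k : complex.Re (cn n) <= complex.Re (cn k) + Ln k /\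
   complex.Im (cn n) <= complex.Im (cn k) + Ln k.
  have [/subnKC E|/ltnW /subnKC E] := leqP n k.
    by have := mono n (k - n)%N; rewrite E; have := Ln0 k; lra.
  by have := mono k (n - k)%N; rewrite E; have := Ln0 n; lra.
pose sup_of (f : C -> R) := sup (range (f \o cn)).
have supP (f : C -> R) : (forall n k, f (cn n) <= f (cn k) + Ln k) ->
    forall k, f (cn k) <= sup_of f <= f (cn k) + Ln k.
  move=> hf k.
  have ne : range (f \o cn) !=set0 by exists (f (cn 0%N)), 0%N.
  have ub m : ubound (range (f \o cn)) (f (cn m) + Ln m) by move=> _ [n _ <-]; exact: hf.
  apply/andP; split; last exact: ge_sup.
  by apply: ub_le_sup; [exists (f (cn 0%N) + Ln 0%N) | exists k].
have h1 := supP _ (fun n k => (cross n k).1).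
have h2 := supP _ (fun n k => (cross n k).2).
pose z := Complex (sup_of (@complex.Re R)) (sup_of (@complex.Im R)).
have zin n : square (cn n) (Ln n) z by split; rewrite /=.
have [|del d0 hd] := Ploc z.
  by have := zin 0%N; rewrite /Ln expr0 divr1.
have [n hn] : exists n, Ln n < del.
  have [n _] := near_infty_natSinv_expn_lt (PosNum (divr_gt0 d0 L00)).
  move=> /(_ n (leqnn n)) /= h; exists n.
  by move: h; rewrite div1r ltr_pdivlMr // mulrC.
by apply: (nPn n); apply: (hd) => //; rewrite Ln0.
Qed.

(** A wrapper that keeps conversion from unfolding [differentiable]. *)
Variant cdiff g z : Prop := CDiff of differentiable (g : C^o -> C^o) (z : C^o).

Definition cder g z : C := 'd (g : C^o -> C^o) (z : C^o) (1 : C^o).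

Lemma cdiff_estimate g z : cdiff g z -> forall e : R, 0 < e ->
  exists2 del, 0 < del & forall h, nrm h < del ->
    nrm (g (z + h) - g z - cder g z * h) <= e * nrm h.
Proof.
move=> [dg] e e0.
have [del d0 hd] := differentiable_nrm dg e0; exists del => // h /hd.
suff -> : 'd (g : C^o -> C^o) (z : C^o) h = cder g z * h by [].
by rewrite /cder -[in LHS](mulr1 h) -[h * 1]/(h *: (1 : C^o)) linearZ mulrC.
Qed.

Lemma estimate_cdiff g z a : (forall e : R, 0 < e ->
  exists2 del, 0 < del & forall h, nrm h < del ->
    nrm (g (z + h) - g z - a * h) <= e * nrm h) -> cdiff g z.
Proof.
move=> hg; split.
have := @nrm_differentiable R C^o C^o g z ( *:%R (a : C) : {linear C^o -> C^o}) (nrm a).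
move=> H; suff df : is_diff (z : C^o) (g : C^o -> C^o) ( *:%R (a : C)).
  by case: df.
apply: H => [h|e /hg [del d0 hd]]; first by rewrite nrmZ.
by exists del => // h /hd.
Qed.

(** Near a point z of differentiability g is affine up to an error that is small
    compared with the distance to z, and affine functions have loop sum 0: the
    loop sums around small squares are small compared with the area. Bisection
    carries this estimate to the whole square. *)
Lemma Goursat g c (L : R) : 0 < L -> (forall z, square c L z -> cdiff g z) ->
  forall e : R, 0 < e ->
  exists n0, forall n, (n0 <= n)%N -> nrm (loop_sum g n c L%:C) <= e.
Proof.
move=> L0 dg e e0.
pose e1 := e / L ^+ 2; have e10 : 0 < e1 by rewrite divr_gt0 ?exprn_gt0.
have -> : e = e1 * L ^+ 2 by rewrite /e1 divfK // expf_neq0 // gt_eqF.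
move: e1 e10 => e1 e10 {e e0}.
apply: (@square_ind (fun c L => exists n0, forall n, (n0 <= n)%N ->
   nrm (loop_sum g n c L%:C) <= e1 * L ^+ 2)) => //.
- move=> {dg L0}{}c {}L L0 [n1 h1] [n2 h2] [n3 h3] [n4 h4].
  exists (maxn (maxn n1 n2) (maxn n3 n4)).+1 => -[|n] //.
  rewrite ltnS !geq_max => /andP[/andP[/h1 {}h1 /h2 {}h2] /andP[/h3 {}h3 /h4 {}h4]].
  rewrite loop_sum_split.
  have -> : L%:C / 2 = (L / 2)%:C by rewrite rmorphM /= fmorphV /= rmorphD /= rmorph1.
  do 3 (apply: le_trans (nrmD _ _) _; rewrite -lerBrDr).
  have : e1 * L ^+ 2 = 4 * (e1 * (L / 2) ^+ 2) by field.
  lra.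
- move=> z /dg /cdiff_estimate; set a := cder g z => /(_ (e1 / 8)).
  rewrite divr_gt0 // => /(_ isT) [del d0 hd].
  exists (del / 2); first by rewrite divr_gt0.
  move=> {dg L0}{}c {}L /andP[L0 Ld] zs; exists 0%N => n _.
  pose r w := g w - (g z - a * z + a * w).
  have -> : loop_sum g n c L%:C = loop_sum r n c L%:C.
    have := loop_sum_lin g (fun w => (g z - a * z) + a * w) 1 (-1) n c L%:C.
    rewrite loop_sum_affine mul1r mulr0 addr0 => <-.
    by congr loop_sum; apply/funext => w; rewrite /r; ring.
  apply: le_trans (_ : 4 * (e1 / 8 * (2 * L)) * L <= _); last first.
    have -> : 4 * (e1 / 8 * (2 * L)) * L = e1 * L ^+ 2 by field.
    by [].
  apply: loop_sum_bound; first exact: ltW.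
  move=> w ws; have wz := square_diam ws zs.
  have := hd (w - z); rewrite (addrC z) subrK.
  have -> : g w - g z - a * (w - z) = r w by rewrite /r; ring.
  move=> H; apply: le_trans (H _) _; first lra.
  by rewrite ler_wpM2l //; lra.
Qed.

End Goursat.

(** * The maximum principle and the Cauchy estimates *)

Section CauchyEstimates.
Context {R : realType}.
Local Notation C := R[i].
Implicit Types (g : C -> C) (a b c l z : C).

Lemma cdiff_cst a z : cdiff (fun=> a) z.
Proof. by split; exact: differentiable_cst. Qed.

Lemma cdiff_id z : cdiff id z.
Proof. by split; have [] := @is_diff_id _ C^o (z : C^o). Qed.

Lemma cdiffB g1 g2 z : cdiff g1 z -> cdiff g2 z -> cdiff (fun w => g1 w - g2 w) z.
Proof. by move=> [h1] [h2]; split; exact: (@differentiableB _ C^o C^o). Qed.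

Lemma cdiffM g1 g2 z : cdiff g1 z -> cdiff g2 z -> cdiff (fun w => g1 w * g2 w) z.
Proof. by move=> [h1] [h2]; split; exact: (@differentiableM _ C^o). Qed.

Lemma cdiffX g n z : cdiff g z -> cdiff (fun w => g w ^+ n) z.
Proof.
move=> h; elim: n => [|n ih]; first exact: cdiff_cst.
have -> : (fun w => g w ^+ n.+1) = (fun w => g w * g w ^+ n).
  by apply/funext => w; rewrite exprS.
exact: cdiffM.
Qed.

Lemma cdiffV g z : g z != 0 -> cdiff g z -> cdiff (fun w => (g w)^-1) z.
Proof. by move=> h0 [h]; split; exact: (@differentiableV _ C^o). Qed.

Lemma cdiff_subr p z : cdiff (fun w => w - p) z.
Proof. by apply: cdiffB; [exact: cdiff_id|exact: cdiff_cst]. Qed.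

Definition ccont g z := forall e : R, 0 < e -> exists2 del, 0 < del &
    forall h, nrm h < del -> nrm (g (z + h) - g z) < e.

Lemma ccontP g z : ccont g z <-> {for (z : C^o), continuous (g : C^o -> C^o)}.
Proof. by split=> h; exact/(@continuous_nrmP _ C^o C^o). Qed.

Lemma cdiff_ccont g z : cdiff g z -> ccont g z.
Proof. by move=> [dg]; apply/ccontP; exact: (@differentiable_continuous _ C^o C^o). Qed.

Lemma ccontX g n z : ccont g z -> ccont (fun w => g w ^+ n) z.
Proof.
move=> /ccontP h; apply/ccontP; elim: n => [|n ih]; first exact: (@cst_continuous C^o C^o (1 : C^o) z).
have -> : (fun w => g w ^+ n.+1) = (fun w => g w * g w ^+ n).
  by apply/funext => w; rewrite exprS.
exact: (@continuousM C C^o _ _ z h ih).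
Qed.

(** This is what makes points of mere continuity removable in [max_frame]. *)
Lemma ccont_mul_cdiff g p : ccont g p -> cdiff (fun w => g w * (w - p)) p.
Proof.
move=> hg; apply: (@estimate_cdiff _ _ _ (g p)) => e /hg [del d0 hd].
exists del => // h /hd /ltW H; rewrite subrr mulr0 subr0.
have -> : g (p + h) * (p + h - p) - g p * h = (g (p + h) - g p) * h by ring.
by rewrite nrmM ler_wpM2r ?nrm_ge0.
Qed.

(** The norm on C whose balls are squares. *)
Definition supn z : R := Num.max `|complex.Re z| `|complex.Im z|.

Lemma supn_le z : supn z <= nrm z.
Proof. by rewrite /supn ge_max nrm_Re nrm_Im. Qed.

Lemma nrm_supn z : nrm z <= 2 * supn z.
Proof.
apply: le_trans (nrm_ReIm z) _.
have : `|complex.Re z| <= supn z by rewrite /supn le_max lexx.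
have : `|complex.Im z| <= supn z by rewrite /supn le_max lexx orbT.
lra.
Qed.

Lemma supn_square z0 (s : R) z : square (z0 - s%:C - s%:C * 'i%C) (2 * s) z ->
  supn (z - z0) <= s.
Proof.
rewrite /square /= !ReImE /= => -[? ?].
by rewrite /supn ge_max !ReImE !ler_norml; lra.
Qed.

Lemma mulii : 'i%C * 'i%C = -1 :> C.
Proof. by rewrite -sqr_i expr2. Qed.

Lemma loop_sum_edges g n z0 (s : R) :
  loop_sum g n (z0 - s%:C - s%:C * 'i%C) (2 * s)%:C =
  \sum_(t <- [:: 1; 'i%C; -1; - 'i%C]) edge_sum g n (z0 + (- s%:C - s%:C * 'i%C) * t)
     (z0 + (s%:C - s%:C * 'i%C) * t).
Proof.
have -> : (2 * s)%:C = s%:C + s%:C by rewrite mulrDl mul1r rmorphD.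
rewrite /loop_sum !big_cons big_nil addr0 !addrA.
have ii (x : C) : x * 'i%C * 'i%C = - x by rewrite -mulrA mulii mulrN1.
by congr (edge_sum _ _ _ _ + edge_sum _ _ _ _ + edge_sum _ _ _ _ + edge_sum _ _ _ _);
  rewrite ?(mulrN, mulrDl, mulNr, mulr1, ii); ring.
Qed.

Definition edge z0 (s : R) t : set C :=
  [set z | exists2 x : R, `|x| <= s & z = z0 + (x%:C - s%:C * 'i%C) * t].

Lemma edge_mid z0 s t x y : edge z0 s t x -> edge z0 s t y -> edge z0 s t ((x + y) / 2).
Proof.
move=> [x' hx ->] [y' hy ->]; exists ((x' + y') / 2).
  by move: hx hy; rewrite !ler_norml; lra.
by rewrite rmorphM /= fmorphV /= !rmorphD /= rmorph1; field.
Qed.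

Lemma edge_corners z0 (s : R) t : 0 <= s ->
  edge z0 s t (z0 + (- s%:C - s%:C * 'i%C) * t) /\
  edge z0 s t (z0 + (s%:C - s%:C * 'i%C) * t).
Proof.
move=> s0; split; [exists (- s) | exists s]; rewrite ?normrN ?ger0_norm //.
by rewrite rmorphN.
Qed.

Lemma edge_supn z0 (s : R) t z : 0 <= s -> t \in [:: 1; 'i%C; -1; - 'i%C : C] ->
  edge z0 s t z -> supn (z - z0) = s.
Proof.
move=> s0 ht [x hx ->]; rewrite addrAC subrr add0r.
move: hx; rewrite /supn !inE in ht *.
have ns : `|s| = s by rewrite ger0_norm.
by case/or4P: ht => /eqP -> hx; rewrite ?mulrN ?mulr1 ?mulrBl -?mulrA ?mulii ?mulrN1
   !ReImE /= ?ReImE /= ?oppr0 ?addr0 ?add0r ?sub0r ?subr0 ?normrN ?opprK ns ?mulr0 ?mulr1 ?mul0r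
   ?subr0 ?addr0 ?add0r ?oppr0 ?normrN ?ns;
   [exact: max_r|exact: max_l|exact: max_r|exact: max_l].
Qed.

Lemma loop_sum_frame g n z0 (s M : R) : 0 <= s ->
  (forall z, supn (z - z0) = s -> nrm (g z) <= M) ->
  nrm (loop_sum g n (z0 - s%:C - s%:C * 'i%C) (2 * s)%:C) <= 8 * M * s.
Proof.
move=> s0 hM; rewrite loop_sum_edges !big_cons big_nil addr0.
have H t : t \in [:: 1; 'i%C; -1; - 'i%C : C] -> nrm t = 1 ->
  nrm (edge_sum g n (z0 + (- s%:C - s%:C * 'i%C) * t) (z0 + (s%:C - s%:C * 'i%C) * t)) <=
  2 * M * s.
  move=> tin t1; have [c1 c2] := edge_corners z0 t s0.
  have := edge_sum_bound n (@edge_mid z0 s t) c1 c2 (fun z ze => hM z (edge_supn s0 tin ze)).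
  have -> : z0 + (s%:C - s%:C * 'i%C) * t - (z0 + (- s%:C - s%:C * 'i%C) * t) =
    (s + s)%:C * t by rewrite rmorphD /=; ring.
  rewrite nrmM t1 mulr1 nrmR ger0_norm ?addr_ge0 //; lra.
have := H 1; have := H 'i%C; have := H (- 1); have := H (- 'i%C).
rewrite !nrmN nrm1 nrm_i !inE !eqxx !orbT => /(_ isT erefl) h1 /(_ isT erefl) h2.
move=> /(_ isT erefl) h3 /(_ isT erefl) h4.
do 3 (apply: le_trans (nrmD _ _) _; rewrite -lerBrDl).
lra.
Qed.

(** Along an edge of direction t the sums of g inherit lower bounds of the
    imaginary part of g t, the density of the contour integral. *)
Lemma edge_sum_lower g n (D : set C) a b t (x m : R) :
  (forall x y, D x -> D y -> D ((x + y) / 2)) -> D a -> D b ->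
  (forall z, D z -> m <= complex.Im (g z * t)) -> 0 <= x -> b - a = x%:C * t ->
  m * x <= complex.Im (edge_sum g n a b).
Proof.
move=> Dm + + hm; elim: n a b x => [|n ih] a b x Da Db x0 E /=.
  have -> : (g a + g b) / 2 * (b - a) =
     (x / 2)%:C * (g a * t) + (x / 2)%:C * (g b * t).
    by rewrite E rmorphM /= fmorphV /= rmorphD /= rmorph1; ring.
  have ImR (y : R) (z : C) : complex.Im (y%:C * z) = y * complex.Im z.
    by case: z => u v /=; rewrite mul0r addr0.
  rewrite ImD !ImR; have := hm _ Da; have := hm _ Db => h1 h2.
  have : x / 2 * m <= x / 2 * complex.Im (g b * t) by rewrite ler_wpM2l // divr_ge0.
  have : x / 2 * m <= x / 2 * complex.Im (g a * t) by rewrite ler_wpM2l // divr_ge0.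
  lra.
have hh : (x / 2)%:C = x%:C / 2 by rewrite rmorphM /= fmorphV /= rmorphD /= rmorph1.
have h1 := ih _ _ (x / 2) Da (Dm _ _ Da Db).
have h2 := ih _ _ (x / 2) (Dm _ _ Da Db) Db.
rewrite ImD.
have : m * (x / 2) <= complex.Im (edge_sum g n a ((a + b) / 2)).
  by apply: h1; rewrite ?divr_ge0 // hh mulrAC -E; field.
have : m * (x / 2) <= complex.Im (edge_sum g n ((a + b) / 2) b).
  by apply: h2; rewrite ?divr_ge0 // hh mulrAC -E; field.
lra.
Qed.

(** Discrete form of the fact that the integral of dz/(z - z0) along the square
    is 2 pi i. *)
Lemma loop_sum_inv n z0 (s : R) : 0 < s ->
  4 <= nrm (loop_sum (fun z => (z - z0)^-1) n (z0 - s%:C - s%:C * 'i%C) (2 * s)%:C).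
Proof.
move=> s0; apply: le_trans (le_trans (ler_norm _) (nrm_Im _)).
rewrite loop_sum_edges !big_cons big_nil addr0 !ImD.
have H t : t != 0 -> 1 <= complex.Im (edge_sum (fun z => (z - z0)^-1) n
    (z0 + (- s%:C - s%:C * 'i%C) * t) (z0 + (s%:C - s%:C * 'i%C) * t)).
  move=> t0; have [c1 c2] := edge_corners z0 t (ltW s0).
  have s1 : (2 * s)^-1 * (2 * s) = 1 by rewrite mulVf // mulf_neq0 // gt_eqF.
  rewrite -[X in X <= _]s1.
  apply: (edge_sum_lower (t := t) n (@edge_mid z0 s t) c1 c2).
  - move=> _ [x hx ->]; rewrite addrAC subrr add0r [(_ * t)^-1]invfM -mulrA mulVf // mulr1.
    have -> : (x%:C - s%:C * 'i%C)^-1 = Complex (x / (x ^+ 2 + s ^+ 2)) (s / (x ^+ 2 + s ^+ 2)).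
      have -> : x%:C - s%:C * 'i%C = Complex x (- s) by simpc.
      by rewrite /GRing.inv /= sqrrN mulNr opprK.
    have xs : x ^+ 2 <= s ^+ 2 by move: hx; rewrite ler_norml => /andP[? ?]; rewrite !expr2; nra.
    have s2 : 0 < s ^+ 2 by rewrite exprn_gt0.
    rewrite /= ler_pdivlMr; last by have := sqr_ge0 x; lra.
    rewrite mulrC ler_pdivrMr ?mulr_gt0 //; have := sqr_ge0 x; rewrite !expr2 in xs s2 *; lra.
  - by rewrite mulr_ge0 // ltW.
  - have -> : (2 * s)%:C = s%:C + s%:C by rewrite mulrDl mul1r rmorphD.
    by ring.
have := H 1; have := H 'i%C; have := H (- 1); have := H (- 'i%C).
have i0 : 'i%C != 0 :> C by rewrite -nrm_gt0 nrm_i.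
rewrite !oppr_eq0 oner_eq0 i0 => /(_ isT) h1 /(_ isT) h2 /(_ isT) h3 /(_ isT) h4.
lra.
Qed.

(** Goursat's lemma for [(g z - g z0)^2 / (z - z0)], which is differentiable at
    z0 too: expanding the square bounds [g z0 ^ 2] times the loop sum of
    [1 / (z - z0)], whose norm is at least 4. The constant 5 will be removed by
    taking powers of g. *)
Lemma max_frame_const g z0 (s M : R) : 0 < s ->
  (forall z, supn (z - z0) <= s -> cdiff g z) ->
  (forall z, supn (z - z0) = s -> nrm (g z) <= M) ->
  nrm (g z0) <= 5 * M.
Proof.
move=> s0 dg hM.
pose k z := (z - z0)^-1.
pose h z := (g z - g z0) ^+ 2 * k z.
have M0 : 0 <= M.
  apply: le_trans (nrm_ge0 (g (z0 + s%:C))) (hM _ _).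
  rewrite addrAC subrr add0r /supn /= normr0 ger0_norm ?ltW //.
  by rewrite max_l // ltW.
have dh z : supn (z - z0) <= s -> cdiff h z.
  move=> zs; have [->|zz0] := eqVneq z z0; last first.
    apply: cdiffM; first by apply/cdiffX/cdiffB; [exact: dg|exact: cdiff_cst].
    by apply: cdiffV; [rewrite subr_eq0|exact: cdiff_subr].
  have dg0 : cdiff g z0.
    apply: dg; rewrite subrr /supn /= normr0 maxxx; exact: ltW.
  pose a := cder g z0; apply: (@estimate_cdiff _ _ _ (a ^+ 2)) => e e0.
  have a0 : 0 < 2 * nrm a + 1 by have := nrm_ge0 a; lra.
  pose e1 := Num.min 1 (e / (2 * nrm a + 1)).
  have e10 : 0 < e1 by rewrite lt_min ltr01 divr_gt0.
  have [del d0 hd] := cdiff_estimate dg0 e10.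
  exists del => // w /hd; rewrite -/a; set r := (X in nrm X) => hr.
  have -> : h (z0 + w) - h z0 - a ^+ 2 * w = 2 * a * r * (w * w^-1) + r * (r / w).
    rewrite /h /k !subrr expr0n mul0r subr0 (_ : z0 + w - z0 = w); last by ring.
    rewrite (_ : g (z0 + w) - g z0 = r + a * w); last by rewrite /r; ring.
    have [->|w0] := eqVneq w 0; first by rewrite invr0 !mulr0 subrr addr0.
    by field.
  have rw : nrm (r / w) <= e1.
    have [->|w0] := eqVneq w 0; first by rewrite invr0 mulr0 nrm0 ltW.
    by rewrite nrmM nrmV ler_pdivrMr // nrm_gt0.
  have ww : nrm (w / w) <= 1.
    have [->|w0] := eqVneq w 0; first by rewrite invr0 mulr0 nrm0.
    by rewrite mulfV // nrm1.
  apply: le_trans (nrmD _ _) _; rewrite !nrmM -nrmM in rw ww *.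
  have e11 : e1 <= 1 by rewrite ge_min lexx.
  have e1e : e1 * (2 * nrm a + 1) <= e.
    by rewrite -ler_pdivlMr // ge_min lexx orbT.
  have n2 : nrm (2 : C) = 2.
    have -> : (2 : C) = 2%:C by rewrite rmorphD /= rmorph1.
    by rewrite nrmR ger0_norm.
  have na := nrm_ge0 a; have nr := nrm_ge0 r; have nw := nrm_ge0 w.
  apply: (@le_trans _ _ (2 * nrm a * nrm r + nrm r * e1)).
    rewrite n2 lerD ?ler_wpM2l // -[leRHS]mulr1 ler_wpM2l // ?mulr_ge0 //.
  have : nrm r * e1 <= nrm r by rewrite -[leRHS]mulr1 ler_wpM2l.
  have : (2 * nrm a + 1) * nrm r <= (2 * nrm a + 1) * (e1 * nrm w).
    by rewrite ler_wpM2l // ltW.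
  have : e1 * (2 * nrm a + 1) * nrm w <= e * nrm w by rewrite ler_wpM2r.
  lra.
have [//|x5] := leP (nrm (g z0)) (5 * M).
pose x := nrm (g z0); rewrite -/x in x5 *.
(* the expansion gives 4 x^2 <= 16 x M + 8 M^2 up to the error in Goursat's
   lemma, which fails for x > 5 M *)
have e0 : 0 < (4 * x ^+ 2 - 16 * x * M - 8 * M ^+ 2) by nra.
have [||n0 /(_ n0 (leqnn _)) Hh] :=
   @Goursat _ h (z0 - s%:C - s%:C * 'i%C) (2 * s) _ _ _ (divr_gt0 e0 (ltr0Sn _ 1)).
- by rewrite mulr_gt0.
- by move=> z /supn_square; exact: dh.
have ks z : supn (z - z0) = s -> nrm (k z) <= s^-1.
  move=> zs; have := supn_le (z - z0); rewrite zs => h1.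
  by rewrite /k nrmV lef_pV2 // posrE; exact: lt_le_trans h1.
have sV : s^-1 * s = 1 by rewrite mulVf // gt_eqF.
have sV0 : 0 <= s^-1 by rewrite invr_ge0 ltW.
have H1 : nrm (loop_sum (fun z => g z ^+ 2 * k z) n0 (z0 - s%:C - s%:C * 'i%C) (2 * s)%:C) <=
   8 * (M ^+ 2 * s^-1) * s.
  apply: loop_sum_frame; first exact: ltW.
  move=> z zs; rewrite nrmM nrmX ler_pM ?nrm_ge0 ?exprn_ge0 ?nrm_ge0 ?ks //.
  by rewrite ler_pXn2r ?nnegrE ?nrm_ge0 ?hM.
have H2 : nrm (loop_sum (fun z => g z * k z) n0 (z0 - s%:C - s%:C * 'i%C) (2 * s)%:C) <=
   8 * (M * s^-1) * s.
  apply: loop_sum_frame; first exact: ltW.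
  by move=> z zs; rewrite nrmM ler_pM ?nrm_ge0 ?ks ?hM.
have H3 := loop_sum_inv n0 z0 s0; rewrite -/k in H3.
have E : g z0 ^+ 2 * loop_sum k n0 (z0 - s%:C - s%:C * 'i%C) (2 * s)%:C =
  loop_sum h n0 (z0 - s%:C - s%:C * 'i%C) (2 * s)%:C -
  loop_sum (fun z => g z ^+ 2 * k z) n0 (z0 - s%:C - s%:C * 'i%C) (2 * s)%:C +
  2 * g z0 * loop_sum (fun z => g z * k z) n0 (z0 - s%:C - s%:C * 'i%C) (2 * s)%:C.
  have -> : h = fun z => 1 * (1 * (g z ^+ 2 * k z) + (- (2 * g z0)) * (g z * k z)) +
     (g z0) ^+ 2 * k z.
    by apply/funext => z; rewrite /h; ring.
  by rewrite !loop_sum_lin; ring.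
have := congr1 (@nrm R _) E; rewrite nrmM nrmX -/x => E'.
have n2 : nrm (2 : C) = 2.
  have -> : (2 : C) = 2%:C by rewrite rmorphD /= rmorph1.
  by rewrite nrmR ger0_norm.
have : x ^+ 2 * 4 <= (4 * x ^+ 2 - 16 * x * M - 8 * M ^+ 2) / 2 +
     8 * (M ^+ 2 * s^-1) * s + 2 * x * (8 * (M * s^-1) * s).
  apply: (@le_trans _ _ (x ^+ 2 * nrm (loop_sum k n0 (z0 - s%:C - s%:C * 'i%C) (2 * s)%:C))).
    by rewrite ler_wpM2l // exprn_ge0 // nrm_ge0.
  rewrite E'; apply: le_trans (nrmD _ _) _; apply: lerD.
    by apply: le_trans (nrmB _ _) _; exact: lerD.
  by rewrite !nrmM n2 -/x ler_wpM2l // mulr_ge0 // nrm_ge0.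
rewrite -!mulrA sV !mulr1; lra.
Qed.

End CauchyEstimates.

Section Taylor.
Context {R : realType}.
Local Notation C := R[i].
Implicit Types (g : C -> C) (a b c l z : C).

(** If x > M, then (x / M)^n exceeds K / a for large n by Bernoulli's
    inequality. *)
Lemma power_trick (x M a K : R) : 0 <= x -> 0 <= M -> 0 < a ->
  (forall n, x ^+ n * a <= K * M ^+ n) -> x <= M.
Proof.
move=> x0 M0 a0 h; have [//|xM] := leP x M.
have [M00|Mn0] := eqVneq M 0.
  have := h 1%N; rewrite M00 in xM *; rewrite !expr1 mulr0; nra.
have Mp : 0 < M by rewrite lt_def Mn0.
pose q := x / M.
have q1 : 1 < q by rewrite /q ltr_pdivlMr // mul1r.
have hq n : q ^+ n * a <= K.
  by rewrite /q expr_div_n mulrAC ler_pdivrMr ?exprn_gt0.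
have bern n : 1 + n%:R * (q - 1) <= q ^+ n.
  elim: n => [|n ih]; first by rewrite mul0r addr0 expr0.
  rewrite exprS -natr1; have : 0 <= n%:R * (q - 1) ^+ 2 :> R.
    by rewrite mulr_ge0 // sqr_ge0.
  have : q * (1 + n%:R * (q - 1)) <= q * q ^+ n by rewrite ler_wpM2l //; lra.
  by rewrite expr2; lra.
pose y := K / (a * (q - 1)).
have [n hn] : exists n : nat, y < n%:R.
  exists (Num.bound `|y|).
  exact: le_lt_trans (ler_norm y) (archi_boundP (normr_ge0 y)).
have aq : 0 < a * (q - 1) by rewrite mulr_gt0 // subr_gt0.
rewrite /y ltr_pdivrMr // in hn.
have := hq n; have : a * (1 + n%:R * (q - 1)) <= a * q ^+ n by rewrite ler_wpM2l // ltW.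
lra.
Qed.

(** Maximum principle on squares, with two removable points: the n-th powers of
    g times [(z - p1) * (z - p2)] are differentiable everywhere, and the
    constants disappear as n grows. *)
Lemma max_frame g z0 p1 p2 (s M : R) : 0 < s -> z0 != p1 -> z0 != p2 ->
  (forall z, supn (z - z0) <= s -> z != p1 -> z != p2 -> cdiff g z) ->
  ccont g p1 -> ccont g p2 ->
  (forall z, supn (z - z0) = s -> nrm (g z) <= M) ->
  nrm (g z0) <= M.
Proof.
move=> s0 zp1 zp2 dg c1 c2 hM.
have M0 : 0 <= M.
  apply: le_trans (nrm_ge0 (g (z0 + s%:C))) (hM _ _).
  rewrite addrAC subrr add0r /supn /= normr0 ger0_norm ?ltW //.
  by rewrite max_l // ltW.
pose a := nrm (z0 - p1) * nrm (z0 - p2).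
pose K := (nrm (z0 - p1) + 2 * s) * (nrm (z0 - p2) + 2 * s).
apply: (@power_trick _ _ a (5 * K)) => //.
- exact: nrm_ge0.
- by rewrite mulr_gt0 // nrm_gt0 subr_eq0.
move=> n; rewrite /a -!nrmX -!nrmM -mulrA.
apply: (@max_frame_const _ (fun z => g z ^+ n * ((z - p1) * (z - p2))) z0 s) => //.
- move=> z zs; have [->|z1] := eqVneq z p1.
    have -> : (fun z => g z ^+ n * ((z - p1) * (z - p2))) =
      (fun z => (g z ^+ n * (z - p1)) * (z - p2)) by apply/funext => w; rewrite mulrA.
    by apply: cdiffM; [apply: ccont_mul_cdiff; exact: ccontX|exact: cdiff_subr].
  have [->|z2] := eqVneq z p2.
    have -> : (fun z => g z ^+ n * ((z - p1) * (z - p2))) =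
      (fun z => (g z ^+ n * (z - p2)) * (z - p1)) by apply/funext => w; ring.
    by apply: cdiffM; [apply: ccont_mul_cdiff; exact: ccontX|exact: cdiff_subr].
  by apply: cdiffM; [apply/cdiffX/dg|apply: cdiffM; exact: cdiff_subr].
- move=> z zs; rewrite mulrC nrmM nrmX nrmM.
  have h p : nrm (z - p) <= nrm (z0 - p) + 2 * s.
    have := nrm_tri z0 z p; have := nrm_supn (z - z0); rewrite zs; lra.
  apply: ler_pM; rewrite ?mulr_ge0 ?exprn_ge0 ?nrm_ge0 //.
    by rewrite /K ler_pM ?nrm_ge0.
  by rewrite lerXn2r ?nnegrE ?nrm_ge0 ?hM.
Qed.

(** Extended by the derivative, the difference quotient of a differentiable g is
    continuous at p and differentiable elsewhere, which is all that [max_frame]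
    asks for. *)
Definition slope g p z : C := if z == p then cder g p else (g z - g p) / (z - p).

Lemma slope_cont g p : cdiff g p -> ccont (slope g p) p.
Proof.
move=> dg e e0; have e2 : 0 < e / 2 by rewrite divr_gt0.
have [del d0 hd] := cdiff_estimate dg e2; exists del => // h /hd H.
rewrite /slope eqxx; have [/eqP|ph] := eqVneq (p + h) p.
  by rewrite subrr nrm0.
have h0 : h != 0 by apply: contra ph => /eqP ->; rewrite addr0.
rewrite (_ : p + h - p = h); last by ring.
have -> : (g (p + h) - g p) / h - cder g p = (g (p + h) - g p - cder g p * h) / h by field.
have hp : 0 < nrm h by rewrite nrm_gt0.
rewrite nrmM nrmV ltr_pdivrMr //; apply: le_lt_trans H _.
by rewrite ltr_pM2r //; lra.
Qed.

Lemma slope_near g p z : z != p ->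
  \forall w \near (z : C^o), (g w - g p) / (w - p) = slope g p w.
Proof.
move=> zp; apply/nbhs_nrmP; exists (nrm (z - p)); first by rewrite nrm_gt0 subr_eq0.
move=> w wz; rewrite /slope; case: eqVneq => // wp.
by move: wz; rewrite wp nrmBC ltxx.
Qed.

Lemma slope_cdiff g p z : z != p -> cdiff g z -> cdiff (slope g p) z.
Proof.
move=> zp dg.
have h : cdiff (fun w => (g w - g p) * (w - p)^-1) z.
  apply: cdiffM; first by apply: cdiffB => //; exact: cdiff_cst.
  by apply: cdiffV; [rewrite subr_eq0|exact: cdiff_subr].
by case: h => h; split; have [] := @near_eq_differentiable R C^o C^o _ (slope g p) z (slope_near g zp) h.
Qed.

Lemma ccontM g1 g2 z : ccont g1 z -> ccont g2 z -> ccont (fun w => g1 w * g2 w) z.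
Proof. by move=> /ccontP h1 /ccontP h2; apply/ccontP; exact: (@continuousM C C^o _ _ z h1 h2). Qed.

Lemma slope_ccont g p z : z != p -> ccont g z -> ccont (slope g p) z.
Proof.
move=> zp cg.
have h : ccont (fun w => (g w - g p) * (w - p)^-1) z.
  apply: ccontM; last first.
    by apply/cdiff_ccont/cdiffV; [rewrite subr_eq0|exact: cdiff_subr].
  move=> e /cg [del d0 hd]; exists del => // k /hd.
  by rewrite opprB addrA subrK.
move=> e /h [del d0 hd]; exists (Num.min del (nrm (z - p))).
  by rewrite lt_min d0 nrm_gt0 subr_eq0.
move=> k; rewrite lt_min => /andP[/hd H kz].
rewrite /slope (negPf zp); case: eqVneq => // E.
by move: kz; rewrite -E (_ : z - (z + k) = - k) ?nrmN ?ltxx //; ring.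
Qed.

Lemma slope_nrm g p z (M t : R) : z != p -> 0 < t -> t <= nrm (z - p) ->
  nrm (g z) <= M -> nrm (g p) <= M -> nrm (slope g p z) <= 2 * M / t.
Proof.
move=> zp t0 tz hz hp; rewrite /slope (negPf zp) nrmM nrmV.
have M0 : 0 <= M by apply: le_trans hp; exact: nrm_ge0.
apply: ler_pM; rewrite ?invr_ge0 ?nrm_ge0 //.
  by have := nrmB (g z) (g p); lra.
by rewrite lef_pV2 ?posrE //; exact: lt_le_trans tz.
Qed.

Lemma ccont_le g z (M : R) : ccont g z ->
  (forall e : R, 0 < e -> exists h, nrm h < e /\ nrm (g (z + h)) <= M) ->
  nrm (g z) <= M.
Proof.
move=> cg H; apply/ler_addgt0Pr => e e0.
have [del d0 hd] := cg e e0; have [h [/hd h1 h2]] := H del d0.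
have := nrm_tri (g (z + h)) (g z) 0; rewrite !subr0 nrmBC; lra.
Qed.

Lemma small_nonzero (e : R) a : 0 < e -> exists h : C, [/\ nrm h < e, h != 0 & h != a].
Proof.
move=> e0; have [E|ne] := eqVneq ((e / 2)%:C) a.
  exists (e / 3)%:C; rewrite -nrm_gt0 nrmR ger0_norm ?divr_ge0 ?ltW //; split; try lra.
  apply/eqP => E'; rewrite -E in E'; have := complexI E'; lra.
exists (e / 2)%:C; rewrite -nrm_gt0 nrmR ger0_norm ?divr_ge0 ?ltW //; split => //; lra.
Qed.

(** The maximum principle bounds first the slope of g at 0, then the slopes of
    that slope, which are continuous at 0 and differentiable elsewhere. *)
Lemma cauchy_estimates g (r M : R) : 0 < r ->
  (forall z, nrm z < r -> cdiff g z) -> (forall z, nrm z < r -> nrm (g z) <= M) ->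
  nrm (cder g 0) <= 16 * M / r /\
  forall h, nrm h <= r / 16 ->
    nrm (g h - g 0 - cder g 0 * h) <= 256 * M / r ^+ 2 * nrm h ^+ 2.
Proof.
move=> r0 dg hM.
have M0 : 0 <= M by apply: le_trans (nrm_ge0 (g 0)) (hM 0 _); rewrite nrm0.
pose u := r / 8; have u0 : 0 < u by rewrite divr_gt0.
have ru : r = 8 * u by rewrite /u; field.
pose q := slope g 0.
have g00 : nrm (g 0) <= M by rewrite hM ?nrm0.
have dg0 : cdiff g 0 by apply: dg; rewrite nrm0.
have qc : ccont q 0 by exact: slope_cont.
pose M1 := 2 * M / u.
have M10 : 0 <= M1 by rewrite divr_ge0 ?mulr_ge0 // ltW.
have q_dist z p : nrm z <= u -> supn (p - z) = 2 * u -> u <= nrm p /\ nrm p < r.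
  move=> zu pz; have := supn_le (p - z); have := nrm_supn (p - z); rewrite pz.
  have := nrmB p z; have := nrmD (p - z) z; rewrite subrK ru; lra.
have in_disc z p : nrm z <= u -> supn (p - z) <= 2 * u -> nrm p < r.
  move=> zu pz; have := nrm_supn (p - z); have := nrmD (p - z) z.
  by rewrite subrK ru; lra.
have q_far z : u <= nrm z -> nrm z < r -> nrm (q z) <= M1.
  move=> h1 h2; apply: slope_nrm => //; rewrite ?subr0 ?hM //.
  by rewrite -nrm_gt0 (lt_le_trans u0).
have q_near z : z != 0 -> nrm z < r -> nrm (q z) <= M1.
  move=> z0 zr; have [uz|/ltW zu] := leP u (nrm z); first exact: q_far.
  apply: (@max_frame q z 0 0 (2 * u)) => //; first by rewrite mulr_gt0.
  - by move=> w wz w0 _; apply: slope_cdiff => //; apply: dg; exact: in_disc wz.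
  - by move=> w wz; have [? ?] := q_dist _ _ zu wz; exact: q_far.
have q0 : nrm (q 0) <= M1.
  apply: ccont_le qc _ => e e0.
  have [|h [he h0 _]] := @small_nonzero (Num.min e r) 0; first by rewrite lt_min e0.
  rewrite lt_min in he; case/andP: he => he hr.
  by exists h; split => //; rewrite add0r q_near.
have q_le z : nrm z < r -> nrm (q z) <= M1.
  by have [->|] := eqVneq z 0; [|exact: q_near].
have cderq : q 0 = cder g 0 by rewrite /q /slope eqxx.
split.
  have -> : 16 * M / r = M1 by rewrite /M1 ru; field; rewrite gt_eqF.
  by rewrite -cderq.
move=> h hr; have [->|h0] := eqVneq h 0.
  by rewrite subrr mulr0 subr0 nrm0 expr0n mulr0.
have slope_le a c : a != 0 -> c != 0 -> c != a -> nrm a <= u / 2 -> nrm c <= u / 2 ->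
    nrm (q c - q a) <= 2 * M1 / u * nrm (c - a).
  move=> a0 c0 ca au cu.
  have -> : q c - q a = slope q a c * (c - a).
    by rewrite /slope (negPf ca) divfK // subr_eq0.
  have cu' : nrm c <= u by lra.
  rewrite nrmM ler_wpM2r ?nrm_ge0 //.
  have ar : nrm a < r by lra.
  have dqa : cdiff q a by apply: slope_cdiff => //; exact: dg.
  apply: (@max_frame (slope q a) c 0 a (2 * u)) => //; first by rewrite mulr_gt0.
  - move=> w wz w0 wa; apply: slope_cdiff => //; apply: slope_cdiff => //.
    by apply: dg; exact: in_disc wz.
  - by apply: slope_ccont; rewrite // eq_sym.
  - exact: slope_cont.
  - move=> w wz; have [? wr] := q_dist _ _ cu' wz.
    have wa : u <= nrm (w - a).
      have := supn_le (w - c); have := nrm_tri a w c; have := nrmB a c; rewrite wz; lra.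
    apply: slope_nrm; rewrite ?q_le //.
    by rewrite -subr_eq0 -nrm_gt0 (lt_le_trans u0).
have hu : nrm h <= u / 2 by rewrite ru in hr; lra.
have H : nrm (q h - q 0) <= 2 * M1 / u * nrm h.
  rewrite nrmBC.
  have H2 : ccont (fun z => q z - q h) 0.
    by move=> e /qc [del d0 hd]; exists del => // k /hd; rewrite opprB addrA subrK.
  apply/ler_addgt0Pr => e e0.
  pose K := 2 * M1 / u; have K0 : 0 <= K.
    by apply: divr_ge0; [exact: mulr_ge0|exact: ltW].
  rewrite -/K.
  have K1 : 0 < K + 1 by lra.
  apply: (@ccont_le _ 0) H2 _ => e1 e10.
  have [|k [he k0 kh]] := @small_nonzero (Num.min e1 (Num.min (u / 2) (e / (K + 1)))) h.
    by rewrite !lt_min e10 !divr_gt0.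
  rewrite !lt_min in he; case/and3P: he => ke1 ku ke.
  exists k; split => //; rewrite add0r.
  apply: le_trans (slope_le h k _ _ _ _ _) _ => //; first exact: ltW.
  rewrite -/K; rewrite ltr_pdivlMr // in ke.
  have := nrmB k h; have := nrm_ge0 k => h1 h2.
  have : K * nrm (k - h) <= K * (nrm k + nrm h) by rewrite ler_wpM2l.
  lra.
have -> : g h - g 0 - cder g 0 * h = (q h - q 0) * h.
  by rewrite {1}/q /slope (negPf h0) cderq subr0; field.
rewrite nrmM.
have -> : 256 * M / r ^+ 2 * nrm h ^+ 2 = 2 * M1 / u * nrm h * nrm h.
  by rewrite /M1 ru; field; rewrite gt_eqF.
by rewrite ler_wpM2r ?nrm_ge0.
Qed.

End Taylor.

(** * Limits along an ultrafilter *)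

(** A cluster point of an ultrafilter is a limit. Taking limits along
    ultrafilters on [nat] spares the successive extractions of subsequences. *)
Lemma ultra_compact_cvg (I : Type) (U : set_system I) {UU : UltraFilter U}
    (T : topologicalType) (f : I -> T) (A : set T) :
  compact A -> (\forall i \near U, A (f i)) -> exists2 l, A l & f @ U --> l.
Proof.
move=> Ac Af; have [l [Al cl]] := Ac (f @ U) (fmap_proper_filter _ _) Af.
exists l => // B Bl; have [//|nB] := in_ultra_setVsetC (f @^-1` B) UU.
have [x [/= nBx Bx]] := cl (~` B) B nB Bl; by [].
Qed.

Section SeveralVariables.
Context {R : realType}.
Local Notation C := R[i].

Lemma nrm_row (k : nat) (x : 'rV[C]_k) (B : R) : 0 <= B ->
  nrm x <= B <-> forall j, nrm (x ord0 j) <= B.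
Proof.
move=> B0; split=> [h j|h].
  apply: le_trans h; rewrite -lecR -!nrmE.
  have -> : `|x| = mx_norm x by []. 
  rewrite mx_normE.
  have : `|x ord0 j|%:nng <= \big[Num.max/0%:nng]_i `|x i.1 i.2|%:nng.
    by apply: (le_bigmax_cond _ (fun i : 'I_1 * 'I_k => `|x i.1 i.2|%:nng) (j := (ord0, j))).
  by rewrite -num_le.
have [x0|xn0] := eqVneq (mx_norm x) 0.
  by rewrite /nrm (_ : `|x| = mx_norm x) // x0.
have [[i j] E] := mx_norm_neq0 xn0.
by rewrite /nrm (_ : `|x| = mx_norm x) // E /= (ord1 i); exact: h.
Qed.

Lemma nrm_coord (k : nat) (x : 'rV[C]_k) j : nrm (x ord0 j) <= nrm x.
Proof. by have [+ _] := nrm_row x (nrm_ge0 x); apply. Qed.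

Lemma ultra_cvg_bounded (I : Type) (U : set_system I) {UU : UltraFilter U}
    (k : nat) (u : I -> 'rV[C]_k) (B : R) :
  (\forall i \near U, nrm (u i) <= B) -> exists2 l, nrm l <= B & u @ U --> l.
Proof.
move=> uB.
have B0 : 0 <= B by have [i hi] := filter_ex uB; exact: le_trans (nrm_ge0 _) hi.
have real_lim (a : I -> R) : (\forall i \near U, `|a i| <= B) ->
    exists l, forall e : R, 0 < e -> \forall i \near U, `|a i - l| < e.
  move=> aB; have [|l _ al] := @ultra_compact_cvg I U UU R a _ (@segment_compact R (- B) B).
    by apply: filterS aB => i; rewrite /= in_itv /= ler_norml.
  exists l => e e0; have /cvgrPdist_lt /(_ e e0) := al.
  by apply: filterS => i; rewrite distrC.
have lims (j : 'I_k) : exists l : C, forall e : R, 0 < e ->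
    \forall i \near U, nrm (u i ord0 j - l) < e.
  have [|a ha] := real_lim (fun i => complex.Re (u i ord0 j)).
    apply: filterS uB => i; apply: le_trans; apply: le_trans (nrm_Re _) (nrm_coord _ _).
  have [|b hb] := real_lim (fun i => complex.Im (u i ord0 j)).
    apply: filterS uB => i; apply: le_trans; apply: le_trans (nrm_Im _) (nrm_coord _ _).
  exists (Complex a b) => e e0; have e2 : 0 < e / 2 by rewrite divr_gt0.
  apply: filterS2 (ha _ e2) (hb _ e2) => i h1 h2.
  apply: le_lt_trans (nrm_ReIm _) _; rewrite !ReImE /=; lra.
have [l hl] := choice lims.
have ul : u @ U --> (\row_j l j : 'rV[C]_k).
  apply/cvg_nrmP => e e0; have e2 : 0 < e / 2 by rewrite divr_gt0.
  have H : U [set i | forall j, nrm (u i ord0 j - l j) < e / 2].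
    by apply: filter_forall => j; exact: hl.
  suff : U [set i | nrm (u i - \row_j l j) < e] by [].
  apply: (filterS _ H) => i h /=; apply: (@le_lt_trans _ _ (e / 2)); last by lra.
  by apply/(nrm_row _ (ltW e2)) => j; rewrite !mxE; apply/ltW/h.
exists (\row_j l j) => //; apply/ler_addgt0Pr => e e0.
have /cvg_nrmP /(_ e e0) h := ul.
have [i [h1 h2]] := filter_ex (filterI uB h).
have := nrmD (u i) (\row_j l j - u i); rewrite addrC subrK nrmBC; lra.
Qed.

(** * Cauchy estimates for vector-valued maps *)

(** A wrapper that keeps conversion from unfolding [differentiable]. *)
Variant hdiff (V W : normedModType C) (f : V -> W) (x : V) : Prop :=
  HDiff of differentiable f x.

Definition der (V W : normedModType C) (f : V -> W) (x : V) : V -> W := 'd f x.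

Lemma derD (V W : normedModType C) (f : V -> W) (x u v : V) :
  der f x (u + v) = der f x u + der f x v.
Proof. exact: raddfD. Qed.

Lemma derZ (V W : normedModType C) (f : V -> W) (x v : V) (a : C) :
  der f x (a *: v) = a *: der f x v.
Proof. exact: linearZ. Qed.

Lemma der0 (V W : normedModType C) (f : V -> W) (x : V) : der f x 0 = 0.
Proof. exact: raddf0. Qed.

Lemma hdiff_estimate (V W : normedModType C) (f : V -> W) (x : V) : hdiff f x ->
  forall e : R, 0 < e -> exists2 del, 0 < del &
    forall h, nrm h < del -> nrm (f (x + h) - f x - der f x h) <= e * nrm h.
Proof. by case=> df; exact: differentiable_nrm. Qed.

Lemma estimate_hdiff (V W : normedModType C) (f : V -> W) (x : V) (L : V -> W) (B : R) :
  (forall a u v, L (a *: u + v) = a *: L u + L v) ->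
  (forall h, nrm (L h) <= B * nrm h) ->
  (forall e : R, 0 < e -> exists2 del, 0 < del &
    forall h, nrm h < del -> nrm (f (x + h) - f x - L h) <= e * nrm h) ->
  hdiff f x /\ der f x = L.
Proof.
move=> Llin LB Lf.
pose lmx := GRing.isLinear.Build C V W *:%R L Llin.
pose L' : {linear V -> W} := HB.pack L lmx.
have [d1 d2] := @nrm_differentiable R V W f x L' B LB Lf.
by split; [split|rewrite /der d2].
Qed.

Lemma cder_unique (g : C -> C) (z a : C) : (forall e : R, 0 < e ->
  exists2 del, 0 < del & forall h, nrm h < del ->
    nrm (g (z + h) - g z - a * h) <= e * nrm h) -> cdiff g z /\ cder g z = a.
Proof.
move=> hg.
have := @estimate_hdiff C^o C^o g z ( *:%R (a : C)) (nrm a).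
case=> [b u v|h|e /hg [del d0 hd]|[d1] d2].
- by rewrite scalerDr !scalerA mulrC.
- by rewrite nrmZ.
- by exists del => // h /hd.
by split; [split|rewrite /cder -/(der _ _) d2 [LHS]mulr1].
Qed.

Lemma cdiff_line (V : normedModType C) (k : nat) (f : V -> 'rV[C]_k) (x v : V)
    (t : C) (j : 'I_k) : hdiff f (x + t *: v) ->
  cdiff (fun z => f (x + z *: v) ord0 j) t /\
  cder (fun z => f (x + z *: v) ord0 j) t = der f (x + t *: v) v ord0 j.
Proof.
move=> df; apply: cder_unique => e e0.
have v1 : 0 < nrm v + 1 by have := nrm_ge0 v; lra.
have [del d0 hd] := hdiff_estimate df (divr_gt0 e0 v1).
exists (del / (nrm v + 1)); first by rewrite divr_gt0.
move=> h; rewrite ltr_pdivlMr // => hh.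
have nhv : nrm (h *: v) <= nrm h * (nrm v + 1).
  by rewrite nrmZ ler_wpM2l ?nrm_ge0 //; lra.
have := hd (h *: v) (le_lt_trans nhv hh).
rewrite -(addrA x) -scalerDl derZ => H.
apply: le_trans (_ : e / (nrm v + 1) * (nrm h * (nrm v + 1)) <= _); last first.
  by rewrite mulrCA divfK ?gt_eqF // mulrC.
apply: le_trans (ler_wpM2l _ nhv); last by rewrite divr_ge0 // ltW.
apply: le_trans H; apply: le_trans (nrm_coord _ j).
by rewrite !mxE [h * _]mulrC.
Qed.

Section Cauchy.
Context (V : normedModType C) (k : nat) (f : V -> 'rV[C]_k) (x : V) (r M : R).
Hypotheses (r0 : 0 < r) (df : forall y, nrm (y - x) < r -> hdiff f y)
  (fM : forall y, nrm (y - x) < r -> nrm (f y) <= M).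

Let M0 : 0 <= M.
Proof. by apply: le_trans (nrm_ge0 (f x)) (fM _); rewrite subrr nrm0. Qed.

Lemma cauchy_der v : nrm (der f x v) <= 16 * M / r * nrm v.
Proof.
have [->|v0] := eqVneq v 0; first by rewrite der0 !nrm0 mulr0.
have v1 : 0 < nrm v by rewrite nrm_gt0.
have B0 : 0 <= 16 * M / r * nrm v.
  by rewrite mulr_ge0 ?nrm_ge0 // divr_ge0 ?mulr_ge0 // ltW.
apply/(nrm_row _ B0) => j.
have inb z : nrm z < r / nrm v -> nrm (x + z *: v - x) < r.
  by rewrite addrAC subrr add0r nrmZ ltr_pdivlMr.
have [|z zr|z zr|+ _] := @cauchy_estimates _ (fun z => f (x + z *: v) ord0 j) (r / nrm v) M.
- by rewrite divr_gt0.
- by have [] := @cdiff_line V k f x v z j (df (inb z zr)).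
- by apply: le_trans (nrm_coord _ _) (fM (inb z zr)).
have h0 : hdiff f (x + 0 *: v) by apply: df; rewrite scale0r addr0 subrr nrm0.
have [_ ->] := cdiff_line j h0.
by rewrite scale0r addr0 invf_div mulrA mulrAC.
Qed.

Lemma cauchy_taylor v : nrm v <= r / 16 ->
  nrm (f (x + v) - f x - der f x v) <= 256 * M / r ^+ 2 * nrm v ^+ 2.
Proof.
have [->|v0] := eqVneq v 0.
  by rewrite der0 addr0 subr0 subrr !nrm0 expr0n mulr0.
have v1 : 0 < nrm v by rewrite nrm_gt0.
move=> vr.
have B0 : 0 <= 256 * M / r ^+ 2 * nrm v ^+ 2.
  apply: mulr_ge0; last exact/exprn_ge0/nrm_ge0.
  by apply: divr_ge0; [exact: mulr_ge0 (ler0n _ _) M0|exact/exprn_ge0/ltW].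
apply/(nrm_row _ B0) => j.
have inb z : nrm z < r / nrm v -> nrm (x + z *: v - x) < r.
  by rewrite addrAC subrr add0r nrmZ ltr_pdivlMr.
have [|z zr|z zr|_ /(_ 1)] := @cauchy_estimates _ (fun z => f (x + z *: v) ord0 j) (r / nrm v) M.
- by rewrite divr_gt0.
- by have [] := @cdiff_line V k f x v z j (df (inb z zr)).
- by apply: le_trans (nrm_coord _ _) (fM (inb z zr)).
have h0 : hdiff f (x + 0 *: v) by apply: df; rewrite scale0r addr0 subrr nrm0.
have [_ ->] := cdiff_line j h0.
rewrite scale0r scale1r addr0 mulr1 !mxE nrm1 expr1n mulr1.
have -> : 256 * M / (r / nrm v) ^+ 2 = 256 * M / r ^+ 2 * nrm v ^+ 2.
  by field; rewrite !gt_eqF.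
by apply; rewrite mulrAC ler_pdivlMr // mul1r.
Qed.

End Cauchy.

(** The estimates of order 1 and 2 around y when z is close to y, the bound M
    itself otherwise. *)
Lemma cauchy_lipschitz (V : normedModType C) (k : nat) (f : V -> 'rV[C]_k) (x : V) (r M : R) :
  0 < r -> (forall y, nrm (y - x) < r -> hdiff f y) ->
  (forall y, nrm (y - x) < r -> nrm (f y) <= M) ->
  forall y z, nrm (y - x) < r / 2 -> nrm (z - x) < r / 2 ->
    nrm (f z - f y) <= 64 * M / r * nrm (z - y).
Proof.
move=> r0 df fM y z yr zr; pose s := r / 2.
have s0 : 0 < s by rewrite divr_gt0.
have rs : r = 2 * s by rewrite /s; field.
have inb w : nrm (w - y) < s -> nrm (w - x) < r.
  by move=> ws; have := nrm_tri y w x; rewrite /s in ws *; lra.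
have d1 w (ws : nrm (w - y) < s) := df w (inb w ws).
have M1 w (ws : nrm (w - y) < s) := fM w (inb w ws).
have M0 : 0 <= M by apply: le_trans (nrm_ge0 (f x)) (fM x _); rewrite subrr nrm0.
pose h := z - y.
have zE : z = y + h by rewrite /h addrC subrK.
have Ms : 0 <= M / s by rewrite divr_ge0 // ltW.
have -> : 64 * M / r * nrm h = 32 * (M / s * nrm h) by rewrite rs; field; rewrite gt_eqF.
have [hs|hs] := leP (nrm h) (s / 16).
  have := cauchy_taylor s0 d1 M1 hs; rewrite -zE.
  have := cauchy_der s0 d1 M1 h.
  have -> : 16 * M / s * nrm h = 16 * (M / s * nrm h) by ring.
  have -> : 256 * M / s ^+ 2 * nrm h ^+ 2 = 256 * (M / s * nrm h) * (nrm h / s).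
    by field; rewrite gt_eqF.
  have h16 : nrm h / s <= 1 / 16 by rewrite ler_pdivrMr //; lra.
  move=> q2 q3; have := nrmD (f z - f y - der f y h) (der f y h); rewrite subrK.
  have : 256 * (M / s * nrm h) * (nrm h / s) <= 256 * (M / s * nrm h) * (1 / 16).
    apply: ler_wpM2l h16; apply: mulr_ge0; first exact: ler0n.
    exact: mulr_ge0 Ms (nrm_ge0 h).
  lra.
have : nrm (f z - f y) <= 2 * M.
  have := nrmB (f z) (f y).
  have zr' : nrm (z - x) < r by lra.
  have yr' : nrm (y - x) < r by lra.
  by have := fM z zr'; have := fM y yr'; lra.
have : M / s * (s / 16) <= M / s * nrm h by rewrite ler_wpM2l // ltW.
have -> : M / s * (s / 16) = M / 16 by field; rewrite gt_eqF.
lra.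
Qed.

End SeveralVariables.

(** * Limits and differences of holomorphic maps *)

Section HolomorphicMaps.
Context {R : realType}.
Local Notation C := R[i].

Lemma hdiff_comp (U V W : normedModType C) (f : U -> V) (g : V -> W) (x : U) :
  hdiff f x -> hdiff g (f x) ->
  hdiff (g \o f) x /\ der (g \o f) x = der g (f x) \o der f x.
Proof.
by move=> [df] [dg]; split; [split; exact: differentiable_comp|exact: diff_comp].
Qed.

Lemma hdiff_near (V W : normedModType C) (f g : V -> W) (x : V) :
  (\forall y \near x, f y = g y) -> hdiff f x -> hdiff g x /\ der g x = der f x.
Proof.
move=> fg [df]; have [d1 d2] := near_eq_differentiable fg df.
split; [exact: HDiff d1|exact: d2].
Qed.

Lemma hdiff_same_der (V W : normedModType C) (f g : V -> W) (x : V) : hdiff f x ->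
  (forall h, g (x + h) - g x = f (x + h) - f x) -> hdiff g x /\ der g x = der f x.
Proof.
move=> df fg.
have [d1 d2] : is_diff x g ('d f x).
  apply: is_diff_estimate => [|e /(hdiff_estimate df) [del d0 hd]].
    by case: df => df; exact: ((diff_locallyP _ _).1 df).1.
  by exists del => // h /hd; rewrite fg.
by split; [exact: HDiff d1|exact: d2].
Qed.

Lemma hdiff_cont (V W : normedModType C) (f : V -> W) (x : V) :
  hdiff f x -> {for x, continuous f}.
Proof. by move=> [df]; exact: differentiable_continuous. Qed.

Lemma hdiffB (V W : normedModType C) (f g : V -> W) (x : V) :
  hdiff f x -> hdiff g x -> hdiff (fun y => f y - g y) x.
Proof. by move=> [df] [dg]; split; exact: (@differentiableB _ V W f g). Qed.

Lemma hdiff_cst (V W : normedModType C) (a : W) (x : V) : hdiff (fun=> a) x.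
Proof. by split; exact: differentiable_cst. Qed.

Lemma hdiff_id (V : normedModType C) (x : V) : hdiff id x.
Proof. by split; have [] := @is_diff_id _ V x. Qed.

Lemma hdiff_pair (V W1 W2 : normedModType C) (f : V -> W1) (g : V -> W2) (x : V) :
  hdiff f x -> hdiff g x -> hdiff (fun y => (f y, g y)) x.
Proof. by move=> [df] [dg]; split; exact: differentiable_pair. Qed.

Lemma hdiff_lin (V W : normedModType C) (L : V -> W) (B : R) (x : V) :
  (forall a u v, L (a *: u + v) = a *: L u + L v) ->
  (forall h, nrm (L h) <= B * nrm h) -> hdiff L x /\ der L x = L.
Proof.
move=> Ll LB; apply: (estimate_hdiff Ll LB) => e e0; exists 1 => // h _.
have -> : L (x + h) = L x + L h by rewrite -[x in LHS]scale1r Ll scale1r.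
by rewrite (addrC (L x)) addrK subrr nrm0; apply: mulr_ge0; [exact: ltW|exact: nrm_ge0].
Qed.

Lemma hdiffZ (V : normedModType C) (a : C) (x : V) :
  hdiff ( *:%R a) x /\ der ( *:%R a) x = *:%R a.
Proof.
apply: (@hdiff_lin V V _ (nrm a)) => [b u v|h]; last by rewrite nrmZ.
by rewrite scalerDr !scalerA mulrC.
Qed.

Lemma hdiff_line (V : normedModType C) (x v : V) (t : C) :
  hdiff (fun s : C^o => x + s *: v) (t : C^o) /\
  der (fun s : C^o => x + s *: v) (t : C^o) = fun s => s *: v.
Proof.
apply: (@estimate_hdiff _ C^o V _ _ _ (nrm v)).
- by move=> a y z; rewrite scalerDl scalerA.
- by move=> h; rewrite nrmZ mulrC.
- move=> e e0; exists 1 => // h _; rewrite scalerDl.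
  rewrite addrA (addrC (x + t *: v)) addrK subrr nrm0.
  by apply: mulr_ge0; [exact: ltW|exact: nrm_ge0].
Qed.

Lemma cvg_nrm_le (I : Type) (U : set_system I) {UU : ProperFilter U}
    (V : normedModType C) (u : I -> V) (l : V) (B : R) :
  u @ U --> l -> (\forall i \near U, nrm (u i) <= B) -> nrm l <= B.
Proof.
move=> ul uB; apply/ler_addgt0Pr => e e0.
have /cvg_nrmP /(_ e e0) h := ul.
have [i [h1 h2]] := filter_ex (filterI uB h).
have := nrmD (u i) (l - u i); rewrite addrC subrK nrmBC; lra.
Qed.

(** Weierstrass' theorem. The order 2 Cauchy estimate passes to the limit, so
    that pointwise convergence of a bounded family is enough. *)
Lemma weierstrass (I : Type) (U : set_system I) {UU : UltraFilter U}
    (V : normedModType C) (k : nat) (f_ : I -> V -> 'rV[C]_k) (f : V -> 'rV[C]_k)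
    (x : V) (r M : R) : 0 < r ->
  (\forall i \near U, forall y, nrm (y - x) < r ->
     hdiff (f_ i) y /\ nrm (f_ i y) <= M) ->
  (forall y, nrm (y - x) < r -> f_ ^~ y @ U --> f y) ->
  hdiff f x.
Proof.
move=> r0 fU fl.
have M0 : 0 <= M.
  have [i hi] := filter_ex fU; have [|_ h] := hi x; first by rewrite subrr nrm0.
  exact: le_trans (nrm_ge0 _) h.
have derB v : \forall i \near U, nrm (der (f_ i) x v) <= 16 * M / r * nrm v.
  apply: filterS fU => i h; apply: cauchy_der => // y yr; by have [] := h y yr.
have /choice [L hL] : forall v, exists l, nrm l <= 16 * M / r * nrm v /\
    der (f_ i) x v @[i --> U] --> l.
  by move=> v; have [l l1 l2] := ultra_cvg_bounded (derB v); exists l.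
have Ll a u v : L (a *: u + v) = a *: L u + L v.
  apply: (@cvg_unique _ (@norm_hausdorff _ _) _ _ _ _ (hL _).2).
  have -> : (fun i => der (f_ i) x (a *: u + v)) =
      (fun i => a *: der (f_ i) x u + der (f_ i) x v).
    by apply/funext => i; rewrite derD derZ.
  by apply: cvgD; [apply: (@cvgZl_tmp)|]; exact: (hL _).2.
pose K := 256 * M / r ^+ 2.
have K0 : 0 <= K by apply: divr_ge0; [apply: mulr_ge0; [exact: ler0n|exact: M0]|exact/exprn_ge0/ltW].
have est h : nrm h <= r / 16 -> nrm (f (x + h) - f x - L h) <= K * nrm h ^+ 2.
  move=> hr; have xh : nrm (x + h - x) < r by rewrite addrAC subrr add0r; lra.
  have xx : nrm (x - x) < r by rewrite subrr nrm0.
  apply: (@cvg_nrm_le I U _ _ (fun i => f_ i (x + h) - f_ i x - der (f_ i) x h)).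
    by apply: cvgB; [apply: cvgB; exact: fl|exact: (hL _).2].
  by apply: filterS fU => i hi; apply: cauchy_taylor => // y yr; have [] := hi y yr.
have [] // := @estimate_hdiff R V _ f x L (16 * M / r) Ll (fun h => (hL h).1).
move=> e e0; have K1 : 0 < K + 1 by lra.
exists (Num.min (r / 16) (e / (K + 1))); first by rewrite lt_min !divr_gt0.
move=> h; rewrite lt_min => /andP[/ltW /est H he].
apply: le_trans H _; rewrite expr2 mulrA ler_wpM2r ?nrm_ge0 //.
by rewrite ltr_pdivlMr // in he; have := nrm_ge0 h; lra.
Qed.

(** The Lipschitz bound in x for the function [f x y' - f x y], which is itself
    bounded thanks to the Lipschitz bound in y. *)
Lemma mixed_difference (V1 V2 : normedModType C) (k : nat)
    (f : V1 -> V2 -> 'rV[C]_k) (x0 : V1) (y0 : V2) (r M : R) : 0 < r ->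
  (forall x y, nrm (x - x0) < r -> nrm (y - y0) < r ->
     [/\ hdiff (f ^~ y) x, hdiff (f x) y & nrm (f x y) <= M]) ->
  forall x x' y y', nrm (x - x0) < r / 2 -> nrm (x' - x0) < r / 2 ->
    nrm (y - y0) < r / 2 -> nrm (y' - y0) < r / 2 ->
  nrm ((f x' y' - f x' y) - (f x y' - f x y)) <=
    4096 * M / r ^+ 2 * nrm (x' - x) * nrm (y' - y).
Proof.
move=> r0 hf x x' y y' xr xr' yr yr'.
have hr : r / 2 <= r by lra.
have := @cauchy_lipschitz R V1 k (fun u => f u y' - f u y) x0 r (64 * M / r * nrm (y' - y)) r0.
move=> /(_ _ _ x x' xr xr').
have -> : 64 * (64 * M / r * nrm (y' - y)) / r * nrm (x' - x) =
   4096 * M / r ^+ 2 * nrm (x' - x) * nrm (y' - y) by field; rewrite gt_eqF.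
apply.
- move=> u ur; apply: hdiffB.
    by have [] := hf u y' ur (lt_le_trans yr' hr).
  by have [] := hf u y ur (lt_le_trans yr hr).
- move=> u ur; apply: (cauchy_lipschitz r0 _ _ yr yr') => v vr.
    by have [] := hf u v ur vr.
  by have [] := hf u v ur vr.
Qed.

Lemma nat_ultra : exists U : set_system nat, UltraFilter U /\ \oo `<=` U.
Proof. exact: ultraFilterLemma. Qed.

(** Iteration of the contraction [x |-> y - rho x]; the limit of the bounded
    sequence of iterates along an ultrafilter is the fixed point. *)
Lemma perturb_id_surj (p : nat) (rho : 'rV[C]_p -> 'rV[C]_p) (s : R) :
  0 < s -> rho 0 = 0 ->
  (forall x x', nrm x <= s -> nrm x' <= s -> nrm (rho x' - rho x) <= nrm (x' - x) / 2) ->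
  forall y, nrm y <= s / 2 -> exists2 x, nrm x <= 2 * nrm y & x + rho x = y.
Proof.
move=> s0 rho0 rhoL y ys.
pose u := fix u n := if n is n'.+1 then y - rho (u n') else 0.
have uB n : nrm (u n) <= 2 * nrm y.
  elim: n => [|n ih] /=; first by rewrite nrm0 mulr_ge0 ?nrm_ge0.
  have := nrmB y (rho (u n)); have := @rhoL 0 (u n).
  by rewrite nrm0 rho0 !subr0 => /(_ (ltW s0)) h1; have := h1 ltac:(lra); lra.
have uD n : nrm (u n.+1 - u n) <= nrm y / 2 ^+ n.
  elim: n => [|n ih].
    by rewrite /= rho0 !subr0 expr0 divr1.
  have -> : u n.+2 - u n.+1 = - (rho (u n.+1) - rho (u n)).
    have E a b : (y - a) - (y - b) = - (a - b) by rewrite (opprB y) addrC subrKA opprB.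
    exact: E (rho (u n.+1)) (rho (u n)).
  rewrite nrmN.
  have uB1 := uB n; have uB2 := uB n.+1.
  apply: le_trans (rhoL _ _ _ _) _; [lra|lra|].
  rewrite exprS invfM mulrCA [leRHS]mulrC; lra.
have [U [UU Uoo]] := nat_ultra.
have [x xB ux] := @ultra_cvg_bounded R nat U UU p u (2 * nrm y) (filterE _ uB).
exists x => //; apply/eqP; rewrite -subr_eq0; apply/eqP/nrm0_eq0/eqP.
rewrite eq_le nrm_ge0 andbT; apply/ler_addgt0Pr => e e0; rewrite add0r.
have e4 : 0 < e / 4 by rewrite divr_gt0.
have /cvg_nrmP /(_ _ e4) H := ux.
have H2 : U [set n | nrm y / 2 ^+ n < e / 4].
  apply: Uoo.
  have y1 : 0 < nrm y + 1 by have := nrm_ge0 y; lra.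
  apply: filterS (near_infty_natSinv_expn_lt (PosNum (divr_gt0 e4 y1))) => n /=.
  rewrite div1r ltr_pdivlMr // mulrC => h; apply: le_lt_trans h.
  by rewrite ler_wpM2r // ?invr_ge0 ?exprn_ge0 //; lra.
have [n [h1 h2]] := filter_ex (filterI H H2).
have -> : x + rho x - y = (x - u n) + (u n - u n.+1) + (rho x - rho (u n)).
  by rewrite /= subrKA opprB -[RHS]addrA -[LHS]addrA; congr (_ + _); rewrite [RHS]addrC subrKA.
have ubn := uB n.
have h3 := rhoL (u n) x ltac:(lra) ltac:(lra).
have h4 := uD n; rewrite nrmBC in h4.
have := nrmD (x - u n + (u n - u n.+1)) (rho x - rho (u n)).
have := nrmD (x - u n) (u n - u n.+1).
rewrite (nrmBC x) in h3 *; rewrite /= in h2; lra.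
Qed.

End HolomorphicMaps.

(** * Holomorphic maps in charts *)

Lemma near_continuous (S T : topologicalType) (f : S -> T) (z : S) (P : set T) :
  {for z, continuous f} -> (\forall y \near f z, P y) -> \forall w \near z, P (f w).
Proof. by move=> fc; exact: fc. Qed.

Section Charts.
Context {R : realType}.
Local Notation C := R[i].

Lemma chart_invK (k : nat) (M : topologicalType) (a : chart R k M) (p : M) :
  chart_dom a p -> chart_inv a (a p) = p.
Proof. by move=> ap; apply: (@chart_funK _ _ _ a); rewrite inE. Qed.

Lemma chart_dom_near (k : nat) (M : topologicalType) (a : chart R k M) (p : M) :
  chart_dom a p -> \forall q \near p, chart_dom a q.
Proof. by move=> ap; apply: open_nbhs_nbhs; split => //; exact: chart_dom_open. Qed.

Lemma chart_cont (k : nat) (M : topologicalType) (a : chart R k M) (p : M) :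
  chart_dom a p -> {for p, continuous a}.
Proof. by move=> ap; apply: (@chart_fun_cont _ _ _ a); rewrite inE. Qed.

Lemma chart_inv_continuous (k : nat) (M : topologicalType) (a : chart R k M) (p : M) :
  chart_dom a p -> {for a p, continuous (chart_inv a)}.
Proof.
by move=> ap; apply: (@chart_inv_cont _ _ _ a); rewrite inE; exists p.
Qed.

Lemma chart_cod_near (k : nat) (M : topologicalType) (a : chart R k M) (p : M) :
  chart_dom a p -> \forall x \near (a p : 'rV[C]_k),
    chart_dom a (chart_inv a x) /\ a (chart_inv a x) = x.
Proof.
move=> ap; have : nbhs (a p : 'rV[C]_k) (a @` chart_dom a).
  by apply: open_nbhs_nbhs; split; [exact: chart_cod_open|exists p].
by apply: filterS => _ [q aq <-]; rewrite chart_invK.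
Qed.

Section CurvesInManifolds.
Context (V : normedModType C) (k : nat) (M : complexManifold R k).
Implicit Types (f : V -> M) (z : V) (a b : chart R k M).

Definition mhol f z := {for z, continuous f} /\ hdiff (chart_at (f z) \o f) z.

Definition mder f z : V -> 'rV[C]_k := der (chart_at (f z) \o f) z.

Lemma holomorphic_fromE f : holomorphic_from f <-> forall z, mhol f z.
Proof.
split=> h z; have [h1 h2] := h z.
  by split; [exact: h1|exact: HDiff h2].
by case: h2 => h2; split; [exact: h1|exact: h2].
Qed.

(** The transition map is differentiable at the point, and near the point the
    new coordinates are the transition map applied to the old ones. *)
Lemma change_chart f z a b : atlas a -> atlas b -> chart_dom a (f z) ->
  chart_dom b (f z) -> {for z, continuous f} -> hdiff (a \o f) z -> hdiff (b \o f) z.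
Proof.
move=> Aa Ab az bz fc da.
have dab : hdiff (b \o chart_inv a) ((a \o f) z).
  by split; exact: atlas_compatible.
have [h _] := hdiff_comp da dab.
have E : \forall w \near z, ((b \o chart_inv a) \o (a \o f)) w = (b \o f) w.
  apply: filterS (near_continuous fc (chart_dom_near az)) => w /= aw.
  by rewrite chart_invK.
by have [] := hdiff_near E h.
Qed.

Lemma mhol_chart f z b : mhol f z -> atlas b -> chart_dom b (f z) -> hdiff (b \o f) z.
Proof.
move=> [fc fd] Ab bz; apply: (change_chart _ Ab _ bz fc fd).
  exact: atlas_chart_at.
exact: mem_chart_at.
Qed.

Lemma chart_mhol f z a : {for z, continuous f} -> atlas a -> chart_dom a (f z) ->
  hdiff (a \o f) z -> mhol f z.
Proof.
move=> fc Aa az da; split => //; apply: (change_chart Aa _ az _ fc da).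
  exact: atlas_chart_at.
exact: mem_chart_at.
Qed.

Lemma mhol_near f g z : (\forall w \near z, f w = g w) -> mhol f z ->
  mhol g z /\ mder g z = mder f z.
Proof.
move=> fg [fc fd]; have E := nbhs_singleton fg.
have gc : {for z, continuous g}.
  move=> A; rewrite -E => /(near_continuous fc) fA.
  suff : \forall w \near z, A (g w) by [].
  by apply: filterS2 fg fA => w <-.
have fg' : \forall w \near z, (chart_at (f z) \o f) w = (chart_at (g z) \o g) w.
  by apply: filterS fg => w /= ->; rewrite E.
have [d1 d2] := hdiff_near fg' fd.
by split; [split; [exact: gc|exact: d1]|exact: d2].
Qed.

Lemma mhol_cst (p : M) z : mhol (fun=> p) z.
Proof. by split; [exact: cst_continuous|exact: hdiff_cst]. Qed.

End CurvesInManifolds.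

Lemma mhol_comp (V W : normedModType C) (k : nat) (M : complexManifold R k)
    (h : W -> V) (f : V -> M) (w : W) :
  hdiff h w -> mhol f (h w) ->
  mhol (f \o h) w /\ mder (f \o h) w = mder f (h w) \o der h w.
Proof.
move=> dh [fc df]; have [d1 d2] := hdiff_comp dh df.
split; last exact: d2.
by split; [apply: continuous_comp; [exact: hdiff_cont|exact: fc]|exact: d1].
Qed.

Definition hol_at (k l : nat) (M : complexManifold R k) (N : complexManifold R l)
    (g : M -> N) (p : M) :=
  {for p, continuous g} /\ hdiff (in_charts g p) (chart_at p p).

Lemma holomorphic_onE (k l : nat) (M : complexManifold R k) (N : complexManifold R l)
    (U : set M) (g : M -> N) : holomorphic_on U g <-> forall p, U p -> hol_at g p.
Proof.
split=> h p /h [h1 h2].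
  by split; [exact: h1|exact: HDiff h2].
by case: h2 => h2; split; [exact: h1|exact: h2].
Qed.

Section Composition.
Context (V : normedModType C) (k l : nat) (M : complexManifold R k)
  (N : complexManifold R l).

Lemma mhol_hol (f : V -> M) (g : M -> N) (z : V) :
  mhol f z -> hol_at g (f z) ->
  mhol (g \o f) z /\ mder (g \o f) z = @mdiff R k l M N g (f z) \o mder f z.
Proof.
move=> [fc fd] [gc gd].
have [d1 d2] := hdiff_comp fd gd.
have E : \forall w \near z, (in_charts g (f z) \o (chart_at (f z) \o f)) w =
   (chart_at (g (f z)) \o (g \o f)) w.
  apply: filterS (near_continuous fc (chart_dom_near (mem_chart_at (f z)))) => w /= aw.
  by rewrite /in_charts /= chart_invK.
have [d3 d4] := hdiff_near E d1.
split; last by rewrite /mder d4 d2.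
by split; [apply: continuous_comp; [exact: fc|exact: gc]|exact: d3].
Qed.

End Composition.

Lemma in_chart_mhol (k : nat) (M : complexManifold R k) (p : M) :
  mhol (chart_inv (chart_at p)) (chart_at p p) /\
  mder (chart_inv (chart_at p)) (chart_at p p) = id.
Proof.
have pp := mem_chart_at p.
have E : \forall x \near (chart_at p p : 'rV[C]_k),
    id x = (chart_at p \o chart_inv (chart_at p)) x.
  by apply: filterS (chart_cod_near pp) => x [_ /= ->].
have [d1 d2] := hdiff_near E (hdiff_id _).
have c := chart_inv_continuous pp.
split.
  by apply: (chart_mhol c (atlas_chart_at p)); [rewrite chart_invK|exact: d1].
rewrite /mder (chart_invK pp); apply: (etrans d2).
by have [||_ ->] := @hdiff_lin R _ _ (@id 'rV[C]_k) 1 (chart_at p p);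
  [by []|by move=> h; rewrite mul1r|by []].
Qed.

Section HolComposition.
Context (k l q : nat) (M : complexManifold R k) (N : complexManifold R l)
  (P : complexManifold R q).

Lemma mdiff_id (p : M) : @mdiff R k k M M id p = id.
Proof.
have [_ <-] := in_chart_mhol p; rewrite /mder chart_invK //; exact: mem_chart_at.
Qed.

Lemma mdiff_comp (g : M -> N) (h : N -> P) (p : M) : hol_at g p -> hol_at h (g p) ->
  @mdiff R k q M P (h \o g) p = @mdiff R l q N P h (g p) \o @mdiff R k l M N g p.
Proof.
move=> hg hh; have [i1 i2] := in_chart_mhol p.
have pK := chart_invK (mem_chart_at p).
have gi : hol_at g (chart_inv (chart_at p) (chart_at p p)) by rewrite pK.
have [j1 j2] := mhol_hol i1 gi.
have hi : hol_at h ((g \o chart_inv (chart_at p)) (chart_at p p)) by rewrite /= pK.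
have [_ E] := mhol_hol j1 hi; rewrite j2 i2 /mder /= pK in E.
exact: E.
Qed.

End HolComposition.

End Charts.

(** * Coordinates on a Lie group *)

Section LieGroup.
Context {R : realType} {m : nat} (G : complexLieGroup R m).
Local Notation C := R[i].
Local Notation V := 'rV[C]_m.

Lemma continuous_mul (T : topologicalType) (f g : T -> G) (z : T) :
  {for z, continuous f} -> {for z, continuous g} ->
  {for z, continuous (fun w => (f w * g w)%g)}.
Proof.
move=> fc gc; have H := @mulg_continuous R m G (f z, g z).
exact: (cvg_comp (fun w => (f w, g w)) (fun x : G * G => (x.1 * x.2)%g) (cvg_pair fc gc) H).
Qed.

Lemma mhol_mul (W : normedModType C) (f g : W -> G) (z : W) :
  mhol f z -> mhol g z -> mhol (fun w => (f w * g w)%g) z.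
Proof.
move=> [fc fd] [gc gd]; split; first exact: continuous_mul.
have d1 := hdiff_pair fd gd.
have d2 := HDiff (@mulg_differentiable R m G (f z) (g z)).
have [d3 _] := hdiff_comp d1 d2.
have fE := near_continuous fc (chart_dom_near (mem_chart_at (f z))).
have gE := near_continuous gc (chart_dom_near (mem_chart_at (g z))).
suff E : \forall w \near z, (fun w => chart_at (f z * g z)%g
    (chart_inv (chart_at (f z)) (chart_at (f z) (f w)) *
     chart_inv (chart_at (g z)) (chart_at (g z) (g w)))%g) w =
    (chart_at (f z * g z)%g \o (fun w => (f w * g w)%g)) w.
  by have [] := hdiff_near E d3.
by apply: filterS2 fE gE => w fw gw /=; rewrite !chart_invK.
Qed.

Lemma mhol_exp (W : normedModType C) (f : W -> G) (z : W) (n : nat) :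
  mhol f z -> mhol (fun w => (f w ^+ n)%g) z.
Proof.
move=> df; elim: n => [|n ih]; first exact: mhol_cst.
have -> : (fun w => (f w ^+ n.+1)%g) = (fun w => (f w * f w ^+ n)%g).
  by apply/funext => w; rewrite expgS.
exact: mhol_mul.
Qed.

Lemma hol_Ltrans (g h : G) : hol_at (Ltrans g) h.
Proof.
have c : {for h, continuous (Ltrans g)}.
  by apply: continuous_mul; [exact: cst_continuous|by move=> A].
split; first exact: c.
have [i1 _] := in_chart_mhol h.
have [_] := mhol_mul (mhol_cst g (chart_at h h)) i1.
by rewrite (chart_invK (mem_chart_at h)).
Qed.

(** Coordinates centred at the identity: near 0 and 1, [kap] and [ell] are
    inverse to each other. *)
Definition kap (x : V) : G := chart_inv (chart_at (1%g : G)) (x + chart_at (1%g : G) 1%g).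
Definition ell (g : G) : V := chart_at (1%g : G) g - chart_at (1%g : G) 1%g.
Definition dom1 : set G := chart_dom (chart_at (1%g : G)).

Lemma dom1_1 : dom1 1%g. Proof. exact: mem_chart_at. Qed.

Lemma kap_ell g : dom1 g -> kap (ell g) = g.
Proof. by move=> h; rewrite /kap /ell subrK chart_invK. Qed.

Lemma ell1 : ell 1%g = 0. Proof. by rewrite /ell subrr. Qed.

Lemma kap0 : kap 0 = 1%g.
Proof. by rewrite -ell1 kap_ell //; exact: dom1_1. Qed.

Lemma ell_cont g : dom1 g -> {for g, continuous ell}.
Proof.
move=> h; apply: (@cvgB _ V G _ _ (chart_at (1%g : G)) (fun=> chart_at (1%g : G) 1%g)).
  exact: chart_cont.
exact: cvg_cst.
Qed.

Lemma mhol_ell (W : normedModType C) (f : W -> G) (z : W) :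
  mhol f z -> dom1 (f z) -> hdiff (ell \o f) z.
Proof.
move=> df dz; have h := mhol_chart df (atlas_chart_at _) dz.
exact: hdiffB h (hdiff_cst _ _).
Qed.

Lemma kap_near x : dom1 (kap x) -> ell (kap x) = x -> 
  [/\ {for x, continuous kap}, mhol kap x &
   \forall y \near x, dom1 (kap y) /\ ell (kap y) = y].
Proof.
move=> dx ex.
have xE : x + chart_at (1%g : G) 1%g = chart_at (1%g : G) (kap x).
  by rewrite -{1}ex /ell subrK.
have trc : {for x, continuous (fun y : V => y + chart_at (1%g : G) 1%g)}.
  by apply: (@cvgD C V V (nbhs x) _ id (fun=> chart_at (1%g : G) 1%g)); [exact: cvg_id|exact: cvg_cst].
have kc : {for x, continuous kap}.
  apply: (@continuous_comp _ _ _ (fun y : V => y + chart_at (1%g : G) 1%g)); first exact: trc.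
  by rewrite xE; exact: chart_inv_continuous.
have near : \forall y \near x, dom1 (kap y) /\ ell (kap y) = y.
  have H : \forall y \near x + chart_at (1%g : G) 1%g,
      dom1 (chart_inv (chart_at (1%g : G)) y) /\
      chart_at (1%g : G) (chart_inv (chart_at (1%g : G)) y) = y.
    by rewrite xE; exact: chart_cod_near.
  apply: filterS (near_continuous trc H) => y [h1 h2]; split => //.
  by rewrite /ell /kap h2 addrK.
split; [exact: kc| |exact: near].
apply: (chart_mhol kc (atlas_chart_at (1%g : G)) dx).
have E : \forall y \near x, (fun y : V => y - (- chart_at (1%g : G) 1%g)) y =
    (chart_at (1%g : G) \o kap) y.
  by apply: filterS near => y [_ h] /=; rewrite opprK -{1}h /ell subrK.
by have [] := hdiff_near E (hdiffB (hdiff_id _) (hdiff_cst _ _)).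
Qed.

Lemma local_coordinates : exists2 r : R, 0 < r &
  (forall x, nrm x < r -> dom1 (kap x) /\ ell (kap x) = x) /\
  (forall x y, nrm x < r -> nrm y < r ->
     dom1 (kap x * kap y)%g /\ nrm (ell (kap x * kap y)%g) <= 1).
Proof.
have d0 : dom1 (kap 0) by rewrite kap0; exact: dom1_1.
have e0 : ell (kap 0) = 0 by rewrite kap0 ell1.
have [kc _ /nbhs_nrmP [r1 r10 h1]] := kap_near d0 e0.
have gA : nbhs (1%g : G) (dom1 `&` [set g | nrm (ell g) < 1]).
  apply: filterI; first exact/chart_dom_near/dom1_1.
  have := ell_cont dom1_1; rewrite /prop_for /continuous_at ell1 => /cvg_nrmP /(_ 1 ltr01).
  by apply: filterS => g; rewrite subr0.
have mc : {for ((0, 0) : V * V), continuous (fun w : V * V => (kap w.1 * kap w.2)%g)}.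
  apply: continuous_mul.
    by apply: (@continuous_comp _ _ _ fst kap); [exact: cvg_fst|exact: kc].
  by apply: (@continuous_comp _ _ _ snd kap); [exact: cvg_snd|exact: kc].
have gA' : \forall g \near (kap ((0, 0) : V * V).1 * kap ((0, 0) : V * V).2)%g, dom1 g /\ nrm (ell g) < 1.
  by rewrite /= kap0 mulg1.
have [[Q1 Q2] /= [/nbhs_nrmP [r2 r20 h2] /nbhs_nrmP [r3 r30 h3]] sub] :=
  near_continuous mc gA'.
exists (Num.min r1 (Num.min r2 r3)); first by rewrite !lt_min r10 r20.
split=> [x|x y]; rewrite !lt_min.
  by move=> /andP[xr _]; apply: h1; rewrite subr0.
move=> /and3P[_ xr _] /and3P[_ _ yr].
have [|a b] := sub (x, y); last by split; [exact: a|exact: ltW].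
by split; [apply: h2; rewrite subr0|apply: h3; rewrite subr0].
Qed.

End LieGroup.

Section Powers.
Context {R : realType} {m : nat} (G : complexLieGroup R m).
Local Notation C := R[i].
Local Notation V := 'rV[C]_m.
Local Notation kap := (@kap R m G).
Local Notation ell := (@ell R m G).
Local Notation dom1 := (@dom1 R m G).

(** The group law read in these coordinates. *)
Definition mlt (x y : V) : V := ell (kap x * kap y)%g.

(** In coordinates, the k-th power of [kap b]. *)
Definition pw (b : V) (k : nat) : V := iter k (mlt^~ b) 0.

Definition coord_radius (r : R) := 0 < r /\
  (forall x, nrm x < r -> dom1 (kap x) /\ ell (kap x) = x) /\
  (forall x y, nrm x < r -> nrm y < r ->
     dom1 (kap x * kap y)%g /\ nrm (ell (kap x * kap y)%g) <= 1).

Context (r : R) (rP : coord_radius r).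

Let r0 : 0 < r. Proof. by case: rP. Qed.

Lemma ell_kap x : nrm x < r -> ell (kap x) = x.
Proof. by case: rP => _ [h _] /h []. Qed.

Lemma dom1_kap x : nrm x < r -> dom1 (kap x).
Proof. by case: rP => _ [h _] /h []. Qed.

Lemma kap_mlt x y : nrm x < r -> nrm y < r -> kap (mlt x y) = (kap x * kap y)%g.
Proof. by case: rP => _ [_ h] xr yr; rewrite kap_ell //; case: (h x y xr yr). Qed.

Lemma mhol_kap x : nrm x < r -> mhol kap x.
Proof. by move=> xr; have [] := kap_near (dom1_kap xr) (ell_kap xr). Qed.

Lemma hdiff_mlt (W : normedModType C) (f g : W -> V) (z : W) :
  nrm (f z) < r -> nrm (g z) < r -> hdiff f z -> hdiff g z ->
  hdiff (fun w => mlt (f w) (g w)) z.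
Proof.
move=> fr gr df dg.
have [d1 _] := mhol_comp df (mhol_kap fr).
have [d2 _] := mhol_comp dg (mhol_kap gr).
apply: (mhol_ell (mhol_mul d1 d2)).
by case: rP => _ [_ h]; have [] := h _ _ fr gr.
Qed.

Lemma mlt0x y : nrm y < r -> mlt 0 y = y.
Proof. by move=> yr; rewrite /mlt kap0 mul1g ell_kap. Qed.

Lemma mltx0 x : nrm x < r -> mlt x 0 = x.
Proof. by move=> xr; rewrite /mlt kap0 mulg1 ell_kap. Qed.

Definition mlt_cst : R := 4096 / r ^+ 2.
Local Notation K := mlt_cst.

Lemma mlt_cst_ge0 : 0 <= K.
Proof. by apply: divr_ge0; [exact: ler0n|exact/exprn_ge0/ltW]. Qed.

(** All estimates of the group law follow from this one: the difference between
    product and sum vanishes when one factor is 1, so that it is bounded by a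
    bilinear term. *)
Lemma mlt_mixed x x' y y' : nrm x < r / 2 -> nrm x' < r / 2 -> nrm y < r / 2 ->
  nrm y' < r / 2 ->
  nrm ((mlt x' y' - mlt x' y) - (mlt x y' - mlt x y)) <= K * nrm (x' - x) * nrm (y' - y).
Proof.
move=> xr xr' yr yr'.
have H u v : nrm (u - 0) < r -> nrm (v - 0) < r ->
    [/\ hdiff (mlt^~ v) u, hdiff (mlt u) v & nrm (mlt u v) <= 1].
  rewrite !subr0 => ur vr; split.
  - exact: hdiff_mlt ur vr (hdiff_id _) (hdiff_cst _ _).
  - exact: hdiff_mlt ur vr (hdiff_cst _ _) (hdiff_id _).
  - by case: rP => _ [_ h]; have [] := h u v ur vr.
have := mixed_difference r0 H; rewrite mulr1 => {}H.
by have := H x x' y y'; rewrite !subr0; apply.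
Qed.

Lemma r2 (x : V) : nrm x < r / 2 -> nrm x < r.
Proof. by have := r0; lra. Qed.

Lemma nrm0_lt : nrm (0 : V) < r / 2.
Proof. by rewrite nrm0 divr_gt0. Qed.

Lemma mlt_approx x y : nrm x < r / 2 -> nrm y < r / 2 ->
  nrm (mlt x y - (x + y)) <= K * nrm x * nrm y.
Proof.
move=> xr yr; have := mlt_mixed nrm0_lt xr nrm0_lt yr.
rewrite !subr0 (mlt0x (r2 yr)) (mlt0x (r2 nrm0_lt)) (mltx0 (r2 xr)) subr0.
by rewrite opprD addrA.
Qed.

Lemma mlt_lipl x x' y : nrm x < r / 2 -> nrm x' < r / 2 -> nrm y < r / 2 ->
  nrm ((mlt x' y - mlt x y) - (x' - x)) <= K * nrm (x' - x) * nrm y.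
Proof.
move=> xr xr' yr; have := mlt_mixed xr xr' nrm0_lt yr.
rewrite subr0 (mltx0 (r2 xr)) (mltx0 (r2 xr')).
have -> : mlt x' y - x' - (mlt x y - x) = mlt x' y - mlt x y - (x' - x).
  by rewrite !opprB (addrC x) addrACA (addrC (- x')).
by [].
Qed.

Lemma mlt_lipr x y y' : nrm x < r / 2 -> nrm y < r / 2 -> nrm y' < r / 2 ->
  nrm ((mlt x y' - mlt x y) - (y' - y)) <= K * nrm x * nrm (y' - y).
Proof.
move=> xr yr yr'; have := mlt_mixed nrm0_lt xr yr yr'.
by rewrite subr0 (mlt0x (r2 yr)) (mlt0x (r2 yr')).
Qed.

(** On a ball of radius 2 s the quadratic error of the group law is at most
    half of the linear term, so that errors made in a product of many small
    factors do not build up. *)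
Definition pw_radius (s : R) := [/\ 0 < s, 4 * s < r & 4 * (K * s) <= 1].

Lemma pw_radius_ex : exists s, pw_radius s.
Proof.
have K1 : 0 < 4 * (K + 1) by have := mlt_cst_ge0; lra.
exists (Num.min (r / 5) (4 * (K + 1))^-1).
split; first by rewrite lt_min invr_gt0 K1 divr_gt0.
  have : Num.min (r / 5) (4 * (K + 1))^-1 <= r / 5 by rewrite ge_min lexx.
  by have := r0; lra.
rewrite mulrA; apply: (@le_trans _ _ (4 * K * (4 * (K + 1))^-1)).
  rewrite ler_wpM2l ?ge_min ?lexx ?orbT //.
  by apply: mulr_ge0 => //; exact: mlt_cst_ge0.
by rewrite ler_pdivrMr //; lra.
Qed.

Context (s : R) (sP : pw_radius s).
Let s0 : 0 < s. Proof. by case: sP. Qed.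
Let sr : 4 * s < r. Proof. by case: sP. Qed.
Let Ks : 4 * (K * s) <= 1. Proof. by case: sP. Qed.

Lemma pwS b k : pw b k.+1 = mlt (pw b k) b. Proof. by []. Qed.

Lemma pw_bound b k : k%:R * nrm b <= s -> nrm (pw b k) <= 2 * (k%:R * nrm b).
Proof.
elim: k => [|k ih]; first by rewrite nrm0 mul0r mulr0.
rewrite -natr1 mulrDl mul1r pwS => hs.
have := sr; have := s0; have := Ks => ? ? ?.
have b0 := nrm_ge0 b; have K0 := mlt_cst_ge0.
have kb : 0 <= k%:R * nrm b by apply: mulr_ge0.
have {ih} ih : nrm (pw b k) <= 2 * (k%:R * nrm b) by apply: ih; lra.
have br : nrm b < r / 2 by lra.
have pr : nrm (pw b k) < r / 2 by lra.
have := mlt_approx pr br.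
have : K * nrm (pw b k) * nrm b <= 1 * nrm b.
  apply: ler_wpM2r => //.
  have : K * nrm (pw b k) <= K * (2 * s) by apply: ler_wpM2l => //; lra.
  lra.
have := nrmD (mlt (pw b k) b - (pw b k + b)) (pw b k + b); rewrite subrK.
have := nrmD (pw b k) b; lra.
Qed.

Lemma pw_small b k : k%:R * nrm b <= s -> nrm (pw b k) < r / 2.
Proof. by move=> h; have := pw_bound h; have := sr; lra. Qed.

Lemma kS_le (b : V) k : k.+1%:R * nrm b <= s -> k%:R * nrm b <= s /\ nrm b <= s.
Proof.
rewrite -natr1 mulrDl mul1r => hs; have b0 := nrm_ge0 b.
by have kb : 0 <= k%:R * nrm b by [apply: mulr_ge0]; split; lra.
Qed.

Lemma kap_pw b k : k%:R * nrm b <= s -> kap (pw b k) = (kap b ^+ k)%g.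
Proof.
elim: k => [|k ih]; first by move=> _; exact: kap0.
move=> /kS_le [h1 h2].
have := sr; have := s0 => ? ?.
rewrite pwS kap_mlt ?ih // ?expgSr //; last lra.
exact/r2/pw_small.
Qed.

Lemma pw_linear b k : k%:R * nrm b <= s ->
  nrm (pw b k - k%:R *: b) <= K * (k%:R * nrm b) ^+ 2.
Proof.
elim: k => [|k ih]; first by move=> _; rewrite scale0r subr0 nrm0 mul0r expr0n mulr0.
move=> hs; have [h1 h2] := kS_le hs; have := sr; have := s0 => ? ?.
have b0 := nrm_ge0 b; have K0 := mlt_cst_ge0.
have br : nrm b < r / 2 by lra.
have e1 := mlt_approx (pw_small h1) br.
have e2 : K * nrm (pw b k) * nrm b <= K * (2 * (k%:R * nrm b)) * nrm b.
  by apply: ler_wpM2r => //; apply: ler_wpM2l => //; exact: pw_bound.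
have e3 := ih h1.
have -> : pw b k.+1 - k.+1%:R *: b =
   (mlt (pw b k) b - (pw b k + b)) + (pw b k - k%:R *: b).
  have <- : pw b k + b - (k%:R *: b + b) = pw b k - k%:R *: b.
    by rewrite (addrC (k%:R *: b)) addrKA.
  by rewrite subrKA -natr1 scalerDl scale1r.
apply: le_trans (nrmD _ _) _.
have -> : K * (k.+1%:R * nrm b) ^+ 2 = K * (2 * (k%:R * nrm b)) * nrm b +
   K * (k%:R * nrm b) ^+ 2 + K * nrm b ^+ 2 by rewrite -natr1; ring.
have : 0 <= K * nrm b ^+ 2 by apply: mulr_ge0 => //; exact: exprn_ge0.
lra.
Qed.

Lemma pw_lipschitz b b' k : k%:R * nrm b <= s -> k%:R * nrm b' <= s ->
  nrm (pw b' k - pw b k) <= 4 * (k%:R * nrm (b' - b)).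
Proof.
elim: k => [|k ih]; first by move=> _ _; rewrite subrr nrm0 mul0r mulr0.
move=> hs hs'; have [h1 h2] := kS_le hs; have [h1' h2'] := kS_le hs'.
have := sr; have := s0 => ? ?.
have b0 := nrm_ge0 b; have b0' := nrm_ge0 b'; have K0 := mlt_cst_ge0.
have d0 := nrm_ge0 (b' - b).
have br : nrm b < r / 2 by lra.
have br' : nrm b' < r / 2 by lra.
have e3 := ih h1 h1'.
have e1 := mlt_lipl (pw_small h1) (pw_small h1') br.
have e2 := mlt_lipr (pw_small h1') br br'.
have f1 : K * nrm (pw b' k - pw b k) * nrm b <= nrm (b' - b).
  apply: (@le_trans _ _ (K * (4 * (k%:R * nrm (b' - b))) * nrm b)).
    by apply: ler_wpM2r => //; apply: ler_wpM2l.
  have -> : K * (4 * (k%:R * nrm (b' - b))) * nrm b =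
    4 * (K * (k%:R * nrm b)) * nrm (b' - b) by ring.
  rewrite -[leRHS]mul1r; apply: ler_wpM2r => //.
  have : K * (k%:R * nrm b) <= K * s by apply: ler_wpM2l.
  have := Ks; lra.
have f2 : K * nrm (pw b' k) * nrm (b' - b) <= nrm (b' - b).
  rewrite -[leRHS]mul1r; apply: ler_wpM2r => //.
  have : K * nrm (pw b' k) <= K * (2 * s).
    by apply: ler_wpM2l => //; have := pw_bound h1'; lra.
  have := Ks; lra.
have g1 := nrmD (mlt (pw b' k) b - mlt (pw b k) b - (pw b' k - pw b k)) (pw b' k - pw b k).
have g2 := nrmD (mlt (pw b' k) b' - mlt (pw b' k) b - (b' - b)) (b' - b).
have g3 := nrm_tri (mlt (pw b' k) b) (mlt (pw b' k) b') (mlt (pw b k) b).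
rewrite subrK in g1; rewrite subrK in g2; rewrite !pwS -natr1.
move: d0 e1 e2 e3 f1 f2 g1 g2 g3; clear.
move: (pw b k) (pw b' k) => p p'; move: (mlt p b) (mlt p' b) (mlt p' b') => q q1 q'.
lra.
Qed.

Lemma pw_mul b k l : (k * l)%:R * nrm b <= s / 2 ->
  pw b (k * l) = pw (pw b k) l.
Proof.
move=> h; have := sr; have := s0 => ? ?.
have [->|l0] := eqVneq l 0%N; first by rewrite muln0.
have b0 := nrm_ge0 b.
have kb : k%:R * nrm b <= (k * l)%:R * nrm b.
  by apply: ler_wpM2r => //; rewrite ler_nat leq_pmulr // lt0n.
have h1 : l%:R * nrm (pw b k) <= s.
  apply: (@le_trans _ _ (l%:R * (2 * (k%:R * nrm b)))).
    by apply: ler_wpM2l => //; apply: pw_bound; lra.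
  have -> : l%:R * (2 * (k%:R * nrm b)) = 2 * ((k * l)%:R * nrm b) by rewrite natrM; ring.
  by lra.
have h2 : (k * l)%:R * nrm b <= s by lra.
have h3 : k%:R * nrm b <= s by lra.
have E : kap (pw b (k * l)) = kap (pw (pw b k) l) by rewrite !kap_pw // expgnA.
rewrite -(ell_kap (r2 (pw_small h2))) E ell_kap //.
exact/r2/pw_small.
Qed.

End Powers.

(** * The exponential map *)

Section Exponential.
Context {R : realType} {m : nat} (G : complexLieGroup R m).
Local Notation C := R[i].
Local Notation V := 'rV[C]_m.
Local Notation kap := (@kap R m G).
Local Notation ell := (@ell R m G).
Local Notation dom1 := (@dom1 R m G).
Local Notation pw := (@pw R m G).
Context (r : R) (rP : coord_radius G r).
Context (s : R) (sP : pw_radius r s).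
Local Notation K := (mlt_cst r).
Local Notation pw_bound := (pw_bound rP sP).
Local Notation pw_linear := (pw_linear rP sP).
Local Notation pw_lipschitz := (pw_lipschitz rP sP).
Local Notation pw_small := (pw_small rP sP).
Local Notation pw_mul := (pw_mul rP sP).
Local Notation kap_pw := (kap_pw rP sP).
Local Notation ell_kap := (ell_kap rP).
Local Notation dom1_kap := (dom1_kap rP).
Local Notation mhol_kap := (mhol_kap rP).
Local Notation r2 := (r2 rP).

Let r0 : 0 < r. Proof. by case: rP. Qed.
Let s0 : 0 < s. Proof. by case: sP. Qed.
Let sr : 4 * s < r. Proof. by case: sP. Qed.

(** The approximation [kap (x / N) ^ N] of the exponential of x, with
    N = n + 1, read in coordinates. *)
Definition euler (n : nat) (x : V) : V := pw ((n.+1%:R : C)^-1 *: x) n.+1.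

Lemma nrm_natV k : nrm (k.+1%:R^-1 : C) = k.+1%:R^-1.
Proof.
rewrite nrmV; congr (_^-1).
have -> : (k.+1%:R : C) = k.+1%:R%:C by rewrite rmorph_nat.
by rewrite nrmR ger0_norm.
Qed.

Lemma nrm_div k (x : V) : k.+1%:R * nrm ((k.+1%:R : C)^-1 *: x) = nrm x.
Proof. by rewrite nrmZ nrm_natV mulrA mulfV ?mul1r // pnatr_eq0. Qed.

Lemma euler_bound n x : nrm x <= s -> nrm (euler n x) <= 2 * nrm x.
Proof. by move=> xs; have := @pw_bound ((n.+1%:R : C)^-1 *: x) n.+1; rewrite nrm_div; apply. Qed.

Lemma euler_linear n x : nrm x <= s -> nrm (euler n x - x) <= K * nrm x ^+ 2.
Proof.
move=> xs; have := @pw_linear ((n.+1%:R : C)^-1 *: x) n.+1; rewrite nrm_div.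
by rewrite scalerA mulfV ?pnatr_eq0 // scale1r; apply.
Qed.

Lemma hdiff_euler n x : nrm x < s -> hdiff (euler n) x.
Proof.
move=> xs; have := sr; have := s0 => ? ?.
have [d1 _] := hdiffZ ((n.+1%:R : C)^-1) x.
have xn : nrm ((n.+1%:R : C)^-1 *: x) <= s.
  have := nrm_div n x; rewrite -natr1 mulrDl mul1r.
  have : 0 <= n%:R * nrm ((n.+1%:R : C)^-1 *: x) by apply: mulr_ge0 => //; exact: nrm_ge0.
  lra.
have xr : nrm ((n.+1%:R : C)^-1 *: x) < r by lra.
have [d2 _] := mhol_comp d1 (mhol_kap xr).
have d3 := mhol_exp n.+1 d2.
have nx : n.+1%:R * nrm ((n.+1%:R : C)^-1 *: x) <= s by rewrite nrm_div ltW.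
have er : nrm (euler n x) < r by exact/r2/pw_small.
have dE : dom1 ((kap \o *:%R (n.+1%:R^-1)) x ^+ n.+1)%g.
  by rewrite /= -kap_pw //; exact: dom1_kap.
have d4 := mhol_ell d3 dE.
suff E : \forall y \near x, (ell \o (fun w => (kap \o *:%R (n.+1%:R^-1)) w ^+ n.+1)%g) y =
    euler n y by have [] := hdiff_near E d4.
apply/nbhs_nrmP; exists (s - nrm x); first by rewrite subr_gt0.
move=> y yx.
have ys : nrm y < s by have := nrmD (y - x) x; rewrite subrK; lra.
have ny : n.+1%:R * nrm ((n.+1%:R : C)^-1 *: y) <= s by rewrite nrm_div ltW.
rewrite /= -kap_pw // ell_kap //; exact/r2/pw_small.
Qed.

(** Splitting [kap (x / N)] into k + 1 equal factors moves it by O(1 / N^2),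
    and the N-th power multiplies errors by at most 4 N. *)
Lemma euler_refine n k x : nrm x <= s / 2 ->
  nrm (euler (n.+1 * k.+1).-1 x - euler n x) <= 4 * K * nrm x ^+ 2 / n.+1%:R.
Proof.
move=> xs; have := sr; have := s0 => ? ?; have x0 := nrm_ge0 x.
set N := (n.+1 * k.+1).-1.
have NE : N.+1 = (k.+1 * n.+1)%N by rewrite /N mulnC prednK // muln_gt0.
pose b := (N.+1%:R : C)^-1 *: x.
have Nb : N.+1%:R * nrm b = nrm x by exact: nrm_div.
have -> : euler N x = pw (pw b k.+1) n.+1.
  by rewrite /euler -/b NE pw_mul // -NE Nb.
have n0 : n.+1%:R != 0 :> C by rewrite pnatr_eq0.
have k0 : k.+1%:R != 0 :> C by rewrite pnatr_eq0.
have nb : k.+1%:R *: b = (n.+1%:R : C)^-1 *: x.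
  by rewrite /b NE natrM scalerA; congr (_ *: _);
    rewrite invfM mulrA mulfV // mul1r.
have nkb : n.+1%:R * (k.+1%:R * nrm b) = nrm x by rewrite mulrA -natrM mulnC -NE.
have b0 := nrm_ge0 b.
have n1 : 1 <= n.+1%:R :> R by rewrite ler1n.
have kb : k.+1%:R * nrm b <= s.
  have : 1 * (k.+1%:R * nrm b) <= n.+1%:R * (k.+1%:R * nrm b).
    by apply: ler_wpM2r => //; exact: mulr_ge0.
  lra.
have h1 : n.+1%:R * nrm (pw b k.+1) <= s.
  have : n.+1%:R * nrm (pw b k.+1) <= n.+1%:R * (2 * (k.+1%:R * nrm b)).
    by apply: ler_wpM2l => //; exact: pw_bound.
  lra.
have h2 : n.+1%:R * nrm ((n.+1%:R : C)^-1 *: x) <= s by rewrite nrm_div; lra.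
apply: le_trans (pw_lipschitz h2 h1) _.
rewrite -nb.
have := pw_linear kb.
have E : (k.+1%:R * nrm b) = nrm x / n.+1%:R.
  by rewrite -nkb mulrAC mulfV ?mul1r // pnatr_eq0.
move=> /(ler_wpM2l (ler0n R n.+1)) H.
have -> : 4 * K * nrm x ^+ 2 / n.+1%:R = 4 * (n.+1%:R * (K * (k.+1%:R * nrm b) ^+ 2)).
  by rewrite E; field; rewrite addrC natr1 pnatr_eq0.
by apply: ler_wpM2l.
Qed.

Context (U : set_system nat) (UU : UltraFilter U) (Uoo : \oo `<=` U).

Lemma ecoord_ex : exists e : V -> V, forall x, nrm x <= s -> euler ^~ x @ U --> e x.
Proof.
have H : forall x : V, exists l : V, nrm x <= s -> euler ^~ x @ U --> l.
  move=> x; have [xs|xs] := boolP (nrm x <= s); last by exists 0.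
  have [l _ hl] := @ultra_cvg_bounded R nat U UU m (euler^~ x) (2 * nrm x)
    (filterE _ (fun n => euler_bound n xs)).
  by exists l.
by have [e he] := choice H; exists e.
Qed.

End Exponential.

Section ExponentialCoordinate.
Context {R : realType} {m : nat} (G : complexLieGroup R m).
Local Notation C := R[i].
Local Notation V := 'rV[C]_m.
Local Notation kap := (@kap R m G).
Local Notation ell := (@ell R m G).
Local Notation dom1 := (@dom1 R m G).
Local Notation pw := (@pw R m G).
Context (r : R) (rP : coord_radius G r).
Context (s : R) (sP : pw_radius r s).
Local Notation K := (mlt_cst r).
Local Notation pw_lipschitz := (pw_lipschitz rP sP).
Local Notation pw_mul := (pw_mul rP sP).
Local Notation kap_pw := (kap_pw rP sP).
Local Notation ell_kap := (ell_kap rP).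
Local Notation dom1_kap := (dom1_kap rP).
Local Notation mhol_kap := (mhol_kap rP).
Local Notation r2 := (r2 rP).

Local Notation euler := (@euler R m G).

Let r0 : 0 < r. Proof. by case: rP. Qed.
Let s0 : 0 < s. Proof. by case: sP. Qed.
Let sr : 4 * s < r. Proof. by case: sP. Qed.

Context (U : set_system nat) (UU : UltraFilter U) (Uoo : \oo `<=` U).
Context (e : V -> V) (eP : forall x, nrm x <= s -> euler ^~ x @ U --> e x).

Lemma ecoord_bound x : nrm x <= s -> nrm (e x) <= 2 * nrm x.
Proof.
move=> xs; apply: (@cvg_nrm_le _ nat U _ V _ _ _ (eP xs)).
by apply: filterE => n; exact: (euler_bound rP sP).
Qed.

Lemma ecoord_linear x : nrm x <= s -> nrm (e x - x) <= K * nrm x ^+ 2.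
Proof.
move=> xs.
have H : (fun n => euler n x - x) @ U --> e x - x.
  by apply: (@cvgB C V nat U); [exact: eP|exact: cvg_cst].
apply: (@cvg_nrm_le _ nat U _ V _ _ _ H).
by apply: filterE => n; exact: (euler_linear rP sP).
Qed.

(** The approximations are holomorphic and uniformly bounded. *)
Lemma hdiff_ecoord x : nrm x < s -> hdiff e x.
Proof.
move=> xs; have sx : 0 < s - nrm x by rewrite subr_gt0.
have ys y : nrm (y - x) < s - nrm x -> nrm y < s.
  by move=> h; have := nrmD (y - x) x; rewrite subrK; lra.
apply: (@weierstrass R nat U UU V m (fun n => euler n) e x (s - nrm x) (2 * s) sx).
  apply: filterE => n y /ys h; split; first exact: (hdiff_euler rP sP).
  by apply: le_trans (euler_bound rP sP _ (ltW h)) _; lra.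
by move=> y /ys h; apply: eP; exact: ltW.
Qed.

Lemma natV_cvg (a : R) : forall d, 0 < d -> U [set n | a / n.+1%:R < d].
Proof.
move=> d d0; apply: Uoo.
pose N := Num.bound (`|a| / d).
have hN : `|a| / d < N%:R by apply: archi_boundP; apply: divr_ge0 => //; exact: ltW.
exists N => // n /= Nn; rewrite ltr_pdivrMr //.
rewrite ltr_pdivrMr // in hN; apply: le_lt_trans (ler_norm a) _.
apply: lt_le_trans hN _; rewrite mulrC; apply: ler_wpM2l; first exact: ltW.
by rewrite ler_nat; exact: leqW.
Qed.

(** By [euler_refine] the limit may be taken along the multiples n (k + 1),
    where [euler] is the (k + 1)-th power of the approximation at
    [x / (k + 1)]. *)
Lemma ecoord_pow x k : nrm x <= s / 2 -> e x = pw (e ((k.+1%:R : C)^-1 *: x)) k.+1.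
Proof.
move=> xs; have := s0 => ?.
have x0 := nrm_ge0 x.
set xk := (k.+1%:R : C)^-1 *: x.
have nk : k.+1%:R * nrm xk = nrm x by exact: nrm_div.
have k1 : 1 <= k.+1%:R :> R by rewrite ler1n.
have xk0 := nrm_ge0 xk.
have xks : nrm xk <= nrm x.
  by rewrite -nk -[leLHS]mul1r; apply: ler_wpM2r.
have h1 : (fun n => euler (n.+1 * k.+1).-1 x) @ U --> e x.
  apply/cvg_nrmP => d d0; have d2 : 0 < d / 2 by rewrite divr_gt0.
  have xs1 : nrm x <= s by lra.
  have /cvg_nrmP /(_ _ d2) H1 := eP xs1.
  suff : U [set n | nrm (euler (n.+1 * k.+1).-1 x - e x) < d] by [].
  apply: filterS2 H1 (natV_cvg (4 * K * nrm x ^+ 2) d2) => n.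
  move=> /= H1 H2; change (nrm (euler (n.+1 * k.+1).-1 x - e x) < d).
  have := nrm_tri (euler n x) (euler (n.+1 * k.+1).-1 x) (e x).
  have := euler_refine rP sP n k xs; move: H1 H2.
  by move: (euler n x) (euler _ x) (e x) (_ / n.+1%:R) => u v w c; lra.
have E n : euler (n.+1 * k.+1).-1 x = pw (euler n xk) k.+1.
  have NE : (n.+1 * k.+1).-1.+1 = (n.+1 * k.+1)%N by rewrite prednK // muln_gt0.
  rewrite /euler NE pw_mul; last by rewrite -NE nrm_div.
  by congr (pw (pw _ _) _); rewrite natrM invfM scalerA.
apply: (@cvg_unique _ (@norm_hausdorff _ _) _ _ _ _ h1).
apply/cvg_nrmP => d d0.
have dk : 0 < d / (4 * k.+1%:R) by rewrite divr_gt0 // mulr_gt0.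
have xs1 : nrm xk <= s by lra.
have /cvg_nrmP /(_ _ dk) H1 := eP xs1.
suff : U [set n | nrm (euler (n.+1 * k.+1).-1 x - pw (e xk) k.+1) < d] by [].
apply: filterS H1 => n /= H1; change (nrm (euler (n.+1 * k.+1).-1 x - pw (e xk) k.+1) < d).
rewrite E.
have small (y : V) : nrm y <= 2 * nrm xk -> k.+1%:R * nrm y <= s.
  move=> h; have : k.+1%:R * nrm y <= k.+1%:R * (2 * nrm xk) by apply: ler_wpM2l.
  lra.
have L := pw_lipschitz (small _ (ecoord_bound xs1)) (small _ (euler_bound rP sP n xs1)).
apply: le_lt_trans L _; rewrite ltr_pdivlMr ?mulr_gt0 // in H1.
by rewrite mulrA mulrC.
Qed.

Definition Exp (x : V) : G := kap (e x).

Lemma ecoord_small x : nrm x <= s -> nrm (e x) < r / 2.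
Proof. by move=> xs; have := ecoord_bound xs; have := sr; have := s0; lra. Qed.

Lemma ecoord0 : e 0 = 0.
Proof.
apply: nrm0_eq0; apply/eqP; rewrite eq_le nrm_ge0 andbT.
by have := @ecoord_bound 0; rewrite nrm0 mulr0; apply; exact: ltW.
Qed.

Lemma Exp0 : Exp 0 = 1%g.
Proof. by rewrite /Exp ecoord0 kap0. Qed.

Lemma dom1_Exp x : nrm x <= s -> dom1 (Exp x).
Proof. by move=> h; exact/dom1_kap/r2/ecoord_small. Qed.

Lemma ell_Exp x : nrm x <= s -> ell (Exp x) = e x.
Proof. by move=> h; exact/ell_kap/r2/ecoord_small. Qed.

Lemma mhol_Exp x : nrm x < s -> mhol Exp x.
Proof.
move=> xs; have xr := r2 (ecoord_small (ltW xs)).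
by have [d _] := mhol_comp (hdiff_ecoord xs) (mhol_kap xr).
Qed.

Lemma Exp_root x k : nrm x <= s / 2 -> Exp x = (Exp ((k.+1%:R : C)^-1 *: x) ^+ k.+1)%g.
Proof.
move=> xs; have := s0 => ?.
set xk := (k.+1%:R : C)^-1 *: x.
have nk : k.+1%:R * nrm xk = nrm x by exact: nrm_div.
have k1 : 1 <= k.+1%:R :> R by rewrite ler1n.
have xks : nrm xk <= nrm x.
  by rewrite -nk -[leLHS]mul1r; apply: ler_wpM2r => //; exact: nrm_ge0.
rewrite {1}/Exp (ecoord_pow k xs) kap_pw //.
have xs1 : nrm xk <= s by lra.
have := ler_wpM2l (ler0n R k.+1) (ecoord_bound xs1).
have := nrm_ge0 x; lra.
Qed.

(** Both sides are powers of [Exp (x / (k + 1))]. *)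
Lemma Exp_step x k : nrm ((1 + (k.+1%:R : C)^-1) *: x) <= s / 2 -> nrm x <= s / 2 ->
  Exp ((1 + (k.+1%:R : C)^-1) *: x) = (Exp x * Exp ((k.+1%:R : C)^-1 *: x))%g.
Proof.
move=> h1 h2; rewrite (Exp_root k.+1 h1) (Exp_root k h2).
have -> : (k.+2%:R : C)^-1 *: ((1 + (k.+1%:R)^-1) *: x) = (k.+1%:R)^-1 *: x.
  rewrite scalerA; congr (_ *: _).
  have k0 : k.+1%:R != 0 :> C by rewrite pnatr_eq0.
  have -> : 1 + (k.+1%:R)^-1 = k.+2%:R / k.+1%:R :> C.
    by rewrite -[k.+2]add1n natrD mulrDl mulfV // addrC mul1r addrC.
  by rewrite mulrA mulVf ?mul1r // pnatr_eq0.
by rewrite expgSr.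
Qed.

End ExponentialCoordinate.

(** * Curves with a given left-invariant velocity *)

(** Bisection on a segment, seen as the lower edge of a square. *)
Lemma seg_ind {R : realType} (P : R -> R -> Prop) :
  (forall a b, a < b -> P a ((a + b) / 2) -> P ((a + b) / 2) b -> P a b) ->
  (forall t, 0 <= t <= 1 -> exists2 del, 0 < del & forall a b,
     0 <= a -> a <= t <= b -> b <= 1 -> a < b -> b - a < del -> P a b) ->
  P 0 1.
Proof.
move=> Psplit Ploc.
have := @square_ind R (fun c L => 0 <= complex.Re c -> complex.Re c + L <= 1 ->
  P (complex.Re c) (complex.Re c + L)) 0 1 ltr01.
rewrite /= add0r => H; apply: H => //.
- move=> c L L0 h1 h2 _ _ c0 cL.
  have E : (complex.Re c + (complex.Re c + L)) / 2 = complex.Re c + L / 2 by field.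
  apply: Psplit; rewrite ?E; first lra.
    by apply: h1 => //; lra.
  have : P (complex.Re c + L / 2) (complex.Re c + L / 2 + L / 2).
    by move: h2; rewrite !ReImE /=; apply; lra.
  by rewrite -addrA -splitr.
- move=> z [/=]; rewrite add0r => /Ploc [del d0 hd] _; exists del => // c L /andP[L0 Ld].
  by move=> [/andP[z1 z2] _] c0 cL; apply: hd => //; rewrite ?z1 //; lra.
Qed.

Lemma hdiff_lipschitz {R : realType} (V W : normedModType R[i]) (f : V -> W) (x : V) :
  hdiff f x -> exists B : R, 0 < B /\ exists2 del : R, 0 < del &
    forall h, nrm h < del -> nrm (f (x + h) - f x) <= B * nrm h.
Proof.
move=> df; have [del d0 hd] := hdiff_estimate df ltr01.
have [e e0 he] : exists2 e : R, 0 < e & forall h, nrm h < e -> nrm (der f x h) < 1.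
  have dc : continuous ('d f x) by case: df => df; exact: diff_continuous.
  have /continuous_nrmP /(_ 1 ltr01) [e e0 he] := dc 0.
  by exists e => // h /he; rewrite add0r [X in _ - X]raddf0 subr0.
have L h : nrm (der f x h) <= 2 / e * nrm h.
  have [->|h0] := eqVneq h 0; first by rewrite der0 !nrm0 mulr0.
  have nh : 0 < nrm h by rewrite nrm_gt0.
  pose c := e / 2 / nrm h; have c0 : 0 < c by rewrite !divr_gt0.
  have nc : nrm (c%:C : R[i]) = c by rewrite nrmR ger0_norm // ltW.
  have : nrm (der f x (c%:C *: h)) < 1.
    by apply: he; rewrite nrmZ nc /c divfK ?gt_eqF //; lra.
  rewrite derZ nrmZ nc => /ltW; rewrite mulrC -ler_pdivlMr // mul1r => H.
  by apply: le_trans H _; rewrite /c !invf_div mulrC -mulrA mulrC -mulrA mulrC lexx.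
exists (2 / e + 1); split; first by have : 0 < 2 / e by [rewrite divr_gt0]; lra.
exists del => // h /hd H; have := L h.
have := nrmD (f (x + h) - f x - der f x h) (der f x h); rewrite subrK mul1r in H *.
lra.
Qed.

Section Generation.
Context {R : realType} {m : nat} (G : complexLieGroup R m).
Local Notation C := R[i].
Local Notation V := 'rV[C]_m.
Local Notation kap := (@kap R m G).
Local Notation ell := (@ell R m G).
Local Notation dom1 := (@dom1 R m G).
Local Notation mlt := (@mlt R m G).
Context (r : R) (rP : coord_radius G r).
Context (s : R) (sP : pw_radius r s).
Local Notation K := (mlt_cst r).
Local Notation mhol_kap := (mhol_kap rP).

Let r0 : 0 < r. Proof. by case: rP. Qed.
Let s0 : 0 < s. Proof. by case: sP. Qed.
Let sr : 4 * s < r. Proof. by case: sP. Qed.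
Let Ks : 4 * (K * s) <= 1. Proof. by case: sP. Qed.

(** The curve w has velocity xi at b after translation to the identity. As an
    estimate in the fixed coordinates [ell], this does not involve charts at
    the points of the curve. *)
Definition generates (w : C -> G) (b : C) (xi : V) := forall d : R, 0 < d ->
  exists2 del : R, 0 < del & forall h, nrm h < del ->
    dom1 ((w b)^-1 * w (b + h)%R)%g /\
    nrm (ell ((w b)^-1 * w (b + h)%R)%g - h *: xi) <= d * nrm h.

Lemma mhol_generates (w : C -> G) (b : C) (xi : V) : mhol (w : C^o -> G) (b : C^o) ->
  der (ell \o (fun t : C^o => (w b)^-1 * w t)%g) (b : C^o) (1 : C^o) = xi ->
  generates w b xi.
Proof.
move=> dw dE d d0.
have dF := mhol_mul (mhol_cst (w b)^-1%g (b : C^o)) dw.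
have d1 : dom1 ((w b)^-1 * w b)%g by rewrite mulVg; exact: dom1_1.
have [del1 d10 h1] := hdiff_estimate (mhol_ell dF d1) d0.
have /nbhs_nrmP [del2 d20 h2] := near_continuous dF.1 (chart_dom_near d1).
exists (Num.min del1 del2); first by rewrite lt_min d10.
move=> h; rewrite lt_min => /andP[/h1 H1 hd2]; split.
  by apply: h2; rewrite addrAC subrr add0r.
move: H1; rewrite /= mulVg ell1 subr0.
have -> : der (ell \o (fun t : C^o => ((w b)^-1 * w t)%g)) (b : C^o) h = h *: xi.
  by rewrite -dE -derZ [h *: _]mulr1.
by [].
Qed.

(** For fixed u2, [mlt v u2 = u1] is an equation for v whose left-hand side is
    a small perturbation of a translation. *)
Lemma perturb_left u1 u2 : nrm u1 <= s / 8 -> nrm u2 <= s / 8 ->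
  exists2 v, nrm v <= 2 * nrm (u1 - u2) & kap u1 = (kap v * kap u2)%g.
Proof.
move=> h1 h2; have := s0; have := sr; have := Ks => ? ? ?; have n2 := nrm_ge0 u2.
have u2r : nrm u2 < r / 2 by lra.
have d12 := nrmB u1 u2.
have K0 := mlt_cst_ge0 rP.
pose rho x := mlt x u2 - mlt 0 u2 - x.
have rho0 : rho 0 = 0 by rewrite /rho subrr subr0.
have rhoL x x' : nrm x <= s -> nrm x' <= s -> nrm (rho x' - rho x) <= nrm (x' - x) / 2.
  move=> xs xs'.
  have xr : nrm x < r / 2 by lra.
  have xr' : nrm x' < r / 2 by lra.
  have := mlt_lipl rP xr xr' u2r.
  have -> : mlt x' u2 - mlt x u2 - (x' - x) = rho x' - rho x.
    by rewrite /rho; move: (mlt x' u2) (mlt x u2) (mlt 0 u2) => p q o;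
       apply/rowP => j; rewrite !mxE; ring.
  move=> H; apply: le_trans H _; rewrite mulrAC mulrC; apply: ler_wpM2l; first exact: nrm_ge0.
  have : K * nrm u2 <= K * (s / 8) by apply: ler_wpM2l.
  lra.
have ys : nrm (u1 - u2) <= s / 2 by lra.
have [x xB xE] := perturb_id_surj s0 rho0 rhoL ys.
have xr : nrm x < r by lra.
have u2r' : nrm u2 < r by lra.
exists x => //; rewrite -(kap_mlt rP xr u2r'); congr kap.
move: xE; rewrite /rho (mlt0x rP u2r') addrC subrK.
by move/(canLR (subrK _)) => <-; rewrite subrK.
Qed.

Lemma perturb_right a b : nrm a <= s / 4 -> nrm b <= s / 4 ->
  exists2 v, nrm v <= 2 * nrm (b - a) & kap b = (kap a * kap v)%g.
Proof.
move=> h1 h2; have := s0; have := sr; have := Ks => ? ? ?; have n2 := nrm_ge0 a.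
have ar : nrm a < r / 2 by lra.
have d12 := nrmB b a.
have K0 := mlt_cst_ge0 rP.
pose rho x := mlt a x - mlt a 0 - x.
have rho0 : rho 0 = 0 by rewrite /rho subrr subr0.
have rhoL x x' : nrm x <= s -> nrm x' <= s -> nrm (rho x' - rho x) <= nrm (x' - x) / 2.
  move=> xs xs'.
  have xr : nrm x < r / 2 by lra.
  have xr' : nrm x' < r / 2 by lra.
  have := mlt_lipr rP ar xr xr'.
  have -> : mlt a x' - mlt a x - (x' - x) = rho x' - rho x.
    by rewrite /rho; move: (mlt a x') (mlt a x) (mlt a 0) => p q o;
       apply/rowP => j; rewrite !mxE; ring.
  move=> H; apply: le_trans H _; rewrite mulrC; apply: ler_wpM2l; first exact: nrm_ge0.
  have : K * nrm a <= K * (s / 4) by apply: ler_wpM2l.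
  lra.
have ys : nrm (b - a) <= s / 2 by lra.
have [x xB xE] := perturb_id_surj s0 rho0 rhoL ys.
have xr : nrm x < r by lra.
have ar' : nrm a < r by lra.
exists x => //; rewrite -(kap_mlt rP ar' xr); congr kap.
move: xE; rewrite /rho (mltx0 rP ar') addrC subrK.
by move/(canLR (subrK _)) => <-; rewrite subrK.
Qed.

Lemma generates_small (w : C -> G) (b : C) (xi : V) (c : R) : 0 < c ->
  generates w b xi -> exists2 del : R, 0 < del & forall h, nrm h < del ->
    nrm (ell ((w b)^-1 * w (b + h)%R)%g) <= c.
Proof.
move=> c0 /(_ _ ltr01) [del d0 hd].
have x1 : 0 < nrm xi + 1 by have := nrm_ge0 xi; lra.
exists (Num.min del (c / (nrm xi + 1))); first by rewrite lt_min d0 divr_gt0.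
move=> h; rewrite lt_min ltr_pdivlMr // => /andP[/hd [_ H] hc].
have := nrmD (ell ((w b)^-1 * w (b + h)%R)%g - h *: xi) (h *: xi).
by rewrite subrK nrmZ; lra.
Qed.

Definition quot (w1 w2 : C -> G) (t : C) : G := (w1 t * (w2 t)^-1)%g.

(** In coordinates the increments of the two curves at b agree up to o(h), so
    that they differ by a factor [kap] of o(h) according to [perturb_left]. *)
Lemma quot_step (w1 w2 : C -> G) (b : C) (xi : V) :
  generates w1 b xi -> generates w2 b xi -> forall d : R, 0 < d ->
  exists2 del : R, 0 < del & forall h, nrm h < del -> exists2 v, nrm v <= d * nrm h &
    quot w1 w2 (b + h) = (w1 b * kap v * (w2 b)^-1)%g.
Proof.
move=> g1 g2 d d0.
have d4 : 0 < d / 4 by rewrite divr_gt0.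
have s8 : 0 < s / 8 by rewrite divr_gt0.
have [e1 e10 h1] := g1 _ d4; have [e2 e20 h2] := g2 _ d4.
have [e3 e30 h3] := generates_small s8 g1; have [e4 e40 h4] := generates_small s8 g2.
exists (Num.min (Num.min e1 e2) (Num.min e3 e4)); first by rewrite !lt_min e10 e20 e30.
move=> h; rewrite !lt_min => /andP[/andP[/h1 [D1 H1] /h2 [D2 H2]] /andP[/h3 H3 /h4 H4]].
have [v vB vE] := perturb_left H3 H4.
rewrite !kap_ell // in vE.
exists v.
  apply: le_trans vB _.
  have := nrm_tri (h *: xi) (ell ((w1 b)^-1 * w1 (b + h)%R)%g) (ell ((w2 b)^-1 * w2 (b + h)%R)%g).
  rewrite (nrmBC (h *: xi)); lra.
rewrite /quot; have -> : w1 (b + h)%R = (w1 b * ((w1 b)^-1 * w1 (b + h)%R))%g by rewrite mulVKg.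
rewrite vE; rewrite -!mulgA; congr (_ * (_ * _))%g.
by rewrite mulgV mulg1.
Qed.

(** In a chart the quotient of two curves with the same velocity has derivative
    0 at every point near b. *)
Lemma quot_locally_constant (w1 w2 : C -> G) (b : C) (xi : V) (eta : R) : 0 < eta ->
  (forall t, nrm (t - b) < eta -> generates w1 t xi /\ generates w2 t xi) ->
  exists2 del : R, 0 < del & forall t, nrm (t - b) < del ->
    quot w1 w2 t = quot w1 w2 b.
Proof.
move=> eta0 gen.
have bb : nrm (b - b) < eta by rewrite subrr nrm0.
pose g0 := quot w1 w2 b; pose a := chart_at g0.
have tr_hol t : mhol (fun v : V => (w1 t * kap v * (w2 t)^-1)%g) 0.
  have r0' : nrm (0 : V) < r by rewrite nrm0.
  exact: mhol_mul (mhol_mul (mhol_cst _ _) (mhol_kap r0')) (mhol_cst _ _).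
have tr0 t : (w1 t * kap 0 * (w2 t)^-1)%g = quot w1 w2 t by rewrite kap0 mulg1.
have [g1 g2] := gen b bb.
have [e1 e10 h1] := quot_step g1 g2 ltr01.
have a_near : \forall g \near (w1 b * kap 0 * (w2 b)^-1)%g, chart_dom a g.
  by rewrite tr0; exact/chart_dom_near/mem_chart_at.
have /nbhs_nrmP [e2 e20 h2] := near_continuous (tr_hol b).1 a_near.
exists (Num.min eta (Num.min e1 e2)); first by rewrite !lt_min eta0 e10.
move=> t; rewrite !lt_min => /and3P[t1 t2 t3].
have dom_a z : nrm (z - b) < eta -> nrm (z - b) < e1 -> nrm (z - b) < e2 ->
    chart_dom a (quot w1 w2 z).
  move=> _ z1 z2; have [v vB] := h1 _ z1; rewrite addrC subrK => ->.
  by apply: h2; rewrite subr0; lra.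
pose y z := a (quot w1 w2 z).
have dy z : nrm (z - b) < eta -> nrm (z - b) < e1 -> nrm (z - b) < e2 ->
    forall d : R, 0 < d -> exists2 del : R, 0 < del &
      forall h, nrm h < del -> nrm (y (z + h) - y z) <= d * nrm h.
  move=> z0 z1 z2 d d0.
  have Dz := dom_a z z0 z1 z2; rewrite -tr0 in Dz.
  have [B [B0 [e3 e30 h3]]] := hdiff_lipschitz (mhol_chart (tr_hol z) (atlas_chart_at g0) Dz).
  have [k1 k2] := gen z z0.
  have [e4 e40 h4] := quot_step k1 k2 (divr_gt0 d0 B0).
  exists (Num.min e4 (e3 / (d / B))); first by rewrite lt_min e40 !divr_gt0.
  move=> h; rewrite lt_min => /andP[/h4 [v vB E] hh].
  rewrite /y E -(tr0 z).
  have ve3 : nrm v < e3.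
    by apply: le_lt_trans vB _; rewrite mulrC -ltr_pdivlMr // divr_gt0.
  have := h3 v ve3; rewrite /= add0r => H.
  apply: le_trans H _; apply: le_trans (ler_wpM2l (ltW B0) vB) _.
  by rewrite mulrA mulrCA mulfV ?mulr1 // gt_eqF.
have yE : y t = y b.
  apply/eqP; rewrite -subr_eq0; apply/eqP/nrm0_eq0/eqP; rewrite eq_le nrm_ge0 andbT.
  apply/ler_addgt0Pr => d d0; rewrite add0r.
  pose v := t - b.
  pose c (x : R) := b + x%:C * v.
  have cB x : 0 <= x <= 1 -> nrm (c x - b) <= nrm v.
    move=> /andP[x0 x1]; rewrite /c addrAC subrr add0r nrmM nrmR ger0_norm //.
    by rewrite -[leRHS]mul1r; apply: ler_wpM2r => //; exact: nrm_ge0.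
  have : nrm (y (c 1) - y (c 0)) <= d * (1 - 0).
    have v1 : 0 < nrm v + 1 by have := nrm_ge0 v; lra.
    apply: (@seg_ind R (fun p q => nrm (y (c q) - y (c p)) <= d * (q - p))).
      move=> p q pq H1 H2; apply: le_trans (nrm_tri (y (c ((p + q) / 2))) _ _) _.
      by rewrite /GRing.one in H1 H2 *; lra.
    move=> x x01; have xB := cB x x01.
    have dv : 0 < d / (nrm v + 1) by rewrite divr_gt0.
    have [del d1 hd] :=
      dy (c x) (le_lt_trans xB t1) (le_lt_trans xB t2) (le_lt_trans xB t3) _ dv.
    exists (del / (nrm v + 1)); first by rewrite divr_gt0.
    move=> p q p0 /andP[px xq] q1 pq; rewrite ltr_pdivlMr // => qp.
    have step x' : `|x' - x| <= q - p -> nrm (y (c x') - y (c x)) <= d * `|x' - x|.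
      move=> hx'.
      have cE : c x' = c x + (x' - x)%:C * v by rewrite /c rmorphB /=; ring.
      have nE : nrm ((x' - x)%:C * v) <= `|x' - x| * (nrm v + 1).
        by rewrite nrmM nrmR; apply: ler_wpM2l => //; lra.
      rewrite cE; have H : nrm ((x' - x)%:C * v) < del.
        apply: le_lt_trans nE _; apply: le_lt_trans qp; apply: ler_wpM2r => //; exact: ltW.
      apply: le_trans (hd _ H) _.
      apply: (@le_trans _ _ (d / (nrm v + 1) * (`|x' - x| * (nrm v + 1)))).
        by apply: ler_wpM2l => //; rewrite divr_ge0 // ltW.
      by rewrite mulrCA divfK ?gt_eqF // mulrC.
    have Nq : `|q - x| = q - x by rewrite ger0_norm //; lra.
    have Np : `|p - x| = x - p by rewrite ler0_norm ?opprB //; lra.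
    have Hq := step q; have Hp := step p; rewrite Nq in Hq; rewrite Np nrmBC in Hp.
    have {}Hq : nrm (y (c q) - y (c x)) <= d * (q - x) by apply: Hq; lra.
    have {}Hp : nrm (y (c x) - y (c p)) <= d * (x - p) by apply: Hp; lra.
    by apply: le_trans (nrm_tri (y (c x)) _ _) _; lra.
  rewrite subr0 mulr1 /c rmorph1 mul1r rmorph0 mul0r addr0.
  by rewrite [b + v]addrC /v subrK.
have Dt := dom_a t t1 t2 t3.
have Db : chart_dom a (quot w1 w2 b) by exact: mem_chart_at.
by rewrite -(chart_invK Dt) -/(y t) yE /y chart_invK.
Qed.

(** Curves with the same left-invariant velocity differ by a left translation:
    this is what makes integral curves unique. *)
Lemma quot_constant (w1 w2 : C -> G) (b : C) (xi : V) :
  (forall x : R, 0 <= x <= 1 -> exists2 eta : R, 0 < eta &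
     forall t, nrm (t - x%:C * b) < eta -> generates w1 t xi /\ generates w2 t xi) ->
  quot w1 w2 b = quot w1 w2 0.
Proof.
move=> gen; have b1 : 0 < nrm b + 1 by have := nrm_ge0 b; lra.
have := @seg_ind R (fun p q => quot w1 w2 (q%:C * b) = quot w1 w2 (p%:C * b)).
rewrite rmorph1 rmorph0 mul1r mul0r; apply.
  by move=> p q pq h1 h2; rewrite h2 h1.
move=> x /gen [eta eta0 h].
have [del d0 hd] := quot_locally_constant eta0 h.
exists (del / (nrm b + 1)); first by rewrite divr_gt0.
move=> p q p0 /andP[px xq] q1 pq; rewrite ltr_pdivlMr // => qp.
have step x' : `|x' - x| <= q - p -> nrm (x'%:C * b - x%:C * b) < del.
  move=> hx'; rewrite -mulrBl -rmorphB /= nrmM nrmR.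
  apply: le_lt_trans qp; apply: ler_pM => //; first exact: nrm_ge0.
  by lra.
rewrite (hd _ (step q _)) ?(hd _ (step p _)) //; rewrite ler_norml; lra.
Qed.

End Generation.

(** * One-parameter subgroups *)

Section OneParameter.
Context {R : realType} {m : nat} (G : complexLieGroup R m).
Local Notation C := R[i].
Local Notation V := 'rV[C]_m.
Local Notation ell := (@ell R m G).
Context (r : R) (rP : coord_radius G r).
Context (s : R) (sP : pw_radius r s).
Local Notation K := (mlt_cst r).

Local Notation euler := (@euler R m G).

Let s0 : 0 < s. Proof. by case: sP. Qed.

Context (U : set_system nat) (UU : UltraFilter U) (Uoo : \oo `<=` U).
Context (e : V -> V) (eP : forall x, nrm x <= s -> euler ^~ x @ U --> e x).

Local Notation Exp := (@Exp R m G e).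

Local Notation generates := (@generates R m G).

(** The velocity depends only on the increments of the curve, and scales with
    the parameter. *)
Lemma generates_ext (w w' : C -> G) (b b' c : C) (x : V) (eta : R) : c != 0 -> 0 < eta ->
  (forall h, nrm h < eta -> ((w b)^-1 * w (b + h)%R)%g = ((w' b')^-1 * w' (b' + c * h)%R)%g) ->
  generates w' b' x -> generates w b (c *: x).
Proof.
move=> c0 eta0 wE gw' d d0; have nc : 0 < nrm c by rewrite nrm_gt0.
have [del d1 hd] := gw' _ (divr_gt0 d0 nc).
exists (Num.min eta (del / nrm c)); first by rewrite lt_min eta0 divr_gt0.
move=> h; rewrite lt_min ltr_pdivlMr // => /andP[h1 h2].
have hc : nrm (c * h) < del by rewrite nrmM mulrC.
have [H1 H2] := hd _ hc; rewrite wE //; split => //.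
rewrite scalerA [h * c]mulrC; apply: le_trans H2 _.
by rewrite nrmM mulrA divfK ?gt_eqF.
Qed.

Lemma generates_Exp0 xi : generates (fun t => Exp (t *: xi)) 0 xi.
Proof.
move=> d d0; have := s0 => ?; have K0 := mlt_cst_ge0 rP.
have x0 := nrm_ge0 xi.
have x1 : 0 < nrm xi + 1 by lra.
have k1 : 0 < K * nrm xi ^+ 2 + 1.
  by have : 0 <= K * nrm xi ^+ 2 by [apply: mulr_ge0 => //; exact: exprn_ge0]; lra.
exists (Num.min (s / (nrm xi + 1)) (d / (K * nrm xi ^+ 2 + 1))).
  by rewrite lt_min !divr_gt0.
move=> h; rewrite lt_min !ltr_pdivlMr // => /andP[h1 h2].
have hs : nrm (h *: xi) <= s by rewrite nrmZ; have := nrm_ge0 h; lra.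
rewrite scale0r (Exp0 rP sP UU eP) invg1 mul1g add0r; split.
  exact: (dom1_Exp rP sP UU eP).
rewrite (ell_Exp rP sP UU eP) //; apply: le_trans (ecoord_linear rP sP UU eP hs) _.
rewrite nrmZ exprMn mulrCA expr2 -mulrA mulrCA [d * _]mulrC; apply: ler_wpM2l; first exact: nrm_ge0.
by have := nrm_ge0 h; lra.
Qed.

(** The derivative of [Exp ((1 + h) x)] at h = 0 is found along h = 1 / k, where
    [Exp (x + x / k) = Exp x * Exp (x / k)]. *)
Lemma generates_Exp xi t : nrm (t *: xi) < s / 2 ->
  generates (fun t => Exp (t *: xi)) t xi.
Proof.
move=> ts; have := s0 => ?.
have [->|t0] := eqVneq t 0; first exact: generates_Exp0.
set x := t *: xi in ts.
have nx := nrm_ge0 x.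
suff g : generates (fun h => Exp (x + h *: x)) 0 x.
  have -> : xi = t^-1 *: x by rewrite /x scalerA mulVf // scale1r.
  apply: (@generates_ext _ _ t 0 t^-1 x 1 _ ltr01 _ g); first by rewrite invr_eq0.
  move=> h _; rewrite scale0r addr0 add0r; congr (_^-1 * Exp _)%g.
    by rewrite scalerA mulfV // scale1r.
  by rewrite scalerA mulrDl mulfV // scalerDl scale1r [h / t]mulrC.
have x0s : nrm (x + 0 *: x) < s by rewrite scale0r addr0; lra.
have [lh _] := hdiff_line x x 0.
have [d1 _] := mhol_comp lh (mhol_Exp rP sP UU eP x0s).
apply: mhol_generates (d1) _.
set F := ell \o _; set A := der F (0 : C^o) (1 : C^o).
have F0 : F 0 = 0 by rewrite /F /= mulVg ell1.
have dF : hdiff F (0 : C^o).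
  apply: mhol_ell; first exact: mhol_mul (mhol_cst _ _) d1.
  by rewrite mulVg; exact: dom1_1.
have Fk k : (1 + k.+1%:R^-1) * nrm x <= s / 2 -> F (k.+1%:R^-1 : C) = e (k.+1%:R^-1 *: x).
  move=> hk.
  have E : x + (k.+1%:R^-1 : C) *: x = (1 + k.+1%:R^-1) *: x by rewrite scalerDl scale1r.
  have n1 : nrm ((1 + k.+1%:R^-1 : C) *: x) <= s / 2.
    rewrite nrmZ; apply: le_trans hk; apply: ler_wpM2r => //.
    by apply: le_trans (nrmD _ _) _; rewrite nrm1 nrm_natV.
  rewrite /F /= scale0r addr0 E (Exp_step rP sP UU Uoo eP n1) ?(ltW ts) // mulKg.
  rewrite (ell_Exp rP sP UU eP) //.
  have : nrm ((k.+1%:R^-1 : C) *: x) <= nrm x.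
    rewrite nrmZ nrm_natV -[leRHS]mul1r; apply: ler_wpM2r => //.
    by rewrite invf_le1 // ler1n.
  lra.
suff : nrm (x - A) = 0 by move/nrm0_eq0/eqP; rewrite subr_eq0 => /eqP.
apply/eqP; rewrite eq_le nrm_ge0 andbT; apply/ler_addgt0Pr => d d0; rewrite add0r.
have d2 : 0 < d / 2 by rewrite divr_gt0.
have [del de hd] := hdiff_estimate dF d2.
have gap : 0 < s / 2 - nrm x by rewrite subr_gt0.
have [k [k1 k2 k3]] : exists k : nat, [/\ 1 / k.+1%:R < del,
    nrm x / k.+1%:R < s / 2 - nrm x & K * nrm x ^+ 2 / k.+1%:R < d / 2].
  have H : U ([set k | 1 / k.+1%:R < del] `&` ([set k | nrm x / k.+1%:R < s / 2 - nrm x] `&`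
      [set k | K * nrm x ^+ 2 / k.+1%:R < d / 2])).
    by apply: filterI; [|apply: filterI]; exact: natV_cvg.
  by have [k [? [? ?]]] := filter_ex H; exists k.
have kx : (1 + k.+1%:R^-1) * nrm x <= s / 2.
  by move: k2; move: (k.+1%:R^-1 : R) => i; lra.
have := Fk k kx; have : nrm (k.+1%:R^-1 : C) = k.+1%:R^-1 by exact: nrm_natV.
have : 0 < k.+1%:R^-1 :> R by rewrite invr_gt0.
move: k1 k2 k3; move: (k.+1%:R^-1 : R) (k.+1%:R^-1 : C) => i j k1 k2 k3 i0 nj Fj {kx}.
have kV : nrm j < del by rewrite nj -(mul1r i).
have := hd _ kV; rewrite add0r F0 subr0 Fj nj.
have -> : der F (0 : C^o) (j : C^o) = j *: A.
  by rewrite -derZ [_ *: (1 : C^o)]mulr1.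
have xk : nrm (j *: x) <= s by rewrite nrmZ nj; lra.
have := ecoord_linear rP sP UU eP xk.
rewrite nrmZ nj => H1 H2.
have H3 : nrm (j *: (x - A)) <= i * d.
  rewrite scalerBr; apply: le_trans (nrm_tri (e (j *: x)) _ _) _.
  rewrite nrmBC.
  have E : K * (i * nrm x) ^+ 2 = i * (K * nrm x ^+ 2 * i) by ring.
  have : i * (K * nrm x ^+ 2 * i) <= i * (d / 2) by apply: ler_wpM2l; exact: ltW.
  rewrite E in H1.
  have : i * d = i * (d / 2) + i * (d / 2) by field.
  lra.
by rewrite nrmZ nj ler_pM2l in H3.
Qed.

(** Both sides, as functions of b, are curves with velocity xi. *)
Lemma Exp_add xi a b : nrm (a *: xi) + nrm (b *: xi) < s / 2 ->
  Exp ((a + b) *: xi) = (Exp (a *: xi) * Exp (b *: xi))%g.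
Proof.
move=> h.
have nb := nrm_ge0 (b *: xi); have na := nrm_ge0 (a *: xi).
pose gap := s / 2 - (nrm (a *: xi) + nrm (b *: xi)).
have gap0 : 0 < gap by rewrite subr_gt0.
have x0 := nrm_ge0 xi.
have x1 : 0 < nrm xi + 1 by lra.
have := @quot_constant R m G r rP s sP (fun t => Exp ((a + t) *: xi))
  (fun t => Exp (t *: xi)) b xi.
rewrite /quot addr0 scale0r (Exp0 rP sP UU eP) invg1 mulg1 => H.
rewrite -H ?mulgVK // => x /andP[x01 x11].
exists (gap / (nrm xi + 1)); first by rewrite divr_gt0.
move=> t; rewrite ltr_pdivlMr // => tx.
have tb : nrm (t *: xi) < s / 2 - nrm (a *: xi).
  have -> : t *: xi = (t - x%:C * b) *: xi + x%:C *: (b *: xi).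
    by rewrite scalerA -scalerDl subrK.
  apply: le_lt_trans (nrmD _ _) _; rewrite [nrm (x%:C *: _)]nrmZ nrmR ger0_norm //.
  have : x * nrm (b *: xi) <= 1 * nrm (b *: xi) by apply: ler_wpM2r.
  rewrite [nrm ((t - _) *: _)]nrmZ; have := nrm_ge0 (t - x%:C * b).
  move: tx; rewrite /gap {H}; move: (nrm (t - _)) (nrm xi) (nrm (a *: xi)) (nrm (b *: xi)).
  by move=> *; lra.
split; last by apply: generates_Exp; apply: lt_le_trans tb _; rewrite gerBl.
have ab : nrm ((a + t) *: xi) < s / 2.
  by rewrite scalerDl; apply: le_lt_trans (nrmD _ _) _; rewrite addrC -ltrBrDr.
have g := generates_Exp ab.
rewrite -[xi](scale1r); apply: (@generates_ext _ _ t (a + t) 1 xi 1 _ ltr01 _ g).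
  exact: oner_neq0.
by move=> h' _; rewrite scale1r mul1r addrA.
Qed.

End OneParameter.

Section ExponentialMap.
Context {R : realType} {m : nat} (G : complexLieGroup R m).
Local Notation C := R[i].
Local Notation V := 'rV[C]_m.
Context (r : R) (rP : coord_radius G r).
Context (s : R) (sP : pw_radius r s).
Local Notation K := (mlt_cst r).

Local Notation euler := (@euler R m G).

Let s0 : 0 < s. Proof. by case: sP. Qed.

Context (U : set_system nat) (UU : UltraFilter U) (Uoo : \oo `<=` U).
Context (e : V -> V) (eP : forall x, nrm x <= s -> euler ^~ x @ U --> e x).

Local Notation Exp := (@Exp R m G e).

Local Notation generates := (@generates R m G).

Local Notation Exp_add := (Exp_add rP sP UU Uoo eP).

Lemma der_subr (W : normedModType C) (f : W -> V) (a : V) (x : W) :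
  hdiff f x -> der (fun y => f y - a) x = der f x.
Proof.
move=> df.
have H h : f (x + h) - a - (f x - a) = f (x + h) - f x by rewrite opprB addrA subrK.
by have [_ E] := @hdiff_same_der R W V f (fun y => f y - a) x df H.
Qed.

(** [Exp] is defined on a ball; powers of a small argument extend it to the Lie
    algebra. *)
Definition GExp (y : V) : G :=
  let k := Num.bound (nrm y / (s / 2)) in (Exp ((k.+1%:R : C)^-1 *: y) ^+ k.+1)%g.

Lemma GExpE y k : nrm y <= k.+1%:R * (s / 2) ->
  GExp y = (Exp ((k.+1%:R : C)^-1 *: y) ^+ k.+1)%g.
Proof.
have s2 : 0 < s / 2 by rewrite divr_gt0.
have root k' l : nrm y <= k'.+1%:R * (s / 2) -> (Exp ((k'.+1%:R : C)^-1 *: y) ^+ k'.+1)%g =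
   (Exp ((k'.+1%:R * l.+1%:R : C)^-1 *: y) ^+ (k'.+1 * l.+1))%g.
  move=> h; rewrite (Exp_root rP sP UU Uoo eP l).
    by rewrite -expgnA mulnC scalerA -invfM mulrC.
  by rewrite nrmZ nrm_natV mulrC ler_pdivrMr // mulrC.
move=> hk; rewrite /GExp; set k0 := Num.bound _.
have hk0 : nrm y <= k0.+1%:R * (s / 2).
  rewrite -ler_pdivrMr //; apply/ltW.
  have : nrm y / (s / 2) < k0%:R.
    by apply: archi_boundP; apply: divr_ge0; [exact: nrm_ge0|exact: ltW].
  by move/lt_trans; apply; rewrite ltr_nat.
by rewrite (root _ k hk0) (root _ k0 hk) [in RHS]mulrC mulnC.
Qed.

Lemma GExp_small y : nrm y <= s / 2 -> GExp y = Exp y.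
Proof. by move=> ys; rewrite (@GExpE y 0) ?mul1r // invr1 scale1r expg1. Qed.

Lemma GExp0 : GExp 0 = 1%g.
Proof.
by rewrite GExp_small ?(Exp0 rP sP UU eP) // nrm0 divr_ge0 // ltW.
Qed.

Lemma GExp_near xi t : exists2 del : R, 0 < del & forall h, nrm h < del ->
  GExp ((t + h) *: xi) = (GExp (t *: xi) * Exp (h *: xi))%g.
Proof.
have s8 : 0 < s / 8 by rewrite divr_gt0.
have s82 : s / 8 <= s / 2 by have := s0; lra.
have s84 : s / 8 + s / 8 < s / 2 by have := s0; lra.
have x0 := nrm_ge0 xi; have x1 : 0 < nrm xi + 1 by lra.
pose k := Num.bound (nrm (t *: xi) / (s / 8)).
have tk : nrm (t *: xi) <= k.+1%:R * (s / 8).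
  rewrite -ler_pdivrMr //; apply/ltW.
  have : nrm (t *: xi) / (s / 8) < k%:R.
    by apply: archi_boundP; apply: divr_ge0; [exact: nrm_ge0|exact: ltW].
  by move/lt_trans; apply; rewrite ltr_nat.
have k1 : 1 <= k.+1%:R :> R by rewrite ler1n.
move: (k) tk k1 => {}k tk k1.
exists (s / 8 / (nrm xi + 1)); first by rewrite divr_gt0.
move=> h; rewrite ltr_pdivlMr // => hs.
have hx : nrm (h *: xi) < s / 8.
  rewrite nrmZ; apply: le_lt_trans hs; apply: ler_wpM2l; first exact: nrm_ge0.
  by rewrite lerDl.
pose xk := (k.+1%:R : C)^-1 *: xi.
have sk8 : s / 8 <= k.+1%:R * (s / 8) by rewrite -[leLHS]mul1r; apply: ler_wpM2r => //; exact: ltW.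
have sk2 : k.+1%:R * (s / 8) <= k.+1%:R * (s / 2) by apply: ler_wpM2l.
have shrink (c : C) : nrm (c *: xi) <= k.+1%:R * (s / 8) -> nrm (c *: xk) <= s / 8.
  move=> hc; rewrite /xk scalerA [c * _]mulrC -scalerA nrmZ nrm_natV mulrC.
  by rewrite ler_pdivrMr ?ltr0n // mulrC.
have t1 := shrink _ tk.
have hk8 : nrm (h *: xi) <= k.+1%:R * (s / 8) := le_trans (ltW hx) sk8.
have h1 := shrink _ hk8.
have hk := le_trans hk8 sk2; have tk2 := le_trans tk sk2.
have thk : nrm ((t + h) *: xi) <= k.+1%:R * (s / 2).
  rewrite scalerDl; apply: le_trans (nrmD _ _) _; apply: le_trans (lerD tk hk8) _.
  by rewrite -mulrDr; apply: ler_wpM2l => //; exact: ltW.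
have hx2 := le_trans (ltW hx) s82.
have th4 := le_lt_trans (lerD t1 h1) s84.
rewrite (GExpE thk) (GExpE tk2) -(GExp_small hx2) (GExpE hk).
have E (c : C) : (k.+1%:R : C)^-1 *: (c *: xi) = c *: xk by rewrite /xk !scalerA mulrC.
rewrite !E (Exp_add th4) expgMn // /commute -(Exp_add th4) addrC Exp_add //.
by rewrite addrC.
Qed.

Lemma generates_GExp xi t : generates (fun t => GExp (t *: xi)) t xi.
Proof.
have [del d0 hd] := GExp_near xi t.
have g := @generates_Exp0 R m G r rP s sP U UU e eP xi.
rewrite -[xi](scale1r); apply: (@generates_ext R m G _ _ t 0 1 xi del _ d0 _ g).
  exact: oner_neq0.
move=> h /hd; rewrite scale1r => ->; rewrite mulKg mul1r add0r scale0r.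
by rewrite (Exp0 rP sP UU eP) invg1 mul1g.
Qed.

Lemma mder_Exp0 : mder Exp 0 = id.
Proof.
have nz : nrm (0 : V) < s by rewrite nrm0.
have E0 := Exp0 rP sP UU eP.
rewrite /mder E0.
have [|||_ dE] := @estimate_hdiff R V V (chart_at (1%g : G) \o Exp) 0 id 1; last exact: dE.
- by [].
- by move=> h; rewrite mul1r.
move=> d d0; have K0 := mlt_cst_ge0 rP.
exists (Num.min s (d / (K + 1))); first by rewrite lt_min s0 divr_gt0 //; lra.
move=> h; rewrite lt_min ltr_pdivlMr; last by lra.
move=> /andP[hs hk]; have := ecoord_linear rP sP UU eP (ltW hs).
rewrite -(ell_Exp rP sP UU eP (ltW hs)) /= add0r E0 => H.
apply: le_trans H _; rewrite expr2 mulrA; apply: ler_wpM2r; first exact: nrm_ge0.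
by have := nrm_ge0 h; lra.
Qed.

(** The left-invariant field generated by a vector at p that comes from v at the
    identity is the one generated by v. *)
Lemma lif_dL (p h : G) (v : V) :
  @left_invariant_field R m G p (dL p 1%g v) h = @mdiff R m m G G (Ltrans h) 1%g v :> V.
Proof.
rewrite /left_invariant_field /dL.
have E : Ltrans h = Ltrans (h * p^-1)%g \o Ltrans p.
  by apply/funext => x; rewrite /Ltrans /= -mulgA mulKg.
have H := @mdiff_comp R m m m G G G (Ltrans p) (Ltrans (h * p^-1)%g) 1%g
  (hol_Ltrans _ _) (hol_Ltrans _ _).
rewrite E H /=.
have -> : Ltrans p 1%g = p by rewrite /Ltrans mulg1.
by [].
Qed.

(** Near t the curve is [c t * Exp ((t' - t) v)], and [Exp] has derivative
    [id] at 0. *)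
Lemma integral_curve_GExp (p : G) (v : V) :
  @integral_curve R m G p (dL p 1%g v) (fun t => (p * GExp (t *: v))%g).
Proof.
pose c (t : C^o) : G := (p * GExp (t *: v))%g.
have cE (t : C^o) : \forall t' \near t,
    (Ltrans (c t) \o (Exp \o (fun t' : C^o => (- t *: v) + t' *: v))) t' = c t'.
  have [del d0 hd] := GExp_near v t.
  apply/nbhs_nrmP; exists del => // t' /hd H.
  have tt : t + (t' - t) = t' by rewrite addrC subrK.
  rewrite /= /Ltrans /c -[in RHS]tt H -mulgA; congr (_ * (_ * Exp _))%g.
  by rewrite scalerBl scaleNr addrC.
have z0 (t : C^o) : - t *: v + t *: v = 0 by rewrite scaleNr addNr.
have hol t : mhol c t /\ mder c t (1 : C^o) = @mdiff R m m G G (Ltrans (c t)) 1%g v.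
  have [l1 l2] := hdiff_line (- t *: v) v t.
  have nz : nrm (- t *: v + t *: v) < s by rewrite z0 nrm0.
  have [d1 d2] := mhol_comp l1 (mhol_Exp rP sP UU eP nz).
  have [d3 d4] := mhol_hol d1 (hol_Ltrans (c t) _).
  have [d5 d6] := mhol_near (cE t) d3.
  split; first exact: d5.
  rewrite d6 d4 d2 l2 /= z0 mder_Exp0 scale1r.
  by rewrite (Exp0 rP sP UU eP).
split.
- by apply/(@holomorphic_fromE R C^o m G c) => t; exact: (hol t).1.
- by rewrite scale0r GExp0 mulg1.
- move=> t; apply: (etrans _ (esym (lif_dL p (c t) v))).
  apply: (etrans _ (hol t).2).
  by have [[_ [d]] _] := hol t; exact: (@deriveE _ C^o V _ t 1 d).
Qed.

(** By [quot_constant], against the one-parameter subgroup of v. *)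
Lemma integral_curve_unique (p : G) (v : V) (w : C^o -> G) :
  @integral_curve R m G p (dL p 1%g v) w -> w 1 = (p * GExp v)%g.
Proof.
move=> [/holomorphic_fromE hw w0 wv].
have gw t : generates w t v.
  apply: mhol_generates (hw t) _.
  have [d1 d2] := mhol_hol (hw t) (hol_Ltrans (w t)^-1%g (w t)).
  have dwt : mder w t (1 : C^o) = @mdiff R m m G G (Ltrans (w t)) 1%g v.
    rewrite -(lif_dL p) -wv.
    by have [_ [d]] := hw t; exact: (esym (@deriveE _ C^o V _ t 1 d)).
  have E1 : (Ltrans (w t)^-1 (w t))%g = 1%g by rewrite /Ltrans mulVg.
  have := congr1 (fun f => f (1 : C^o)) d2; rewrite /= dwt.
  have H := @mdiff_comp R m m m G G G (Ltrans (w t)) (Ltrans (w t)^-1%g) 1%g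
    (hol_Ltrans _ _) (hol_Ltrans _ _).
  have E2 : Ltrans (w t) 1%g = w t by rewrite /Ltrans mulg1.
  have E3 : Ltrans (w t)^-1%g \o Ltrans (w t) = id.
    by apply/funext => x; rewrite /Ltrans /= mulKg.
  rewrite E3 mdiff_id E2 in H.
  have Hv := congr1 (fun f => f v) H; rewrite /= in Hv; rewrite -Hv => <-.
  rewrite /mder /= E1; rewrite -[RHS](congr1 (fun f => f (1 : C^o)) (der_subr (chart_at (1%g : G) 1%g) _)) //.
  by have [_] := d1; rewrite /= E1.
have := @quot_constant R m G r rP s sP w (fun t => GExp (t *: v)) 1 v.
rewrite /quot scale1r scale0r GExp0 invg1 mulg1 w0 => <-; first by rewrite mulgVK.
by move=> x _; exists 1 => // t _; split; [exact: gw|exact: generates_GExp].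
Qed.

Lemma exp_at_GExp (p : G) (v : V) : @exp_at R m G p (dL p 1%g v) = (p * GExp v)%g.
Proof.
apply: integral_curve_unique; rewrite /exp_at.
have H := @xgetPex _ (fun=> p) [set c | @integral_curve R m G p (dL p 1%g v) c].
by apply: H; exists (fun t => (p * GExp (t *: v))%g); exact: integral_curve_GExp.
Qed.

Lemma exp_at_Exp (p : G) (rho : R) (v : V) : nrm (rho%:C *: v) <= s / 2 ->
  @exp_at R m G p (rho%:C *: (dL p 1%g v : V)) = (p * Exp (rho%:C *: v))%g.
Proof.
move=> h; rewrite -(GExp_small h) -exp_at_GExp; congr exp_at.
by rewrite /dL /mdiff linearZ.
Qed.

End ExponentialMap.

(** * The exponential frame *)

Section LocalInverse.
Context {R : realType} {m : nat} (G : complexLieGroup R m).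
Local Notation C := R[i].
Local Notation V := 'rV[C]_m.
Local Notation ell := (@ell R m G).
Local Notation mlt := (@mlt R m G).
Context (r : R) (rP : coord_radius G r).
Context (s : R) (sP : pw_radius r s).
Local Notation K := (mlt_cst r).
Local Notation r2 := (r2 rP).

Local Notation euler := (@euler R m G).

Let s0 : 0 < s. Proof. by case: sP. Qed.
Let sr : 4 * s < r. Proof. by case: sP. Qed.
Let Ks : 4 * (K * s) <= 1. Proof. by case: sP. Qed.

Context (U : set_system nat) (UU : UltraFilter U) (Uoo : \oo `<=` U).
Context (e : V -> V) (eP : forall x, nrm x <= s -> euler ^~ x @ U --> e x).

Local Notation Exp := (@Exp R m G e).

Local Notation ecoord_bound := (ecoord_bound rP sP UU eP).

(** [e x - x] is of second order at 0, so the Cauchy estimates make it a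
    contraction on a small ball. *)
Lemma ecoord_contraction : exists2 t : R, 0 < t <= s & forall x x', nrm x <= t -> nrm x' <= t ->
  nrm ((e x' - x') - (e x - x)) <= nrm (x' - x) / 2.
Proof.
have K0 := mlt_cst_ge0 rP; have := s0 => ?.
have k1 : 0 < 256 * (K + 1) by apply: mulr_gt0; [exact: ltr0n|lra].
pose t := Num.min (s / 4) (256 * (K + 1))^-1.
have t0 : 0 < t by rewrite lt_min invr_gt0 k1 divr_gt0.
have ts : t <= s / 4 by rewrite ge_min lexx.
have tK : 128 * K * t <= 1 / 2.
  apply: (@le_trans _ _ (128 * K * (256 * (K + 1))^-1)).
    rewrite ler_wpM2l ?ge_min ?lexx ?orbT //.
    by apply: mulr_ge0; [exact: ler0n|].
  rewrite ler_pdivrMr //; lra.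
exists (t / 2); first by apply/andP; split; lra.
have t20 : 0 < 2 * t by lra.
have d1 y : nrm (y - 0) < 2 * t -> hdiff (fun x => e x - id x) y.
  rewrite subr0 => yt; apply: hdiffB; last exact: hdiff_id.
  by apply: (hdiff_ecoord rP sP UU eP); lra.
have d2 y : nrm (y - 0) < 2 * t -> nrm (e y - id y) <= K * (2 * t) ^+ 2.
  rewrite subr0 => yt; have ys : nrm y <= s by lra.
  apply: le_trans (ecoord_linear rP sP UU eP ys) _; apply: ler_wpM2l => //.
  by apply: lerXn2r; rewrite ?nnegrE ?nrm_ge0 ?ltW.
move=> x x' xt xt'.
have h1 : nrm (x - 0) < 2 * t / 2 by rewrite subr0; lra.
have h2 : nrm (x' - 0) < 2 * t / 2 by rewrite subr0; lra.
have := cauchy_lipschitz t20 d1 d2 h1 h2.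
have -> : 64 * (K * (2 * t) ^+ 2) / (2 * t) = 128 * K * t by field; rewrite gt_eqF.
move=> /= H; apply: le_trans H _; rewrite mulrC; apply: ler_wpM2l; first exact: nrm_ge0.
by move: tK; rewrite div1r.
Qed.

(** Near 0, [Exp] is [kap] after a bi-Lipschitz change of coordinates, and in
    the coordinates [kap] the two comparisons are solved by [perturb_right] and
    by the group law. *)
Lemma Exp_local : exists2 s1 : R, 0 < s1 <= s / 2 &
  [/\ forall x y, nrm x <= s1 -> nrm y <= s1 ->
       exists2 w, nrm w <= 8 * nrm (y - x) & Exp y = (Exp x * Exp w)%g,
      forall x w, nrm x <= s1 -> nrm w <= s1 ->
       exists2 y, nrm (y - x) <= 8 * nrm w & (Exp x * Exp w)%g = Exp y &
      forall d : R, 0 < d -> nbhs (1%g : G) (Exp @` [set x | nrm x < d])].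
Proof.
have K0 := mlt_cst_ge0 rP; have := s0; have := sr; have := Ks => ? ? ?.
have [t /andP[t0 ts] tL] := ecoord_contraction.
have surj y : nrm y <= t / 2 -> exists2 x, nrm x <= 2 * nrm y & e x = y.
  move=> yt; have rho0 : e 0 - 0 = 0 by rewrite subr0 (ecoord0 rP sP UU eP).
  have [x xB xE] := perturb_id_surj t0 rho0 tL yt.
  by exists x => //; rewrite -xE addrC subrK.
have eL x x' : nrm x <= t -> nrm x' <= t -> nrm (e x' - e x) <= 2 * nrm (x' - x) /\
    nrm (x' - x) <= 2 * nrm (e x' - e x).
  move=> xt xt'; have := tL _ _ xt xt'.
  have -> : e x' - x' - (e x - x) = (e x' - e x) - (x' - x).
    by move: (e x) (e x') => a b; apply/rowP => j; rewrite !mxE; ring.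
  move: (e x' - e x) (x' - x) => u v; have := nrmB_le u v; have := nrmB_le v u.
  by rewrite (nrmBC v) => h1 h2 h3; have := nrm_ge0 v; have := nrm_ge0 u; split; lra.
exists (t / 16); first by apply/andP; split; lra.
split.
- move=> x y xt yt.
  have xs : nrm x <= s by lra.
  have ys : nrm y <= s by lra.
  have ex := ecoord_bound xs; have ey := ecoord_bound ys.
  have ex4 : nrm (e x) <= s / 4 by lra.
  have ey4 : nrm (e y) <= s / 4 by lra.
  have [v vB vE] := perturb_right rP sP ex4 ey4.
  have xt1 : nrm x <= t by lra.
  have yt1 : nrm y <= t by lra.
  have [eL1 _] := eL _ _ xt1 yt1.
  have vt : nrm v <= t / 2.
    by apply: le_trans vB _; have := nrmB (e y) (e x); lra.
  have [w wB wE] := surj v vt.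
  by exists w; [lra|rewrite /Exp wE].
- move=> x w xt wt.
  have xs : nrm x <= s by lra.
  have ws : nrm w <= s by lra.
  have ex := ecoord_bound xs; have ew := ecoord_bound ws.
  have exr : nrm (e x) < r / 2 by lra.
  have ewr : nrm (e w) < r / 2 by lra.
  have H := mlt_approx rP exr ewr.
  have H2 : K * nrm (e x) * nrm (e w) <= 1 * nrm (e w).
    apply: ler_wpM2r; first exact: nrm_ge0.
    have : K * nrm (e x) <= K * s by apply: ler_wpM2l => //; lra.
    lra.
  have H3 : nrm (mlt (e x) (e w) - e x) <= 2 * nrm (e w).
    have := nrmD (mlt (e x) (e w) - e x - e w) (e w).
    rewrite subrK; rewrite opprD addrA in H.
    by have := nrm_ge0 (e w); lra.
  have dt : nrm (mlt (e x) (e w)) <= t / 2.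
    by have := nrmD (mlt (e x) (e w) - e x) (e x); rewrite subrK; lra.
  have [y yB yE] := surj _ dt.
  exists y; last by rewrite /Exp yE (kap_mlt rP) //; exact: r2.
  have xt1 : nrm x <= t by lra.
  have yt1 : nrm y <= t by lra.
  have [_ eL2] := eL _ _ xt1 yt1.
  by rewrite yE in eL2; lra.
- move=> d d0.
  have c0 : 0 < Num.min (t / 2) (d / 2) by rewrite lt_min !divr_gt0.
  have H : nbhs (1%g : G) [set g | nrm (ell g) < Num.min (t / 2) (d / 2)].
    have := ell_cont (@dom1_1 R m G); rewrite /prop_for /continuous_at ell1.
    by move=> /cvg_nrmP /(_ _ c0); apply: filterS => g; rewrite subr0.
  apply: filterS2 H (chart_dom_near (@dom1_1 R m G)) => g /=.
  rewrite lt_min => /andP[g1 g2] gd.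
  have [x xB xE] := surj _ (ltW g1).
  exists x; first by rewrite /=; lra.
  by rewrite /Exp xE kap_ell.
Qed.

End LocalInverse.

Lemma linear_rV_bounded {R : realType} (k : nat) (V : normedModType R[i])
    (L : {linear 'rV[R[i]]_k -> V}) :
  exists2 B : R, 0 < B & forall h, nrm (L h) <= B * nrm h.
Proof.
pose B := \sum_(j < k) nrm (L (delta_mx ord0 j)).
have B0 : 0 <= B by apply: sumr_ge0 => j _; exact: nrm_ge0.
exists (B + 1); first by lra.
move=> h; apply: (@le_trans _ _ (B * nrm h)); last first.
  by apply: ler_wpM2r; [exact: nrm_ge0|lra].
rewrite {1}[h]row_sum_delta linear_sum /= /B mulr_suml.
apply: (@le_trans _ _ (\sum_(j < k) nrm (L (h ord0 j *: delta_mx ord0 j)))).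
  elim/big_ind2: _ => //; first by rewrite nrm0.
  move=> a b c d H1 H2; apply: le_trans (nrmD _ _) _; exact: lerD.
apply: ler_sum => j _; rewrite linearZ nrmZ mulrC; apply: ler_wpM2l; first exact: nrm_ge0.
exact: nrm_coord.
Qed.

(** What the rescaling needs to know about the group: X is the exponential in
    the frame eps, and moving the argument of X by a small vector amounts, up to
    the factor c, to multiplying X by X of a small vector. *)
Lemma exp_frame {R : realType} {m : nat} (G : complexLieGroup R m)
    (eps : m.-tuple (tangent (1%g : G))) : basis_of fullv eps ->
  exists X : 'rV[R[i]]_m -> G, exists s c : R, [/\ 0 < s, 0 < c, X 0 = 1%g,
   forall p (rho : R) (z : 'rV[R[i]]_m), nrm (rho%:C *: z) <= s ->
     exp_at p (rho%:C *: dL p 1%g (\sum_(k < m) z ord0 k *: tnth eps k)) =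
       (p * X (rho%:C *: z))%g &
   [/\ forall z, nrm z <= s -> mhol X z,
      forall x y, nrm x <= s -> nrm y <= s ->
        exists2 w, nrm w <= c * nrm (y - x) & X y = (X x * X w)%g,
      forall x w, nrm x <= s -> nrm w <= s ->
        exists2 y, nrm (y - x) <= c * nrm w & (X x * X w)%g = X y &
      forall d : R, 0 < d -> nbhs (1%g : G) (X @` [set x | nrm x < d])]].
Proof.
move=> eps_basis.
have [r r0 rP'] := local_coordinates G.
have rP : coord_radius G r by split.
have [s sP] := pw_radius_ex rP.
have [U [UU Uoo]] := nat_ultra.
have [e eP] := ecoord_ex rP sP UU.
have [s1 /andP[s10 s1s] [P1 P2 P3]] := Exp_local rP sP UU eP.
have s0 : 0 < s by case: sP.
pose A (z : 'rV[R[i]]_m) : 'rV[R[i]]_m := \sum_(k < m) z ord0 k *: (tnth eps k : 'rV_m).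
have Alin (a : R[i]) u v : A (a *: u + v) = a *: A u + A v.
  rewrite /A scaler_sumr -big_split /=; apply: eq_bigr => k _.
  by rewrite !mxE scalerDl scalerA.
pose A' : {linear 'rV[R[i]]_m -> 'rV[R[i]]_m} :=
  HB.pack A (GRing.isLinear.Build _ _ _ _ A Alin).
pose B (v : 'rV[R[i]]_m) : 'rV[R[i]]_m := \row_k coord eps k v.
have Blin (a : R[i]) u v : B (a *: u + v) = a *: B u + B v.
  by apply/rowP => k; rewrite !mxE linearP.
pose B' : {linear 'rV[R[i]]_m -> 'rV[R[i]]_m} :=
  HB.pack B (GRing.isLinear.Build _ _ _ _ B Blin).
have AB v : A (B v) = v.
  have vin : v \in <<eps>>%VS by rewrite (span_basis eps_basis) memvf.
  rewrite {2}(coord_span vin) /A; apply: eq_bigr => k _.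
  by rewrite mxE (tnth_nth 0).
have BA z : B (A z) = z.
  apply/rowP => k; rewrite mxE /A.
  have -> : \sum_(k0 < m) z ord0 k0 *: (tnth eps k0 : 'rV_m) =
     \sum_(k0 < m) z ord0 k0 *: eps`_k0.
    by apply: eq_bigr => j _; rewrite (tnth_nth 0).
  by rewrite coord_sum_free //; exact: basis_free eps_basis.
have [a a0 aB] : exists2 a : R, 0 < a & forall h, nrm (A h) <= a * nrm h.
  exact: (linear_rV_bounded A').
have [b b0 bB] : exists2 b : R, 0 < b & forall h, nrm (B h) <= b * nrm h.
  exact: (linear_rV_bounded B').
pose X z := @Exp R m G e (A z).
have AZ (c : R[i]) z : A (c *: z) = c *: A z.
  by have := Alin c z 0; rewrite addr0 => ->; rewrite (_ : A 0 = 0) ?addr0 //; exact: (linear0 A').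
have AD x y : A (y - x) = A y - A x by exact: (linearB A').
have A1 z (t : R) : nrm z <= t / a -> nrm (A z) <= t.
  by move=> h; apply: le_trans (aB z) _; rewrite mulrC -ler_pdivlMr.
have A0 : A 0 = 0 by exact: (linear0 A').
exists X, (s1 / a), (8 * (a * b)); split.
- by rewrite divr_gt0.
- by rewrite !mulr_gt0 // ltr0n.
- by rewrite /X A0 (Exp0 rP sP UU eP).
- move=> p rho z h; rewrite /X AZ.
  have h1 := A1 _ _ h; rewrite AZ in h1; apply: (exp_at_Exp rP sP UU Uoo eP); exact: le_trans h1 s1s.
split.
- move=> z /A1 h.
  have zs : nrm (A z) < s by lra.
  have [dA _] := @hdiff_lin R _ _ A a z Alin aB.
  by have [] := mhol_comp dA (mhol_Exp rP sP UU eP zs).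
- move=> x y /A1 hx /A1 hy; have [w wB wE] := P1 _ _ hx hy.
  exists (B w); last by rewrite /X AB.
  apply: le_trans (bB w) _; rewrite -AD in wB.
  have := aB (y - x) => h.
  have : b * nrm w <= b * (8 * (a * nrm (y - x))).
    apply: ler_wpM2l; first exact: ltW.
    by apply: le_trans wB _; apply: ler_wpM2l.
  by have -> : b * (8 * (a * nrm (y - x))) = 8 * (a * b) * nrm (y - x) by ring.
- move=> x w /A1 hx /A1 hw; have [y yB yE] := P2 _ _ hx hw.
  exists (B y); last by rewrite /X yE AB.
  have -> : B y - x = B (y - A x) by rewrite -{1}(BA x); exact: (esym (linearB B' _ _)).
  apply: le_trans (bB _) _.
  have : b * nrm (y - A x) <= b * (8 * (a * nrm w)).
    apply: ler_wpM2l; first exact: ltW.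
    by apply: le_trans yB _; apply: ler_wpM2l.
  by have -> : b * (8 * (a * nrm w)) = 8 * (a * b) * nrm w by ring.
- move=> d d0; have db : 0 < d / b by rewrite divr_gt0.
  apply: filterS (P3 _ db) => _ [x /= xd <-]; exists (B x); last by rewrite /X AB.
  by rewrite /=; apply: le_lt_trans (bB x) _; rewrite mulrC -ltr_pdivlMr.
Qed.

(** * Topological preliminaries *)

Lemma cvg_initial_topology (S : choiceType) (T : topologicalType) (f : S -> T)
    (I : Type) (F : set_system I) {FF : Filter F} (u : I -> S) (x : S) :
  (f \o u) @ F --> f x -> u @ F --> (x : initial_topology f).
Proof.
move=> fu A; rewrite nbhsE => -[B [[B' oB' <-] /= Bx] BA].
have H : \forall i \near F, B' (f (u i)) by apply: fu; exact: open_nbhs_nbhs.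
by apply: filterS H => i; exact: BA.
Qed.

Lemma cvg_seq_compact (T : topologicalType) (u : nat -> T) (l : T) :
  u @ \oo --> l -> compact (range u `|` [set l]).
Proof.
move=> ul F FF FA; apply: contrapT => nocl.
have ncl p : (range u `|` [set l]) p -> exists A B, [/\ F A, nbhs p B & A `&` B = set0].
  move=> up; apply: contrapT => nAB; apply: nocl; exists p; split => // A B FA' pB.
  by apply/set0P/eqP => AB; apply: nAB; exists A, B.
have [|A [B [FA' lB AB]]] := ncl l; first by right.
have [N _ uN] := ul _ lB.
have fin n : F (~` [set x | exists2 i, (i < n)%N & x = u i]).
  elim: n => [|n ih]; first by apply: filterS filterT => x _ [j].
  have [|A' [B' [FA1 uB' AB']]] := ncl (u n); first by left; exists n.
  apply: filterS2 ih FA1 => x nx A'x [j]; rewrite ltnS leq_eqVlt => /orP[/eqP -> xE|jN xE].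
    suff : (A' `&` B') x by rewrite AB'.
    by split => //; rewrite xE; exact: nbhs_singleton uB'.
  by apply: nx; exists j.
have [x [[xA [xu xN]]]] := filter_ex (filterI (filterI FA' (filterI FA (fin N))) filterT).
move=> _; case: xu => [[i _ ui]|xl].
- have [iN|Ni] := ltnP i N; first by apply: xN; exists i.
  suff : (A `&` B) x by rewrite AB.
    by split => //; rewrite -ui; exact: uN.
- suff : (A `&` B) x by rewrite AB.
    by split => //; rewrite xl; exact: nbhs_singleton lB.
Qed.

(** Needed for precompactness to pass to subsets. *)
Lemma cts_hausdorff (M N : topologicalType) : hausdorff_space N ->
  hausdorff_space (cont_compact_open M N).
Proof.
move=> hN f g fg.
have ev_nbhs (h : cont_compact_open M N) (x : M) (O : set N) : open O -> O ((h : continuousType M N) x) ->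
    nbhs h [set k : cont_compact_open M N | O ((k : continuousType M N) x)].
  move=> oO Ohx; apply: open_nbhs_nbhs; split => //.
  exists [set k : M -> N | k @` [set x] `<=` O].
    by apply: compact_open_open => //; exact: compact_set1.
  by apply/seteqP; split => k /= kO; [apply: kO; exists x|move=> _ [_ -> <-]].
suff : forall x, (f : continuousType M N) x = (g : continuousType M N) x.
  by move=> E; apply/continuousEP.
move=> x; apply: hN => A B; rewrite nbhsE => -[A' [oA' A'x] AA']; rewrite nbhsE => -[B' [oB' B'x] BB'].
have [k [kA kB]] := fg _ _ (ev_nbhs f x A' oA' A'x) (ev_nbhs g x B' oB' B'x).
by exists ((k : continuousType M N) x); split; [exact: AA'|exact: BB'].
Qed.

Section Distance.
Context {R : realType} {N : topologicalType} (d : N -> N -> R) (dP : distance_on d).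

Lemma dist_refl x : d x x = 0.
Proof. by case: dP => [h _ _ _]; apply/h. Qed.
Lemma dist_sym x y : d x y = d y x.
Proof. by case: dP => [_ h _ _]; exact: h. Qed.
Lemma dist_tri y x z : d x z <= d x y + d y z.
Proof. by case: dP => [_ _ h _]; exact: h. Qed.
Lemma dist_ge0 x y : 0 <= d x y.
Proof. by have := dist_tri y x x; rewrite dist_refl (dist_sym y x); lra. Qed.

Lemma dist_separation (x y x' y' : N) (eta : R) :
  3 * eta <= d x y -> d x' x < eta -> d y' y < eta -> eta <= d x' y'.
Proof.
have := dist_tri x' x y; have := dist_tri y' x' y; rewrite (dist_sym x x'); lra.
Qed.

Lemma nbhs_dist x (A : set N) :
  nbhs x A <-> exists2 r : R, 0 < r & [set y | d x y < r] `<=` A.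
Proof. by case: dP => [_ _ _ h]; exact: h. Qed.

Lemma nbhs_dball x (r : R) : 0 < r -> nbhs x [set y | d x y < r].
Proof. by move=> r0; apply/nbhs_dist; exists r. Qed.

Lemma cvg_distP (I : Type) (F : set_system I) {FF : Filter F} (u : I -> N) (l : N) :
  u @ F --> l <-> forall e : R, 0 < e -> F [set i | d (u i) l < e].
Proof.
split=> [h e e0|h A /nbhs_dist [e e0 hA]].
  have H : F [set i | d l (u i) < e] := h _ (nbhs_dball l e0).
  by apply: filterS H => i /=; rewrite dist_sym.
suff : F [set i | A (u i)] by [].
by apply: filterS (h e e0) => i /= H; apply: hA; rewrite /= dist_sym.
Qed.

Lemma dist_hausdorff : hausdorff_space N.
Proof.
move=> x y xy; case: dP => [h _ _ _]; apply/h/eqP; rewrite eq_le dist_ge0 andbT leNgt.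
apply/negP => xy0; have e0 : 0 < d x y / 2 by rewrite divr_gt0.
have [z [/= z1 z2]] := xy _ _ (nbhs_dball x e0) (nbhs_dball y e0).
by have := dist_tri z x y; rewrite (dist_sym z); lra.
Qed.

Lemma uniform_cvg_compact_open (M : topologicalType) (g_ : nat -> continuousType M N)
    (g : continuousType M N) :
  (forall e : R, 0 < e -> \forall k \near \oo, forall x, d (g_ k x) (g x) < e) ->
  (g_ : nat -> cont_compact_open M N) @ \oo --> (g : cont_compact_open M N).
Proof.
move=> ug; apply: cvg_initial_topology.
apply/compact_open_cvgP => K O cK oO gKO.
have H x : K x -> \forall x' \near x & k \near \oo, O (g_ k x').
  move=> Kx; have : nbhs (g x) O by apply: open_nbhs_nbhs; split => //; apply: gKO; exists x.
  move/nbhs_dist => [e e0 eO]; have e2 : 0 < e / 2 by rewrite divr_gt0.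
  have gx : \forall x' \near x, d (g x) (g x') < e / 2.
    exact: (@cts_fun _ _ g x _ (nbhs_dball (g x) e2)).
  exists ([set x' | d (g x) (g x') < e / 2], [set k | forall x, d (g_ k x) (g x) < e / 2]).
    by split; [exact: gx|exact: ug].
  move=> [x' k] [/= h1 h2]; apply: eO => /=.
  by have := dist_tri (g x') (g x) (g_ k x'); rewrite (dist_sym (g x') (g_ k x')); have := h2 x'; lra.
have HK := (compact_near_coveringP K).1 cK _ \oo (fun k x => O (g_ k x)) _ H.
suff : \forall k \near \oo, g_ k @` K `<=` O by [].
by case: HK => n _ HK; exists n => // k nk _ [x Kx <-]; exact: HK nk _ Kx.
Qed.

Lemma uniform_precompact (M : topologicalType) (g_ : nat -> continuousType M N)
    (g : continuousType M N) :
  (forall e : R, 0 < e -> \forall k \near \oo, forall x, d (g_ k x) (g x) < e) ->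
  precompact (range g_ : set (cont_compact_open M N)).
Proof.
move=> /uniform_cvg_compact_open /cvg_seq_compact cg.
apply: precompact_subset (compact_precompact (cts_hausdorff dist_hausdorff) cg).
by move=> h; left.
Qed.

(** The only extraction of a subsequence: each of countably many properties that
    hold along the ultrafilter is satisfied at some later index. *)
Lemma ultra_subsequence (U : set_system nat) {UU : UltraFilter U} (Q : nat -> set nat) :
  \oo `<=` U -> (forall k, U (Q k)) ->
  exists2 s : nat -> nat, {homo s : i j / (i < j)%N} & forall k, Q k (s k).
Proof.
move=> Uoo UQ.
have step k n : exists i, Q k i /\ (n < i)%N.
  have H : U (Q k `&` [set i | (n < i)%N]).
    by apply: filterI; [exact: UQ|apply: Uoo; exists n.+1].
  by have [i [? ?]] := filter_ex H; exists i.
have [f fP] := choice (fun kn : nat * nat => step kn.1 kn.2).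
pose s := fix s k := if k is k'.+1 then f (k, s k') else f (0%N, 0%N).
exists s; last first.
  by case=> [|k]; [have [] := fP (0%N, 0%N)|have [] := fP (k.+1, s k)].
have sS k : (s k < s k.+1)%N by have [] := fP (k.+1, s k).
move=> i; elim=> [//|j ih]; rewrite ltnS leq_eqVlt => /orP[/eqP ->|/ih ij].
  exact: sS.
exact: ltn_trans ij (sS j).
Qed.

End Distance.

(** * Equicontinuity of holomorphic maps into a compact manifold *)

Section CompactTarget.
Context {R : realType} {n : nat} (N : complexManifold R n).
Context (N_compact : compact [set: N]) (d : N -> N -> R) (dP : distance_on d).
Context (U : set_system nat) (UU : UltraFilter U) (Uoo : \oo `<=` U).
Local Notation C := R[i].

Lemma ultra_lim (u : nat -> N) : exists l : N, u @ U --> l.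
Proof.
have H : U [set i | [set: N] (u i)] by apply: filterE.
by have [l _ ul] := @ultra_compact_cvg _ U UU N u _ N_compact H; exists l.
Qed.

Lemma ultra_dist (u : nat -> N) (l : N) : u @ U --> l ->
  forall e : R, 0 < e -> U [set i | d (u i) l < e].
Proof. by move=> /(cvg_distP dP). Qed.

(** A Lebesgue number for the covering of N by bounded pieces of charts. *)
Definition chart_scale (delta : R) := 0 < delta /\
  forall y, exists y1 : N, exists B : R, forall y', d y y' < 2 * delta ->
    chart_dom (chart_at y1) y' /\ nrm (chart_at y1 y') <= B.

(** Otherwise some limit of centres of bad balls would have no bounded chart
    around it. *)
Lemma chart_scale_ex : exists delta, chart_scale delta.
Proof.
apply: contrapT => nex.
have bad k : exists y : N, forall (y1 : N) (B : R), exists2 y',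
    d y y' < 2 * k.+1%:R^-1 & ~ (chart_dom (chart_at y1) y' /\ nrm (chart_at y1 y') <= B).
  apply: contrapT => nb; apply: nex; exists k.+1%:R^-1; split; first by rewrite invr_gt0.
  move=> y; apply: contrapT => ny; apply: nb; exists y => y1 B; apply: contrapT => ny'.
  apply: ny; exists y1, B => y' yy'; apply: contrapT => H; apply: ny'; by exists y'.
have [y yP] := choice bad.
have [l yl] := ultra_lim y.
have aN := mem_chart_at l.
have H : nbhs l [set q | chart_dom (chart_at l) q /\ nrm (chart_at l q) <= nrm (chart_at l l) + 1].
  apply: filterI; first exact: chart_dom_near.
  have /cvg_nrmP /(_ _ ltr01) := chart_cont aN.
  by apply: filterS => q; have := nrmB_le (chart_at l q) (chart_at l l); lra.
move/(nbhs_dist dP): H => [e e0 eH].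
have e2 : 0 < e / 2 by rewrite divr_gt0.
have yl2 := ultra_dist yl e2.
have small := natV_cvg Uoo 2 e2.
have [k [k1 k2]] := filter_ex (filterI yl2 small).
have [y' y'1 y'2] := yP k l (nrm (chart_at l l) + 1).
apply: y'2; apply: eH => /=; rewrite /= in k1 k2.
have := dist_tri dP (y k) l y'; rewrite (dist_sym dP l (y k)).
by move: k1 k2 y'1; move: (k.+1%:R^-1 : R) => j; lra.
Qed.

Context (delta : R) (deltaP : chart_scale delta).
Let delta0 : 0 < delta. Proof. by case: deltaP. Qed.

(** Maps that move points by at most delta on a ball stay, near their limit
    value, in one chart with bounded coordinates, where the Cauchy estimates
    make them equicontinuous. *)
Lemma ultra_equicontinuous (V : normedModType C) (f : nat -> V -> N) (z : V) (r : R) (y0 : N) :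
  0 < r ->
  U [set i | forall w, nrm (w - z) < r -> mhol (f i) w /\ d (f i z) (f i w) <= delta] ->
  f ^~ z @ U --> y0 ->
  forall e : R, 0 < e -> exists2 eta : R, 0 < eta &
    U [set i | forall w, nrm (w - z) < eta -> d (f i w) y0 < e].
Proof.
move=> r0 fU fz e e0.
have [y1 [B aB]] := deltaP.2 y0; set a := chart_at y1 in aB.
have y0d : d y0 y0 < 2 * delta by rewrite (dist_refl dP) mulr_gt0.
have [ay0 _] := aB _ y0d.
have fz0 := ultra_dist fz delta0.
have B0 : 0 <= B by have [_ h] := aB _ y0d; exact: le_trans (nrm_ge0 _) h.
have inv_cont : nbhs (a y0) [set x | d y0 (chart_inv a x) < e].
  apply: (@near_continuous _ _ (chart_inv a) (a y0) [set y | d y0 y < e] (chart_inv_continuous ay0)).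
  by rewrite chart_invK //; exact: nbhs_dball.
move/nbhs_nrmP: inv_cont => [t t0 tP].
have t2 : 0 < t / 2 by rewrite divr_gt0.
have az : U [set i | nrm (a (f i z) - a y0) < t / 2].
  have : a \o (f ^~ z) @ U --> a y0 by apply: continuous_cvg => //; exact: chart_cont.
  by move/cvg_nrmP; apply.
pose c := 64 * B / r.
have c0 : 0 <= c by apply: divr_ge0; [apply: mulr_ge0; [exact: ler0n|]|exact: ltW].
have c1 : 0 < c + 1 by lra.
exists (Num.min (r / 2) (t / 2 / (c + 1))); first by rewrite lt_min !divr_gt0.
apply: filterS (filterI fU (filterI fz0 az)) => i [H1 [H2 H3]] w.
rewrite /= in H1 H2 H3; rewrite lt_min => /andP[wr]; rewrite ltr_pdivlMr // => wt.
have fd v : nrm (v - z) < r -> chart_dom a (f i v) /\ nrm (a (f i v)) <= B.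
  move=> vr; apply: aB; have [_ h] := H1 v vr.
  by have := dist_tri dP (f i z) y0 (f i v); rewrite (dist_sym dP y0 (f i z)); lra.
have hd v : nrm (v - z) < r -> hdiff (a \o f i) v.
  move=> vr; have [h _] := H1 v vr; apply: mhol_chart h (atlas_chart_at _) _.
  by have [] := fd v vr.
have bd v (vr : nrm (v - z) < r) := (fd v vr).2.
have zz : nrm (z - z) < r / 2 by rewrite subrr nrm0 divr_gt0.
have L := cauchy_lipschitz r0 hd bd zz wr.
have wr' : nrm (w - z) < r by lra.
rewrite (dist_sym dP) -(chart_invK (fd w wr').1); apply: tP.
apply: le_lt_trans (nrm_tri (a (f i z)) _ _) _.
rewrite -/c /= in L; have nw := nrm_ge0 (w - z); lra.
Qed.

Lemma ultra_near (T : topologicalType) (f : nat -> T -> N) (z : T) (A : set T) (y0 : N) (e : R) :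
  nbhs z A -> U [set i | forall w, A w -> d (f i w) y0 < e] ->
  \forall w \near z & i \near U, d (f i w) y0 < e.
Proof.
move=> zA UA; exists (A, [set i | forall w, A w -> d (f i w) y0 < e]) => //.
by move=> [w i] [/= h1 h2]; exact: h2.
Qed.

(** Near z the maps have values in one chart, where the coordinates are bounded:
    Weierstrass applies. *)
Lemma ultra_holomorphic (V : normedModType C) (f : nat -> V -> N) (g : V -> N) (z : V) (r : R) :
  0 < r ->
  U [set i | forall w, nrm (w - z) < r -> mhol (f i) w /\ d (f i z) (f i w) <= delta] ->
  (forall w, nrm (w - z) < r -> f ^~ w @ U --> g w) ->
  mhol g z.
Proof.
move=> r0 fU fg.
have zz : nrm (z - z) < r by rewrite subrr nrm0.
have fz := fg _ zz.
have eq := ultra_equicontinuous r0 fU fz.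
have close e : 0 < e -> exists2 eta : R, 0 < eta & forall w, nrm (w - z) < eta -> d (g z) (g w) <= e.
  move=> e0; have [eta eta0 H] := eq e e0.
  exists (Num.min eta r); first by rewrite lt_min eta0.
  move=> w; rewrite lt_min => /andP[w1 w2]; apply/ler_addgt0Pr => e1 e10.
  have gw := ultra_dist (fg w w2) e10.
  have [i [/= h1 h2]] := filter_ex (filterI H gw).
  have := h1 w w1; have := dist_tri dP (f i w) (g z) (g w).
  by rewrite (dist_sym dP (g z) (f i w)); lra.
have gc : {for z, continuous g}.
  move=> A /(nbhs_dist dP) [e e0 eA].
  have [eta eta0 H] := close (e / 2) (divr_gt0 e0 (ltr0Sn _ 1)).
  apply/nbhs_nrmP; exists eta => // w /H h; apply: eA => /=; lra.
have [y1 [B aB]] := deltaP.2 (g z); set a := chart_at y1 in aB.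
have d2 : 0 < delta / 2 by rewrite divr_gt0.
have [eta eta0 H] := eq _ d2.
have [eta' eta'0 H'] := close _ d2.
have az : chart_dom a (g z) by apply: (aB _ _).1; rewrite (dist_refl dP) mulr_gt0.
apply: (chart_mhol gc (atlas_chart_at y1) az).
have rho0 : 0 < Num.min r (Num.min eta eta') by rewrite !lt_min r0 eta0.
apply: (@weierstrass R nat U UU V n (fun i => a \o f i) (a \o g) z _ B rho0).
- apply: filterS (filterI fU H) => i [/= h1 h2] w; rewrite !lt_min => /and3P[w1 w2 w3].
  have [m1 _] := h1 w w1.
  have [a1 a2] : chart_dom a (f i w) /\ nrm (a (f i w)) <= B.
    by apply: aB; rewrite (dist_sym dP); have := h2 w w2; have := delta0; lra.
  by split; [exact: mhol_chart m1 (atlas_chart_at _) a1|exact: a2].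
- move=> w; rewrite !lt_min => /and3P[w1 w2 w3].
  have aw : chart_dom a (g w).
    by apply: (aB _ _).1; have := H' w w3; have := delta0; lra.
  apply: (@continuous_cvg _ _ _ U _ (f ^~ w) a (g w)); first exact: chart_cont.
  exact: fg.
Qed.

(** Near each point of K, f and its limit vary by less than e / 3; finitely many
    such neighbourhoods cover K. *)
Lemma ultra_uniform (T : topologicalType) (f : nat -> T -> N) (g : T -> N) (K : set T) :
  compact K -> (forall z, K z -> \forall w \near z, f ^~ w @ U --> g w) ->
  (forall z, K z -> forall e : R, 0 < e ->
     \forall w \near z & i \near U, d (f i w) (g z) < e) ->
  forall e : R, 0 < e -> U [set i | forall w, K w -> d (f i w) (g w) < e].
Proof.
move=> cK fg H e e0; have e3 : 0 < e / 3 by rewrite divr_gt0.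
apply: ((compact_near_coveringP K).1 cK _ U (fun i w => d (f i w) (g w) < e) _).
move=> z Kz; have [[A B] /= [zA UB] AB] := H z Kz _ e3.
exists (A `&` [set w | f ^~ w @ U --> g w], B).
  by split => //=; apply: filterI => //; exact: fg.
move=> [w i] /= [[Aw gw] Bi].
have gw3 := ultra_dist gw e3.
have [j [Bj /= h1]] := filter_ex (filterI UB gw3).
have h2 := AB (w, j) (conj Aw Bj); have h3 := AB (w, i) (conj Aw Bi); rewrite /= in h2 h3.
have := dist_tri dP (f j w) (g z) (g w); have := dist_tri dP (g z) (f i w) (g w).
by rewrite (dist_sym dP (g z) (f j w)); lra.
Qed.

End CompactTarget.

Lemma nrm_ball_compact {R : realType} (k : nat) (r : R) :
  compact [set x : 'rV[R[i]]_k | nrm x <= r].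
Proof.
rewrite compact_ultra => F FU Fr.
have [l lr Fl] := @ultra_cvg_bounded R _ F FU k id r Fr.
by exists l; split.
Qed.

(** * Normal sequences are equicontinuous *)

Section NormalSeparation.
Context {R : realType} {M N : topologicalType} (N_compact : compact [set: N]).
Context (d : N -> N -> R) (dP : distance_on d).
Context (Omega : set M) (F : set (M -> N)) (p0 : M).
Context (F_cont : forall f p, F f -> Omega p -> {for p, continuous f}).

Lemma cvg_subseq (T : topologicalType) (x : nat -> T) (l : T) (s : nat -> nat) :
  {homo s : i j / (i < j)%N} -> x @ \oo --> l -> (x \o s) @ \oo --> l.
Proof.
move=> sS xl A lA; have [n _ xn] := xl A lA.
have le_s j : (j <= s j)%N.
  elim: j => [//|j ih]; exact: leq_ltn_trans ih (sS _ _ (ltnSn j)).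
by exists n => // j nj; apply: xn => /=; exact: leq_trans nj (le_s j).
Qed.

Lemma cvg_insubd (V : set M) (v0 : set_type V) (x : nat -> M) : open V ->
  x @ \oo --> set_val v0 -> (fun j => insubd v0 (x j) : set_type V) @ \oo --> v0.
Proof.
move=> oV xv; apply: cvg_initial_topology => A vA.
have vV : nbhs (set_val v0) V by apply: open_nbhs_nbhs; split => //; exact: set_valP.
have [n1 _ h1] := xv A vA; have [n2 _ h2] := xv V vV.
exists (maxn n1 n2) => // j; rewrite /= geq_max => /andP[j1 j2].
have E : set_val (insubd v0 (x j)) = x j.
  by rewrite set_valE /= insubdK //; apply/mem_set; exact: h2.
by rewrite /= E; exact: h1.
Qed.

(** The compactness of N excludes compact divergence. A cluster point h of a
    normal sequence is continuous at p0, and infinitely many members map the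
    compact set formed by p0 and the tails of x and y close to [h p0]. *)
Lemma normal_not_separating (f : nat -> M -> N) (x y : nat -> M) (eta : R) :
  normal_at Omega F p0 -> (forall j, F (f j)) ->
  x @ \oo --> p0 -> y @ \oo --> p0 -> 0 < eta ->
  ~ (\forall j \near \oo, eta <= d (f j (x j)) (f j (y j))).
Proof.
move=> [V [oV Vp0 VO nV]] Ff xp yp eta0 [J0 _ sep].
pose v0 : set_type V := exist _ p0 (mem_set Vp0).
have v0E : set_val v0 = p0 by [].
have fc j : continuous (fun v : set_type V => f j (set_val v)).
  move=> v; apply: (@continuous_comp _ _ _ (set_val : set_type V -> M) (f j)).
    exact: initial_continuous.
  by apply: F_cont => //; apply: VO; exact: set_valP.
pose g j : continuousType (set_type V) N := mkcts (fc j).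
have gF j : [set g : continuousType (set_type V) N |
    exists2 f, F f & forall x : set_type V, g x = f (set_val x)] (g j) by exists (f j).
have [s sS [pre|div]] := nV g gF; last first.
  have [n _ H] := div [set v0] setT (@compact_set1 _ v0) N_compact.
  have := H n (leqnn n); rewrite setIT => /seteqP [E _].
  by apply: (E (g (s n) v0)); exists v0.
rewrite precompactE in pre.
have rng : ((g \o s : nat -> cont_compact_open (set_type V) N) @ \oo)
    (closure (range (g \o s) : set (cont_compact_open (set_type V) N))).
  by exists 0%N => // j _; apply: subset_closure; exists j.
have [h [_ hcl]] := pre _ _ rng.
have hc : {for v0, continuous (h : continuousType (set_type V) N)} by exact: cts_fun.
have e2 : 0 < eta / 2 by rewrite divr_gt0.
have := nbhs_dball dP ((h : continuousType (set_type V) N) v0) e2.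
rewrite nbhsE => -[W [oW Wh] Wball].
pose xs j : set_type V := insubd v0 (x (s j)); pose ys j : set_type V := insubd v0 (y (s j)).
have xsv : xs @ \oo --> v0 by apply: cvg_insubd => //; exact: cvg_subseq sS xp.
have ysv : ys @ \oo --> v0 by apply: cvg_insubd => //; exact: cvg_subseq sS yp.
have hW : nbhs v0 [set v | W ((h : continuousType (set_type V) N) v)].
  by apply: hc; exact: open_nbhs_nbhs.
have [J1 _ hx] := xsv _ hW; have [J2 _ hy] := ysv _ hW.
have xV : nbhs p0 V by exact: open_nbhs_nbhs.
have [J3 _ xV3] := xp _ xV; have [J4 _ yV4] := yp _ xV.
pose J := maxn (maxn J0 J1) (maxn J2 (maxn J3 J4)).
have shift (u : nat -> set_type V) : u @ \oo --> v0 -> (fun j => u (J + j)%N) @ \oo --> v0.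
  move=> uv; apply: (@cvg_subseq _ u v0 (fun j => (J + j)%N)) => // a b ab.
  by rewrite ltn_add2l.
pose K : set (set_type V) := (range (fun j => xs (J + j)%N) `|` [set v0]) `|`
  (range (fun j => ys (J + j)%N) `|` [set v0]).
have cK : compact K by apply: compactU; apply: cvg_seq_compact; exact: shift.
have le_s j : (j <= s j)%N.
  elim: j => [//|j ih]; exact: leq_ltn_trans ih (sS _ _ (ltnSn j)).
have hKW : (h : continuousType (set_type V) N) @` K `<=` W.
  move=> _ [v [[[j _ <-]|->]|[[j _ <-]|->]] <-] //.
    by apply: hx; rewrite /= /J; lia.
  by apply: hy; rewrite /= /J; lia.
have hnb : nbhs h [set k : cont_compact_open (set_type V) N |
    (k : continuousType (set_type V) N) @` K `<=` W].
  apply: open_nbhs_nbhs; split => //.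
  by exists [set k : set_type V -> N | k @` K `<=` W] => //; exact: compact_open_open.
have tail : ((g \o s : nat -> cont_compact_open (set_type V) N) @ \oo)
   [set k | exists2 j, (J <= j)%N & k = g (s j)].
  by exists J => // j Jj; exists j.
have [k [[j Jj ->] kW]] := hcl _ _ tail hnb.
have jJ : j = (J + (j - J))%N by rewrite subnKC.
have gx : W (g (s j) (xs j)).
  by apply: kW; exists (xs j) => //; left; left; exists (j - J)%N => //; rewrite -jJ.
have gy : W (g (s j) (ys j)).
  by apply: kW; exists (ys j) => //; right; left; exists (j - J)%N => //; rewrite -jJ.
have sj := le_s j.
have xE : set_val (xs j) = x (s j).
  rewrite /xs set_valE /= insubdK //; apply/mem_set; apply: xV3 => /=.
  by move: Jj sj; rewrite /J; lia.
have yE : set_val (ys j) = y (s j).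
  rewrite /ys set_valE /= insubdK //; apply/mem_set; apply: yV4 => /=.
  by move: Jj sj; rewrite /J; lia.
have := Wball _ gx; have := Wball _ gy; rewrite /= /g /mkcts xE yE.
have : (J0 <= s j)%N by move: Jj sj; rewrite /J; lia.
move=> /sep H h1 h2.
have := dist_tri dP ((h : continuousType (set_type V) N) v0) (f (s j) (x (s j))) (f (s j) (y (s j))).
rewrite (dist_sym dP (f (s j) (x (s j))) ((h : continuousType (set_type V) N) v0)).
move=> h3; move: H; apply/negP; rewrite -ltNge.
by apply: le_lt_trans h3 _; rewrite [ltRHS]splitr; first [exact: ltrD h1 h2|exact: ltrD h2 h1].
Qed.

End NormalSeparation.

(** * Rescaling *)

Section Rescaling.
Context {R : realType} {m n : nat} (G : complexLieGroup R m) (N : complexManifold R n).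
Local Notation C := R[i].
Local Notation V := 'rV[C]_m.
Context (Omega : set G) (Omega_open : open Omega) (p0 : G) (Omega_p0 : Omega p0).
Context (N_compact : compact [set: N]) (d : N -> N -> R) (dP : distance_on d).
Context (F : set (G -> N)) (F_hol : forall f p, F f -> Omega p -> hol_at f p).
Context (X : V -> G) (s c : R) (s0 : 0 < s) (c0 : 0 < c) (X0 : X 0 = 1%g).
Context (X_hol : forall z, nrm z <= s -> mhol X z).
Context (X_quot : forall x y, nrm x <= s -> nrm y <= s ->
   exists2 w, nrm w <= c * nrm (y - x) & X y = (X x * X w)%g).
Context (X_mul : forall x w, nrm x <= s -> nrm w <= s ->
   exists2 y, nrm (y - x) <= c * nrm w & (X x * X w)%g = X y).
Context (X_nbhs : forall e : R, 0 < e -> nbhs (1%g : G) (X @` [set x | nrm x < e])).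
Context (U : set_system nat) (UU : UltraFilter U) (Uoo : \oo `<=` U).
Context (delta : R) (deltaP : chart_scale d delta).
Let delta0 : 0 < delta. Proof. by case: deltaP. Qed.

Lemma translate_hol (p : G) (z : V) : nrm z <= s -> mhol (fun w => (p * X w)%g) z.
Proof. by move=> zs; exact: mhol_mul (mhol_cst p z) (X_hol zs). Qed.

Lemma comp_hol (f : G -> N) (p : G) (z : V) : F f -> nrm z <= s -> Omega (p * X z)%g ->
  mhol (fun w => f (p * X w)%g) z.
Proof.
by move=> Ff zs Oz; have [h _] := mhol_hol (translate_hol p zs) (F_hol Ff Oz).
Qed.

Definition coord_ball (b : R) := [/\ 0 < b, b <= s &
  forall y, nrm y < b -> Omega (p0 * X y)%g].

Lemma coord_ball_ex : exists b, coord_ball b.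
Proof.
have z0 : nrm (0 : V) <= s by rewrite nrm0 ltW.
have [Tc _] := translate_hol p0 z0.
have H : nbhs (p0 * X 0)%g Omega by rewrite X0 mulg1; exact: open_nbhs_nbhs.
have /nbhs_nrmP [e e0 eP] := near_continuous Tc H.
exists (Num.min e s); split; [by rewrite lt_min e0|by rewrite ge_min lexx orbT|].
by move=> y; rewrite lt_min => /andP[ye _]; apply: eP; rewrite subr0.
Qed.

Context (b : R) (bP : coord_ball b).
Let b0 : 0 < b. Proof. by case: bP. Qed.
Let bs : b <= s. Proof. by case: bP. Qed.
Let bO y : nrm y < b -> Omega (p0 * X y)%g. Proof. by case: bP => _ _; apply. Qed.

(** The substitute for a bound 1 / r on the derivative of f at the point of
    coordinate y: it is expressed by the distance alone, and rescaling the frame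
    rescales r. *)
Definition tame (f : G -> N) (y : V) (r : R) := forall z, nrm z < r ->
  d (f (p0 * X y)%g) (f (p0 * X y * X z)%g) <= delta.

(** Tame maps are equicontinuous by [ultra_equicontinuous], so that limits along
    an ultrafilter are uniform near p0. *)
Lemma uniformly_tame_normal (r : R) : 0 < r ->
  (forall f y, F f -> nrm y < r -> tame f y r) -> normal_at Omega F p0.
Proof.
move=> r0 tameF.
pose e := Num.min (b / 2) (r / 2).
have e0 : 0 < e by rewrite lt_min !divr_gt0.
have eb : e < b by rewrite gt_min; apply/orP; left; have := b0; lra.
have er : e < r by rewrite gt_min; apply/orP; right; lra.
pose W : set G := interior ([set g | (X @` [set x | nrm x < e]) (p0^-1 * g)%g] `&` Omega).
have WE g : W g -> exists2 y, nrm y < e & g = (p0 * X y)%g.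
  move=> /interior_subset [[y /= ye yE] _]; exists y => //.
  by rewrite yE mulVKg.
exists W; split.
- exact: open_interior.
- rewrite /W; apply: filterI; last exact: open_nbhs_nbhs.
  have cc : {for p0, continuous (fun g => (p0^-1 * g)%g)}.
    by apply: continuous_mul; [exact: cst_continuous|by move=> A].
  by apply: (near_continuous cc); rewrite mulVg; exact: X_nbhs.
- by move=> g /interior_subset [].
move=> g gF.
have [f fP] := choice (fun j => let: ex_intro2 f Ff fE := gF j in
   (ex_intro _ f (conj Ff fE) : exists f, F f /\ forall x : set_type W, g j x = f (set_val x))).
pose h j y := f j (p0 * X y)%g.
have hyp z : nrm z <= e -> exists2 t : R, 0 < t & U [set i | forall w, nrm (w - z) < t ->
    mhol (h i) w /\ d (h i z) (h i w) <= delta].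
  move=> ze; exists (Num.min (b - e) (r / c)); first by rewrite lt_min subr_gt0 eb divr_gt0.
  apply: filterE => i w; rewrite lt_min ltr_pdivlMr // => /andP[w1 w2].
  have wb : nrm w < b by have := nrmD (w - z) z; rewrite subrK; lra.
  have ws : nrm w <= s by have := bs; lra.
  have zs : nrm z <= s by have := bs; lra.
  split; first by apply: (comp_hol (fP i).1) => //; exact: bO.
  have [v vB vE] := X_quot zs ws.
  rewrite /h vE mulgA; apply: (tameF _ _ (fP i).1); first by lra.
  by apply: le_lt_trans vB _; rewrite mulrC.
have [hl hlP] := choice (fun y => ultra_lim N_compact UU (h ^~ y)).
have unif : forall e' : R, 0 < e' -> U [set i | forall w, nrm w <= e -> d (h i w) (hl w) < e'].
  apply: (ultra_uniform dP UU (@nrm_ball_compact R m e)).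
    by move=> z _; apply: filterE => w; exact: hlP.
  move=> z ze e' e'0; have [t t0 tU] := hyp z ze.
  have [eta eta0 H] := ultra_equicontinuous dP UU deltaP t0 tU (hlP z) e'0.
  apply: (@ultra_near R n N d U _ h z [set w | nrm (w - z) < eta]) => //.
  by apply/nbhs_nrmP; exists eta.
have unifk k : U [set i | forall w, nrm w <= e -> d (h i w) (hl w) < k.+1%:R^-1].
  by apply: unif; rewrite invr_gt0.
have [t tS tP] := ultra_subsequence Uoo unifk.
exists t => //; left.
have pick (x : set_type W) : exists y, nrm y < e /\ set_val x = (p0 * X y)%g.
  by have [y ye yE] := WE _ (set_valP x); exists y.
have [y yP] := choice pick.
pose gl x := hl (y x).
have gE k x : g k x = h k (y x) by rewrite /h -(yP x).2 -(fP k).2.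
have gu (e' : R) : 0 < e' -> \forall k \near \oo, forall x, d (g (t k) x) (gl x) < e'.
  move=> e'0; have [K hK] : exists K : nat, e'^-1 < K%:R.
    by exists (Num.bound e'^-1); apply: archi_boundP; rewrite invr_ge0 ltW.
  exists K => // k /= Kk x; rewrite gE; apply: lt_trans (tP k (y x) (ltW (yP x).1)) _.
  rewrite invf_plt ?posrE // ; apply: lt_le_trans hK _; by rewrite ler_nat leqW.
have glc : continuous gl.
  move=> x A /(nbhs_dist dP) [e' e'0 eA].
  have e3 : 0 < e' / 3 by rewrite divr_gt0.
  have [K _ HK] := gu _ e3.
  have gx : \forall x' \near x, d (g (t K) x) (g (t K) x') < e' / 3.
    exact: (@cts_fun _ _ (g (t K)) x _ (nbhs_dball dP (g (t K) x) e3)).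
  suff : \forall x' \near x, A (gl x') by [].
  apply: filterS gx => x' x'x; apply: eA => /=.
  have h1 := HK K (leqnn K) x; have h2 := HK K (leqnn K) x'.
  have h3 := dist_tri dP (g (t K) x) (gl x) (gl x').
  have h4 := dist_tri dP (g (t K) x') (g (t K) x) (gl x').
  rewrite (dist_sym dP (gl x) (g (t K) x)) in h3; move: x'x h1 h2 h3 h4 => /=; lra.
exact: (@uniform_precompact R N d dP _ (g \o t) (mkcts glc) gu).
Qed.

(** Hofer's doubling argument. Suppose that f is not tame at y at the scale r. If
    some point at distance at most A / 2 is not tame at the scale r / 4, move to
    that point, halve A and divide r by 4. The ratio A / r grows, and the points
    stay in the ball of radius b / 2; they cannot go on for ever, since f is
    continuous at any point where they accumulate. *)
Lemma rescaling_point (f : G -> N) (y0 : V) (r A : R) : F f -> 0 < r -> 0 < A ->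
  nrm y0 + A <= b / 2 -> ~ tame f y0 r ->
  exists (y : V) (j : nat), [/\ nrm y + A / 2 ^+ j <= nrm y0 + A, ~ tame f y (r / 4 ^+ j) &
    forall y', nrm (y' - y) <= A / 2 ^+ j / 2 -> tame f y' (r / 4 ^+ j / 4)].
Proof.
move=> Ff r0 A0 yA nt; apply: contrapT => nex.
pose I y j := nrm y + A / 2 ^+ j <= nrm y0 + A /\ ~ tame f y (r / 4 ^+ j).
have step (q : V * nat) : exists y', I q.1 q.2 -> I y' q.2.+1.
  case: q => y j /=; have [[I1 I2]|nI] := pselect (I y j); last by exists 0.
  apply: contrapT => ny'; apply: nex; exists y, j; split => // y' y'y.
  apply: contrapT => nt'; apply: ny'; exists y' => _; split; last first.
    by move: nt'; rewrite exprSr invfM mulrA.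
  have E : A / 2 ^+ j.+1 = A / 2 ^+ j / 2 by rewrite exprSr invfM mulrA.
  have := nrmD (y' - y) y; rewrite subrK E; lra.
have [next nextP] := choice step.
pose Y j := iteri j (fun i y => next (y, i)) y0.
have YI j : I (Y j) j.
  elim: j => [|j ih]; first by rewrite /I expr0 !divr1.
  exact: (nextP (Y j, j)).
have pick j : exists v, nrm v < r / 4 ^+ j /\
    delta < d (f (p0 * X (Y j))%g) (f (p0 * X (Y j) * X v)%g).
  apply: contrapT => nv; apply: (YI j).2 => v vr; rewrite leNgt; apply/negP => h.
  by apply: nv; exists v.
have [v vP] := choice pick.
have Yb j : nrm (Y j) <= b / 2.
  have [h _] := YI j; have : 0 < A / 2 ^+ j by rewrite divr_gt0 // exprn_gt0.
  lra.
have [l lb Yl] := @ultra_cvg_bounded R _ U UU m Y (b / 2) (filterE _ Yb).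
have lb' : nrm l < b by have := b0; lra.
have ls : nrm l <= s by have := bs; lra.
have [fc _] := comp_hol Ff ls (bO lb').
have d2 : 0 < delta / 2 by rewrite divr_gt0.
have := near_continuous fc (nbhs_dball dP (f (p0 * X l)%g) d2).
move/nbhs_nrmP => [t t0 tP].
have t2 : 0 < t / 2 by rewrite divr_gt0.
have s2 : 0 < Num.min s (t / 2 / c) by rewrite lt_min s0 divr_gt0.
have e1 : U [set j | nrm (Y j - l) < t / 2] by move/cvg_nrmP: Yl; apply.
have e2 := natV_cvg Uoo r s2.
have [j [/= j1 j2]] := filter_ex (filterI e1 e2).
have [v1 v2] := vP j.
have vj : nrm (v j) < Num.min s (t / 2 / c).
  apply: lt_trans v1 (le_lt_trans _ j2); apply: ler_wpM2l; first exact: ltW.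
  rewrite lef_pV2 ?posrE ?exprn_gt0 // -natrX ler_nat.
  exact: ltn_expl.
move: vj; rewrite lt_min ltr_pdivlMr // => /andP[vs vt].
have Ys : nrm (Y j) <= s by have := bs; have := Yb j; have := b0; lra.
have [y' y'1 y'2] := X_mul Ys (ltW vs).
move: v2; apply/negP; rewrite -leNgt -mulgA y'2.
have h1 : d (f (p0 * X l)%g) (f (p0 * X (Y j))%g) < delta / 2 by apply: tP => /=; lra.
have h2 : d (f (p0 * X l)%g) (f (p0 * X y')%g) < delta / 2.
  apply: tP => /=; have := nrm_tri (Y j) y' l; move: y'1 vt; rewrite mulrC; lra.
have := dist_tri dP (f (p0 * X l)%g) (f (p0 * X (Y j))%g) (f (p0 * X y')%g).
rewrite (dist_sym dP (f (p0 * X (Y j))%g) (f (p0 * X l)%g)); move: h1 h2; lra.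
Qed.

(** Starting with A / r = k + 1, the ball of radius A / 2 around y, where f is
    tame at a quarter of the scale r, is large compared with r. *)
Lemma rescaling_centres : ~ normal_at Omega F p0 -> forall k : nat,
  exists (f : G -> N) (y : V) (r A : R),
    [/\ F f, 0 < r, r * k.+1%:R <= A, nrm y + A <= Num.min (b / 2) k.+1%:R^-1 &
        ~ tame f y r] /\ forall y', nrm (y' - y) <= A / 2 -> tame f y' (r / 4).
Proof.
move=> nF k; set R0 := Num.min _ _.
have R00 : 0 < R0 by rewrite lt_min !divr_gt0 /= ?invr_gt0 ?ltr0n.
pose A := R0 / 2; have A0 : 0 < A by rewrite divr_gt0.
pose r := A / k.+1%:R; have r0 : 0 < r by rewrite divr_gt0.
have rA : r <= A by rewrite ler_pdivrMr // ler_peMr ?(ltW A0) // ler1n.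
have [f [y0 [Ff y0r nt]]] : exists f y, [/\ F f, nrm y < r & ~ tame f y r].
  apply: contrapT => nex; apply: nF; apply: (uniformly_tame_normal r0) => f y Ff yr.
  by apply: contrapT => nt; apply: nex; exists f, y.
have yA : nrm y0 + A <= R0 by rewrite /A in rA *; lra.
have Rb : R0 <= b / 2 by rewrite ge_min lexx.
have [y [j [h1 h2 h3]]] := rescaling_point Ff r0 A0 (le_trans yA Rb) nt.
exists f, y, (r / 4 ^+ j), (A / 2 ^+ j); split => //; split => //.
- by rewrite divr_gt0 // exprn_gt0.
- rewrite mulrAC /r divfK ?pnatr_eq0 //.
  apply: ler_wpM2l; first exact: ltW.
  by rewrite lef_pV2 ?posrE ?exprn_gt0 // lerXn2r ?nnegrE ?ler0n // ler_nat.
- exact: le_trans h1 yA.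
Qed.

(** After rescaling by r, tameness at the scale r / 4 becomes tameness at a scale
    independent of k, and the ball where it holds exhausts the space because
    A / r tends to infinity. *)
Lemma rescaled_family (f : nat -> G -> N) (y : nat -> V) (r A : nat -> R) :
  (forall k, [/\ F (f k), 0 < r k, r k * k.+1%:R <= A k,
     nrm (y k) + A k <= Num.min (b / 2) k.+1%:R^-1 &
     forall y', nrm (y' - y k) <= A k / 2 -> tame (f k) y' (r k / 4)]) ->
  forall L : R, 0 <= L -> \forall k \near \oo, forall z, nrm z <= L ->
  [/\ nrm ((r k)%:C *: z) <= s, Omega (p0 * X (y k) * X ((r k)%:C *: z))%g,
      mhol (fun w => f k (p0 * X (y k) * X ((r k)%:C *: w))%g) z &
      forall w, nrm w <= L -> nrm (w - z) < (4 * c)^-1 ->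
        d (f k (p0 * X (y k) * X ((r k)%:C *: z))%g)
          (f k (p0 * X (y k) * X ((r k)%:C *: w))%g) <= delta].
Proof.
move=> H L L0.
pose B := L / s + 2 * c * L.
have Ls0 : 0 <= L / s by apply: divr_ge0 => //; exact: ltW.
have cL0 : 0 <= 2 * c * L by rewrite !mulr_ge0 // ltW.
have B0 : 0 <= B by exact: addr_ge0.
exists (Num.bound B) => // k /= Bk z zL.
have [Ff r0 rA yA tameF] := H k.
have kB : B <= k.+1%:R.
  apply: le_trans (ltW (archi_boundP B0)) _; by rewrite ler_nat leqW.
have k1 : 1 <= k.+1%:R :> R by rewrite ler1n.
have k2 : k.+1%:R^-1 <= 1 :> R by rewrite invf_le1.
have Lk : L <= k.+1%:R * s by rewrite -ler_pdivrMr //; rewrite /B in kB; lra.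
have cLk : 2 * c * L <= k.+1%:R by rewrite /B in kB; lra.
move: yA; rewrite le_min => /andP[yA yA1].
have y0 := nrm_ge0 (y k).
have A1 : A k <= 1 := le_trans (le_trans (ler_wpDl y0 (lexx (A k))) yA1) k2.
have A0 : 0 < A k by apply: lt_le_trans rA; rewrite mulr_gt0.
have rL : r k * L <= s.
  apply: le_trans (_ : r k * (k.+1%:R * s) <= _); first by apply: ler_wpM2l => //; exact: ltW.
  rewrite mulrA; apply: le_trans (ler_wpM2r (ltW s0) (le_trans rA A1)) _; by rewrite mul1r.
have crL : c * (r k * L) <= A k / 2.
  have : r k * (2 * c * L) <= A k.
    by apply: le_trans rA; apply: ler_wpM2l => //; exact: ltW.
  have -> : r k * (2 * c * L) = c * (r k * L) * 2 by ring.
  by lra.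
have nr (x : V) : nrm ((r k)%:C *: x) = r k * nrm x by rewrite nrmZ nrmR gtr0_norm.
have small (x : V) : nrm x <= L -> nrm ((r k)%:C *: x) <= s.
  move=> xL; rewrite nr; apply: le_trans rL; apply: ler_wpM2l => //; exact: ltW.
have ys : nrm (y k) <= s by have := bs; have := b0; lra.
have [y' y'1 y'2] := X_mul ys (small z zL).
have y'A : nrm (y' - y k) <= A k / 2.
  apply: le_trans y'1 (le_trans _ crL); rewrite nr.
  by apply: ler_wpM2l; [exact: ltW|apply: ler_wpM2l => //; exact: ltW].
have y'b : nrm y' < b by have := nrmD (y' - y k) (y k); rewrite subrK; have := b0; lra.
have E : (p0 * X (y k) * X ((r k)%:C *: z))%g = (p0 * X y')%g by rewrite -mulgA y'2.
have OE : Omega (p0 * X (y k) * X ((r k)%:C *: z))%g by rewrite E; exact: bO.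
split => //; first exact: small.
- have hZ := (hdiffZ (r k)%:C z).1.
  exact: (mhol_comp hZ (comp_hol Ff (small z zL) OE)).1.
- move=> w wL wz; have [v v1 v2] := X_quot (small z zL) (small w wL).
  have -> : (p0 * X (y k) * X ((r k)%:C *: w) = p0 * X y' * X v)%g by rewrite v2 -E !mulgA.
  rewrite E; apply: (tameF _ y'A); apply: le_lt_trans v1 _.
  rewrite -scalerBr nr mulrCA ltr_pM2l //.
  by rewrite mulrC -ltr_pdivlMr // -invfM.
Qed.

(** The rescaled maps form an equicontinuous family of holomorphic maps, so they
    have a holomorphic limit. It is not constant: since f is not tame at y at
    the scale r, the k-th rescaled map moves 0 to some point of the unit ball by
    more than delta. *)
Lemma zalcman : ~ normal_at Omega F p0 ->
  exists (f : nat -> G -> N) (p : nat -> G) (r : nat -> R) (phi : V -> N),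
  [/\ forall k, F (f k), forall k, Omega (p k), p @ \oo --> p0, forall k, 0 < r k &
      r @ \oo --> (0 : R)] /\
  [/\ forall z, mhol phi z, ~ (exists q, forall z, phi z = q) &
      forall L e : R, 0 <= L -> 0 < e -> \forall k \near \oo, forall z, nrm z <= L ->
        [/\ nrm ((r k)%:C *: z) <= s, Omega (p k * X ((r k)%:C *: z))%g &
            d (f k (p k * X ((r k)%:C *: z))%g) (phi z) < e]].
Proof.
move=> /rescaling_centres centres.
have [f fP] := choice centres; have [y yP] := choice fP.
have [r rP] := choice yP; have [A AP] := choice rP => {centres fP yP rP}.
have rescaled : forall k, [/\ F (f k), 0 < r k, r k * k.+1%:R <= A k,
     nrm (y k) + A k <= Num.min (b / 2) k.+1%:R^-1 &
     forall y', nrm (y' - y k) <= A k / 2 -> tame (f k) y' (r k / 4)].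
  by move=> k; have [[? ? ? ? _] ?] := AP k.
pose h k z := f k (p0 * X (y k) * X ((r k)%:C *: z))%g.
pose r1 := (4 * c)^-1; have r10 : 0 < r1 by rewrite invr_gt0 mulr_gt0.
have hypL (L : R) (L0 : 0 <= L) := Uoo (rescaled_family rescaled L0).
have hyp z : U [set i | forall w, nrm (w - z) < r1 -> mhol (h i) w /\ d (h i z) (h i w) <= delta].
  have L0 : 0 <= nrm z + r1 by rewrite addr_ge0 ?nrm_ge0 // ltW.
  apply: filterS (hypL _ L0) => i H w wz.
  have wL : nrm w <= nrm z + r1 by have := nrmD (w - z) z; rewrite subrK; lra.
  have zL : nrm z <= nrm z + r1 by lra.
  by split; [have [_ _ hm _] := H w wL|have [_ _ _ hd] := H z zL; exact: hd].
have [phi phiP] := choice (fun z => ultra_lim N_compact UU (h ^~ z)).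
have phi_hol z : mhol phi z by exact: (ultra_holomorphic dP UU deltaP r10 (hyp z) (fun w _ => phiP w)).
have unif (k : nat) : U [set i | forall w, nrm w <= k%:R -> d (h i w) (phi w) < k.+1%:R^-1].
  apply: (ultra_uniform dP UU (@nrm_ball_compact R m k%:R)); last by rewrite invr_gt0.
    by move=> z _; apply: filterE => w; exact: phiP.
  move=> z _ e e0.
  have [eta eta0 H] := ultra_equicontinuous dP UU deltaP r10 (hyp z) (phiP z) e0.
  apply: (@ultra_near R n N d U _ h z [set w | nrm (w - z) < eta]) => //.
  by apply/nbhs_nrmP; exists eta.
pose Q k : set nat := [set i | forall z, nrm z <= k%:R ->
  [/\ nrm ((r i)%:C *: z) <= s, Omega (p0 * X (y i) * X ((r i)%:C *: z))%g &
      d (h i z) (phi z) < k.+1%:R^-1]].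
have QU k : U (Q k).
  apply: filterS (filterI (hypL _ (ler0n R k)) (unif k)) => i [H1 H2] z zk.
  by have [? ? _ _] := H1 z zk; split => //; exact: H2.
have [t tS tQ] := ultra_subsequence Uoo QU.
have inv0 : (fun k => k.+1%:R^-1 : R) @ \oo --> (0 : R) by exact: cvg_harmonic.
exists (f \o t), (fun k => p0 * X (y (t k)))%g, (r \o t), phi; split; split => //.
- by move=> k /=; have [] := rescaled (t k).
- move=> k; have z0 : nrm (0 : V) <= k%:R by rewrite nrm0 ler0n.
  by have [_ + _] := tQ k 0 z0; rewrite scaler0 X0 mulg1.
- apply: (@cvg_subseq _ (fun k => p0 * X (y k))%g _ t tS).
  have z0 : nrm (0 : V) <= s by rewrite nrm0 ltW.
  have [Xc _] := translate_hol p0 z0.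
  rewrite -[X in _ --> X]mulg1 -X0.
  apply: (@continuous_cvg _ _ _ _ _ y (fun w => p0 * X w)%g 0) => //.
  apply/cvg_nrmP => e e0; move/cvgr0Pnorm_lt: inv0 => /(_ e e0).
  apply: filterS => k; rewrite subr0 ger0_norm ?invr_ge0 //; apply: le_lt_trans.
  have [_ r0 rA + _] := rescaled k; rewrite le_min => /andP[_]; apply: le_trans.
  by rewrite lerDl; apply: le_trans rA; rewrite mulr_ge0 // ltW.
- by move=> k /=; have [] := rescaled (t k).
- apply: (@cvg_subseq _ r _ t tS); apply/cvgr0Pnorm_lt => e e0.
  move/cvgr0Pnorm_lt: inv0 => /(_ e e0).
  apply: filterS => k; rewrite ger0_norm ?invr_ge0 //; apply: le_lt_trans.
  have [_ r0 rA + _] := rescaled k; rewrite le_min => /andP[_ yA].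
  rewrite gtr0_norm //; apply: le_trans (le_trans _ yA).
    by apply: le_trans (_ : r k * k.+1%:R <= _); rewrite ?ler_peMr ?ler1n // ltW.
  by apply: le_trans rA _; rewrite lerDr nrm_ge0.
- move=> [q phiq].
  have d2 : 0 < delta / 2 by rewrite divr_gt0.
  have [k [/= k1 k2]] : exists k : nat, k.+1%:R^-1 < delta / 2 /\ (1 <= k)%N.
    (* k = 0 is avoided: the unit ball has to lie in the ball of radius k *)
    move/cvgr0Pnorm_lt: inv0 => /(_ _ d2) [k _ kP]; exists k.+1; split => //.
    by have := kP k.+1 (leqnSn k); rewrite ger0_norm ?invr_ge0.
  have [[_ r0 _ _ nt] _] := AP (t k); apply: nt => v vr.
  have z0 : nrm (0 : V) <= k%:R by rewrite nrm0 ler0n.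
  have [_ _ h1] := tQ k 0 z0.
  have zv : nrm ((r (t k))^-1%:C *: v) <= k%:R.
    apply: le_trans (_ : 1 <= _); last by rewrite ler1n.
    by rewrite nrmZ nrmR gtr0_norm ?invr_gt0 // mulrC ler_pdivrMr // mul1r ltW.
  have [_ _ h2] := tQ k _ zv.
  move: h1 h2; rewrite /h scaler0 X0 mulg1 scalerA -rmorphM divff ?gt_eqF // scale1r !phiq.
  move=> h1 h2; have := dist_tri dP q (f (t k) (p0 * X (y (t k)))%g) (f (t k) (p0 * X (y (t k)) * X v)%g).
  rewrite (dist_sym dP q); move: (k.+1%:R^-1 : R) k1 h1 h2 => j; lra.
- move=> L e L0 e0.
  have [k1 _ k1P] : \forall k \near \oo, k.+1%:R^-1 < e.
    move/cvgr0Pnorm_lt: inv0 => /(_ e e0); apply: filterS => k.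
    by rewrite ger0_norm ?invr_ge0.
  exists (maxn k1 (Num.bound L)) => // k /=; rewrite geq_max => /andP[kk kL] z zL.
  have zk : nrm z <= k%:R.
    by apply: le_trans zL (le_trans (ltW (archi_boundP L0)) _); rewrite ler_nat.
  by have [? ? h3] := tQ k z zk; split => //; apply: lt_trans h3 (k1P k kk).
Qed.

End Rescaling.

Lemma compact_nrm_bounded {R : realType} (V : normedModType R[i]) (K : set V) :
  compact K -> exists2 L : R, 0 <= L & forall z, K z -> nrm z <= L.
Proof.
move=> cK.
suff [k _ kP] : \forall k \near \oo, forall z, K z -> nrm z <= k%:R.
  by exists k%:R; [exact: ler0n|exact: kP k (leqnn k)].
apply: ((compact_near_coveringP K).1 cK nat \oo (fun k z => nrm z <= k%:R) _) => z Kz.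
exists ([set w | nrm (w - z) < 1], [set k : nat | nrm z + 1 <= k%:R]).
  split; first by apply/nbhs_nrmP; exists 1.
  exists (Num.bound (nrm z + 1)) => // k /= kP.
  have h : 0 <= nrm z + 1 by rewrite addr_ge0 ?nrm_ge0.
  by apply: le_trans (ltW (archi_boundP h)) _; rewrite ler_nat.
move=> [w k] [/= h1 h2]; have := nrmD (w - z) z; rewrite subrK; lra.
Qed.

Theorem corollary1p2 (R : realType) (m n : nat) (G : complexLieGroup R m)
    (Omega : set G) (Omega_open : open Omega) (Omega_conn : connected Omega)
    (eps : m.-tuple (tangent (1%g : G))) (eps_basis : basis_of fullv eps)
    (N : hermitianManifold R n) (N_compact : compact [set: N])
    (d : N -> N -> R) (d_dist : distance_on d)
    (F : set (G -> N)) (F_hol : forall f, F f -> holomorphic_on Omega f)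
    (p0 : G) (Omega_p0 : Omega p0) :
  ~ normal_at Omega F p0 <->
  exists (f : nat -> G -> N) (p : nat -> G) (rho : nat -> R),
    [/\ forall j, F (f j),
        forall j, Omega (p j),
        p j @[j --> \oo] --> p0,
        forall j, 0 < rho j &
        rho j @[j --> \oo] --> (0 : R)] /\
    let E (j : nat) (z : 'rV[R[i]]_m) : G :=
      exp_at (p j)
        ((rho j)%:C *: dL (p j) 1%g (\sum_(k < m) z ord0 k *: tnth eps k)) in
    exists phi : 'rV[R[i]]_m -> N,
      [/\ holomorphic_from phi,
          ~ (exists c : N, forall z, phi z = c) &
          cvg_on_compacts d (fun j => [set z | Omega (E j z)])
            (fun j => f j \o E j) phi].
Proof.
have hol f p (Ff : F f) (Op : Omega p) : hol_at f p := (holomorphic_onE Omega f).1 (F_hol f Ff) p Op.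
have [X [s [c [s0 c0 X0 X_exp [X_hol X_quot X_mul X_nbhs]]]]] := exp_frame eps_basis.
split.
- move=> nF.
  have [U [UU Uoo]] := nat_ultra.
  have [delta deltaP] := chart_scale_ex N_compact d_dist UU Uoo.
  have [b bP] := coord_ball_ex Omega_open Omega_p0 s0 X0 X_hol.
  have [f [p [r [phi [seqs [phi_hol phi_nc H]]]]]] :=
    zalcman Omega_open Omega_p0 N_compact d_dist hol s0 c0 X0 X_hol X_quot X_mul X_nbhs
      UU Uoo deltaP bP nF.
  exists f, p, r; split => // E; exists phi; split => //.
    exact: (holomorphic_fromE phi).2.
  move=> K /compact_nrm_bounded [L L0 KL]; split.
    have [J _ JP] := H L 1 L0 ltr01.
    exists J => // j Jj z Kz; have [h1 h2 _] := JP j Jj z (KL z Kz).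
    by rewrite /E /= X_exp.
  move=> e e0; have [J _ JP] := H L e L0 e0.
  exists J => // j Jj z Kz; have [h1 _ h2] := JP j Jj z (KL z Kz).
  by rewrite /E /= X_exp.
move=> [f [p [r [[Ff Op pp0 r0 rho0] /= [phi [_ phi_nc phi_cvg]]]]]] nF.
apply: phi_nc; exists (phi 0) => z; apply: contrapT => zne.
pose E (j : nat) (z : 'rV[R[i]]_m) : G :=
  exp_at (p j) ((r j)%:C *: dL (p j) 1%g (\sum_(k < m) z ord0 k *: tnth eps k)).
(* for fixed z the points E j z tend to p0, whereas their images do not
   approach each other *)
have E_p0 (z' : 'rV[R[i]]_m) : E ^~ z' @ \oo --> p0.
  have scale0 e : 0 < e -> \forall j \near \oo, nrm ((r j)%:C *: z') < e.
    move=> e0; have h : 0 < e / (nrm z' + 1) by rewrite divr_gt0 // ltr_wpDl ?nrm_ge0.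
    move/cvgr0Pnorm_lt: rho0 => /(_ _ h); apply: filterS => j.
    rewrite ltr_pdivlMr ?ltr_wpDl ?nrm_ge0 // nrmZ nrmR; apply: le_lt_trans.
    by apply: ler_wpM2l => //; rewrite lerDl.
  have X1 : X ((r j)%:C *: z') @[j --> \oo] --> (1%g : G).
    rewrite -X0; have z0 : nrm (0 : 'rV[R[i]]_m) <= s by rewrite nrm0 ltW.
    have [Xc _] := X_hol 0 z0.
    apply: (@continuous_cvg _ _ _ _ _ (fun j => (r j)%:C *: z') X 0) => //.
    by apply/cvg_nrmP => e e0; under eq_near do rewrite subr0; exact: scale0.
  have pX : (p j * X ((r j)%:C *: z'))%g @[j --> \oo] --> p0.
    rewrite -[X in _ --> X]mulg1.
    apply: (@cvg_comp _ _ _ (fun j => (p j, X ((r j)%:C *: z'))) (fun x : G * G => x.1 * x.2)%g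
      \oo (nbhs (p0, 1%g))); first exact: cvg_pair pp0 X1.
    exact: (mulg_continuous (p0, 1%g)).
  move=> A /pX [J1 _ J1P]; have [J2 _ J2P] := scale0 s s0.
  exists (maxn J1 J2) => // j; rewrite /= geq_max => /andP[j1 j2].
  rewrite /E X_exp; first exact: J1P.
  exact: ltW (J2P j j2).
pose eta := d (phi z) (phi 0) / 3.
have eta0 : 0 < eta.
  rewrite divr_gt0 // lt_neqAle dist_ge0 // andbT eq_sym; apply/eqP => h.
  by apply: zne; case: d_dist => dE _ _ _; exact/dE.
have f_cont g q : F g -> Omega q -> {for q, continuous g} by move=> Fg Oq; have [] := hol g q Fg Oq.
apply: (normal_not_separating N_compact d_dist f_cont nF Ff (E_p0 z) (E_p0 0) eta0).
have [_ cz] := phi_cvg [set z] (@compact_set1 _ z).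
have [_ c00] := phi_cvg [set (0 : 'rV[R[i]]_m)] (compact_set1 (x := 0 : 'rV[R[i]]_m)).
have [J1 _ J1P] := cz eta eta0; have [J2 _ J2P] := c00 eta eta0.
exists (maxn J1 J2) => // j; rewrite /= geq_max => /andP[j1 j2].
have h1 : d (f j (E j z)) (phi z) < eta by exact: J1P j j1 z erefl.
have h2 : d (f j (E j 0)) (phi 0) < eta by exact: J2P j j2 0 erefl.
apply: (dist_separation d_dist _ h1 h2).
by rewrite /eta mulrC divfK // pnatr_eq0.
Qed.
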